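(* Let $W_0:\mathbb{R}\to\mathbb{R}$ be the viscous shock $W_0(x)=1-e^{-x}$ for $x>0$ and $W_0(x)=-(1-e^{x})$ for $x<0$ (i.e. $W_0(x)=\mathrm{sign}(x)(1-e^{-|x|})$). For every $\epsilon>0$ there is $\delta>0$ such that every odd function $w_0$ satisfying $\|w_0-W_0\|_{H^2(\mathbb{R})}<\delta$ generates a unique odd solution $w(t,x)$ of the modular Burgers equation $$\partial_t w=\partial_x |w|+\partial_x^2 w$$ with $w(0,x)=w_0(x)$, satisfying $$\|w(t,\cdot)-W_0\|_{H^2(\mathbb{R})}<\epsilon \quad\text{for all } t>0$$ and $$\|w(t,\cdot)-W_0\|_{W^{2,\infty}(\mathbb{R})}\to 0 \quad\text{as } t\to+\infty.$$ The solution belongs to the class of functions with $w-W_0\in C(\mathbb{R}_+,H^2(\mathbb{R}))$.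
   Context: $H^k(\mathbb{R})$ and $W^{k,\infty}(\mathbb{R})$ denote the standard Sobolev spaces. For odd solutions the modular Burgers equation is understood as follows: $w(t,\cdot)$ is odd in $x$, and its restriction to $x>0$ solves the boundary-value problem $w_t=w_x+w_{xx}$ for $x>0$, $w(t,0)=0$, $w(t,x)\to 1$ as $x\to+\infty$, subject to the positivity condition $w(t,x)>0$ for $x>0$; classical solutions satisfy $w_x(t,0^+)+w_{xx}(t,0^+)=0$, and the odd extension to $\mathbb{R}$ is piecewise $C^2$ with the interface condition $w_{xx}(t,0^+)-w_{xx}(t,0^-)=-2w_x(t,0)$. *)

(* Defs.v *)
From HB Require Import structures.
From mathcomp Require Import all_boot all_order all_algebra.
From mathcomp Require Import all_classical all_reals all_analysis.
Set Implicit Arguments. Unset Strict Implicit. Unset Printing Implicit Defensive.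
Import Order.TTheory GRing.Theory Num.Theory.
Import numFieldNormedType.Exports.
Local Open Scope classical_set_scope.
Local Open Scope ring_scope.

Section Defs.
Variable R : realType.
Notation mu := (@lebesgue_measure R).

Definition W0 (x : R) : R := Num.sg x * (1 - expR (- `|x|)).

Definition odd_fun (f : R -> R) : Prop := forall x, f (- x) = - f x.

Definition L2 (f : R -> R) : Prop :=
  measurable_fun setT f /\ mu.-integrable setT (fun x => ((f x) ^+ 2)%:E).

Definition smooth_fun (phi : R -> R) : Prop :=
  forall (n : nat) (x : R), derivable (iter n (@derive1 R R) phi) x 1.
Definition test_fun (phi : R -> R) : Prop :=
  smooth_fun phi /\ exists M : R, forall x, M < `|x| -> phi x = 0.

Definition weak_deriv (f g : R -> R) : Prop :=
  forall phi, test_fun phi ->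
    (\int[mu]_x (f x * (derive1 phi) x)%:E = - \int[mu]_x (g x * phi x)%:E)%E.

Definition H2_norm_lt (f : R -> R) (e : R) : Prop :=
  exists g1 g2 : R -> R,
    [/\ L2 f, L2 g1, L2 g2, weak_deriv f g1 /\ weak_deriv g1 g2 &
      Rintegral mu setT (fun x => f x ^+ 2 + g1 x ^+ 2 + g2 x ^+ 2) < e ^+ 2].

Definition W2inf_norm_le (f : R -> R) (e : R) : Prop :=
  exists g1 g2 : R -> R,
    [/\ measurable_fun setT f, measurable_fun setT g1, measurable_fun setT g2,
      weak_deriv f g1 /\ weak_deriv g1 g2 &
      {ae mu, forall x, [/\ `|f x| <= e, `|g1 x| <= e & `|g2 x| <= e]}].

(** Odd solution of the modular Burgers equation with initial datum w0,
    understood (for odd solutions) as the boundary value problem on x > 0: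
    w_t = w_x + w_xx (x > 0), w(t,0) = 0, w(t,x) -> 1 as x -> +oo,
    w(t,x) > 0 for x > 0. *)
Definition mburgers_sol (w : R -> R -> R) (w0 : R -> R) : Prop :=
  [/\ (forall x, w 0 x = w0 x),
      (forall t, 0 <= t -> odd_fun (w t)),
      (forall t x, 0 < t -> 0 < x ->
         [/\ derivable (fun s => w s x) t 1, derivable (w t) x 1,
             derivable (derive1 (w t)) x 1 &
             derive1 (fun s => w s x) t
               = derive1 (w t) x + derive1 (derive1 (w t)) x]),
      (forall t x, 0 < t -> 0 < x -> 0 < w t x) &
      (forall t, 0 < t -> w t x @[x --> +oo] --> (1 : R))].

Definition H2_class (w : R -> R -> R) : Prop :=
  (forall t, 0 <= t -> exists e, H2_norm_lt (fun x => w t x - W0 x) e) /\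
  (forall t0, 0 <= t0 -> forall eps, 0 < eps -> exists d, 0 < d /\
     forall t, 0 <= t -> `|t - t0| < d ->
       H2_norm_lt (fun x => w t x - w t0 x) eps).

End Defs.

(* Main.v *)
(** For odd data the problem is linear: on [x > 0] write [w = W0 + f]; then
    [f_t = f_x + f_xx] and [f(t, 0) = 0].  If [u] solves this equation on the line,
    so does [expR (- x) * u t (- x)]; the method of images thus expresses [f] by
    Gaussian averages of the datum [f0] and of a reflected copy weighted by
    [expR (- x)].  Since [f0 0 = 0], integration by parts shows that [f_x] and [f_xx]
    are given by the same formula with the pairs of data [(f0', f0' + f0)] and
    [(f0'', - (f0'' + 2 f0') - f0)].  Gaussian averaging contracts [L^2], is strongly
    continuous in time, and maps [L^2] to [L^oo] with norm [O(t^(-1/4))], which gives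
    stability, continuity in [H^2], and decay in [W^(2,oo)].  Positivity and
    uniqueness follow from a weak maximum principle on the half line, applied to
    [w - W0 / 2] and to the difference of two solutions. *)

Require Import Defs.
From HB Require Import structures.
From mathcomp Require Import all_boot all_order all_algebra.
From mathcomp Require Import all_classical all_reals all_analysis.
From mathcomp Require Import measurable_realfun.
From mathcomp Require Import ring lra.
Set Implicit Arguments. Unset Strict Implicit. Unset Printing Implicit Defensive.
Import Order.TTheory GRing.Theory Num.Theory.
Import numFieldNormedType.Exports.
Local Open Scope classical_set_scope.
Local Open Scope ring_scope.

(** Every Gaussian average is an expectation over one fixed standard normal variable, time entering
    only through the point of evaluation. Time zero is then not singular, and strong continuity, at
    zero included, reduces to continuity of translations in [L^2], in the form of a bound
    [e + B c^2] on the effect of a shift [c], which can be integrated because the Gaussian has a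
    second moment. The kernel form of the same averages serves to differentiate them.

    Two obstacles shape the rest. The first derivative of the perturbation need not vanish at the
    boundary, so differentiating twice leaves boundary terms; those of the direct and of the
    reflected part cancel, while [f0 0 = 0] removes the others. And the Sobolev norms speak of weak
    derivatives on the whole line, with data known up to null sets: absolutely continuous
    representatives are recovered first, and functions on the half line return to the line by odd
    and even extension. Since [mburgers_sol] imposes no limit at [x = 0] from the right, the
    boundary limits needed for uniqueness come from oddness and the [H^2] class. *)

(** * Affine changes of variable in Lebesgue integrals *)

Definition affine {R : realType} (a b : R) :
  measurableTypeR R -> measurableTypeR R := fun x => a * x + b.

Section affine_substitution.
Context {R : realType}.
Notation mu := (@lebesgue_measure R).
Implicit Types (a b c : R).

Lemma measurable_affine a b : measurable_fun setT (affine a b).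
Proof.
apply: continuous_measurable_fun => x.
apply: cvgD; last exact: cvg_cst.
by apply: cvgM; [exact: cvg_cst|exact: cvg_id].
Qed.

Definition affine_law a b : {measure set (measurableTypeR R) -> \bar R} :=
  measure_function_pushforward__canonical__measure_function_Measure mu (measurable_affine a b).

(** Lebesgue measure is determined by its values on half-open intervals, so the scaled pushforward
    need only be compared with it there. *)
Lemma lebesgue_measure_affine a b (A : set (measurableTypeR R)) :
  0 < a -> measurable A ->
  mu A = (a%:E * mu (affine a b @^-1` A))%E.
Proof.
move=> a0 mA.
pose nu := mscale (NngNum (ltW a0)) (affine_law a b).
have -> : (a%:E * mu (affine a b @^-1` A))%E = nu A by [].
apply: lebesgue_measure_unique => // _ [[u v]] _ <-.
change (mu `]u, v] = a%:E * mu (affine a b @^-1` `]u, v]%classic))%E.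
have -> : affine a b @^-1` `]u, v] = `](u - b) / a, (v - b) / a]%classic.
  apply/seteqP; split => x /=; rewrite !in_itv/= /affine ltr_pdivrMr// ler_pdivlMr//;
  by move=> /andP[? ?]; apply/andP; split; lra.
rewrite !lebesgue_measure_itv/= !lte_fin.
rewrite ltr_pM2r ?invr_gt0// ltrD2r; case: ifPn => _; last by rewrite mule0.
by rewrite -!EFinB -EFinM; congr EFin; field; rewrite gt_eqF.
Qed.

Lemma ge0_integral_affine a b (f : R -> \bar R) : 0 < a ->
  measurable_fun setT f -> (forall x, 0 <= f x)%E ->
  (\int[mu]_x f x = a%:E * \int[mu]_x f (a * x + b)%R)%E.
Proof.
move=> a0 mf f0.
have -> : (\int[mu]_x f x =
    \int[mscale (NngNum (ltW a0)) (affine_law a b)]_x f x)%E.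
  apply: eq_measure_integral => //= A mA _.
  by rewrite (lebesgue_measure_affine b a0 mA).
rewrite ge0_integral_mscale//=.
by rewrite ge0_integral_pushforward//; exact: measurable_affine.
Qed.

Lemma ge0_integralN (f : R -> \bar R) :
  measurable_fun setT f -> (forall x, 0 <= f x)%E ->
  (\int[mu]_x f x = \int[mu]_x f (- x)%R)%E.
Proof.
move=> mf f0.
have -> : (\int[mu]_x f x =
   \int[pushforward mu (-%R : _ -> measurableTypeR R)]_x f x)%E.
  apply: eq_measure_integral => //= A mA _.
  exact/esym/lebesgue_measureN.
by rewrite ge0_integral_pushforward.
Qed.

Lemma measurable_comp_affine a b (f : R -> R) : measurable_fun setT f ->
  measurable_fun setT (fun x => f (a * x + b)).
Proof.
by move=> mf; apply: (measurableT_comp mf); exact: measurable_affine.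
Qed.

Lemma integrable_affine a b (f : R -> R) : 0 < a ->
  mu.-integrable setT (EFin \o f) ->
  mu.-integrable setT (EFin \o (fun x => f (a * x + b))).
Proof.
move=> a0 /integrableP[/measurable_EFinP mf lf]; apply/integrableP; split.
  by apply/measurable_EFinP; exact: measurable_comp_affine.
move: lf; rewrite (@ge0_integral_affine a b)//; last first.
  by apply/measurableT_comp => //; exact/measurable_EFinP.
rewrite /= => lf; apply: contraTT isT => /=; rewrite -leNgt leye_eq => /eqP h.
by move: lf; rewrite h mulry gtr0_sg// mul1e ltxx.
Qed.

Lemma Rintegral_affine a b (f : R -> R) : 0 < a ->
  mu.-integrable setT (EFin \o f) ->
  \int[mu]_x f x = a * \int[mu]_x f (a * x + b).
Proof.
move=> a0 fi; have fi' := integrable_affine b a0 fi.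
have mf : measurable_fun setT (EFin \o f) by case/integrableP : fi.
rewrite -RintegralZl// /Rintegral; congr fine.
under [RHS]eq_integral do rewrite EFinM.
rewrite integralZl// (integralE mu setT (fun x => (f x)%:E)).
rewrite (integralE mu setT (fun x => (f (a * x + b))%:E)).
rewrite (@ge0_integral_affine a b _ a0 (measurable_funepos mf))//.
rewrite (@ge0_integral_affine a b _ a0 (measurable_funeneg mf))//.
have h := integrable_neg_fin_num measurableT fi'.
rewrite [RHS]muleBr//; last by apply: fin_num_adde_defl; rewrite fin_numN.
by congr (_ * _ - _ * _)%E; apply: eq_integral => x _; rewrite ?funeposE ?funenegE.
Qed.
End affine_substitution.

(** * Integrability of real-valued functions *)

Section real_integrable.
Context d (T : measurableType d) (R : realType)
  (nu : {measure set T -> \bar R}) (D : set T).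
Hypothesis mD : measurable D.
Implicit Types f g : T -> R.

Lemma rintegrableD f g : nu.-integrable D (EFin \o f) ->
  nu.-integrable D (EFin \o g) -> nu.-integrable D (EFin \o (fun x => f x + g x)).
Proof.
move=> fi gi; apply: (eq_integrable mD _ _ _ (integrableD mD fi gi)) => x _ /=.
by rewrite EFinD.
Qed.

Lemma rintegrableZ k f : nu.-integrable D (EFin \o f) ->
  nu.-integrable D (EFin \o (fun x => k * f x)).
Proof.
move=> fi; apply: (eq_integrable mD _ _ _ (integrableZl mD k fi)) => x _ /=.
by rewrite EFinM.
Qed.

Lemma rintegrableB f g : nu.-integrable D (EFin \o f) ->
  nu.-integrable D (EFin \o g) -> nu.-integrable D (EFin \o (fun x => f x - g x)).
Proof.
move=> fi gi; apply: (eq_integrable mD _ _ _ (integrableB mD fi gi)) => x _ /=.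
by rewrite EFinB.
Qed.

Lemma rintegrable_le f g : measurable_fun D f ->
  (forall x, D x -> `|f x| <= g x) -> nu.-integrable D (EFin \o g) ->
  nu.-integrable D (EFin \o f).
Proof.
move=> mf fg; apply: le_integrable => //; first exact/measurable_EFinP.
by move=> x Dx /=; rewrite lee_fin (le_trans (fg x Dx))// ler_norm.
Qed.

Lemma rintegrable_meas f : nu.-integrable D (EFin \o f) -> measurable_fun D f.
Proof. by move=> /integrableP[/measurable_EFinP]. Qed.

Lemma RintegralE f : nu.-integrable D (EFin \o f) ->
  (\int[nu]_(x in D) (f x)%:E = (\int[nu]_(x in D) f x)%:E)%E.
Proof. by move=> fi; rewrite /Rintegral fineK//; exact: (integrable_fin_num mD fi). Qed.

End real_integrable.

Arguments rintegrable_le {d T R nu D} mD {f} g _ _ _.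

Lemma ge0_integrable_fin d (T : measurableType d) (R : realType)
    (nu : {measure set T -> \bar R}) (f : T -> R) :
  measurable_fun setT f -> (forall x, 0 <= f x) ->
  (\int[nu]_x (f x)%:E < +oo)%E -> nu.-integrable setT (EFin \o f).
Proof.
move=> mf f0 fi; apply/integrableP; split; first exact/measurable_EFinP.
by under eq_integral => x _ do rewrite /= ger0_norm//.
Qed.

Lemma finite_integrable_cst d (T : measurableType d) (R : realType)
    (nu : {measure set T -> \bar R}) (D : set T) (c : R) :
  measurable D -> (nu D < +oo)%E -> nu.-integrable D (EFin \o (fun=> c)).
Proof.
move=> mD fD; apply/integrableP; split; first exact/measurable_EFinP.
change (\int[nu]_(x in D) (cst `|c|%:E) x < +oo)%E.
by rewrite integral_cst// lte_mul_pinfty// lee_fin.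
Qed.

(** * Averages against the standard Gaussian *)

Section std_gauss.
Context {R : realType}.
Notation mu := (@lebesgue_measure R).

Definition gam (s : R) : R := normal_pdf 0 1 s.

Lemma gam_ge0 s : 0 <= gam s. Proof. exact: normal_pdf_ge0. Qed.
Lemma measurable_gam : measurable_fun setT gam.
Proof. exact: measurable_normal_pdf. Qed.
Lemma integral_gam : (\int[mu]_s (gam s)%:E = 1)%E.
Proof. exact: integral_normal_pdf. Qed.
Lemma integrable_gam : mu.-integrable setT (EFin \o gam).
Proof. exact: integrable_normal_pdf. Qed.
Lemma gam_le1 s : gam s <= 1.
Proof.
rewrite /gam; apply: (le_trans (normal_pdf_ub _ _ _)); rewrite ?oner_neq0//.
rewrite /normal_peak invf_le1 ?sqrtr_gt0; last by rewrite expr1n mul1r pmulrn_lgt0// pi_gt0.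
rewrite -[X in X <= _]sqrtr1 ler_wsqrtr// expr1n mul1r.
by have := pi_ge2 R; rewrite mulr2n; lra.
Qed.

(** The expectation of [K z] at a standard normal variable; the dependence on time will sit inside
    [K]. *)
Definition smear (K : R -> R -> R) (z : R) : R := \int[mu]_s (gam s * K z s).

(** The variance of [h] is nonnegative. The right-hand side is an extended real, since nothing makes
    [h] square integrable here. *)
Lemma jensen_gam (h : R -> R) : measurable_fun setT h ->
  (((\int[mu]_s (gam s * h s)) ^+ 2)%:E <= \int[mu]_s (gam s * h s ^+ 2)%:E)%E.
Proof.
move=> mh.
have mg := measurable_gam.
have m2 : measurable_fun setT (fun s => gam s * h s ^+ 2).
  by apply: measurable_funM => //; exact: measurable_funX.
have m1 : measurable_fun setT (fun s => gam s * h s) by exact: measurable_funM.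
have [->|] := eqVneq (\int[mu]_s (gam s * h s ^+ 2)%:E)%E +oo%E; first by rewrite leey.
move=> fi.
have i2 : mu.-integrable setT (EFin \o (fun s => gam s * h s ^+ 2)).
  apply: ge0_integrable_fin => //; last by rewrite ltey.
  by move=> s; rewrite mulr_ge0 ?sqr_ge0 ?gam_ge0.
have i1 : mu.-integrable setT (EFin \o (fun s => gam s * h s)).
  apply: (rintegrable_le (nu := mu) measurableT (fun s => gam s * h s ^+ 2 + gam s)) => //; last first.
    by apply: rintegrableD => //; exact: integrable_gam.
  move=> s _; rewrite normrM (ger0_norm (gam_ge0 s)).
  rewrite -[X in _ <= _ + X]mulr1 -mulrDr ler_wpM2l ?gam_ge0//.
  by rewrite -[h s ^+ 2]real_normK ?num_real//; have := normr_ge0 (h s); nra.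
set m := (\int[mu]_s (gam s * h s)).
have : 0 <= \int[mu]_s (gam s * (h s - m) ^+ 2).
  by apply: Rintegral_ge0 => y _; rewrite mulr_ge0 ?sqr_ge0 ?gam_ge0.
have -> : \int[mu]_s (gam s * (h s - m) ^+ 2) =
  \int[mu]_s (gam s * h s ^+ 2 - (2 * m) * (gam s * h s) + m ^+ 2 * gam s).
  by apply: eq_Rintegral => y _; ring.
have i1' := rintegrableZ measurableT (2 * m) i1.
have i3 := rintegrableZ measurableT (m ^+ 2) integrable_gam.
have i4 := rintegrableB measurableT i2 i1'.
rewrite RintegralD// RintegralB// !RintegralZl//; last exact: integrable_gam.
have -> : \int[mu]_s gam s = 1 by rewrite /Rintegral integral_gam.
rewrite -/m => h0.
rewrite RintegralE// lee_fin; lra.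
Qed.

Definition meas2 (K : R -> R -> R) : Prop :=
  measurable_fun setT (fun p : measurableTypeR R * measurableTypeR R => K p.1 p.2).

Lemma measurable_Rintegral2 (K : R -> R -> R) :
  meas2 K ->
  measurable_fun setT (fun z => \int[mu]_s K z s).
Proof.
move=> mK.
have mE : measurable_fun setT (fun p : measurableTypeR R * measurableTypeR R => (K p.1 p.2)%:E).
  exact/measurable_EFinP.
apply: (@measurableT_comp _ _ _ _ _ _ fine) => //=.
under eq_fun do rewrite integralE.
apply: emeasurable_funB.
- under eq_fun => z.
    rewrite (_ : (\int[_]_x _ = \int[mu]_s ((fun p : measurableTypeR R * measurableTypeR R => (K p.1 p.2)%:E)^\+ (z, s)))%E).
    over.
  by apply: eq_integral => s _; rewrite !funeposE.
  by apply: measurable_fun_fubini_tonelli_F => //; exact: measurable_funepos.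
- under eq_fun => z.
    rewrite (_ : (\int[_]_x _ = \int[mu]_s ((fun p : measurableTypeR R * measurableTypeR R => (K p.1 p.2)%:E)^\- (z, s)))%E).
    over.
  by apply: eq_integral => s _; rewrite !funenegE.
  by apply: measurable_fun_fubini_tonelli_F => //; exact: measurable_funeneg.
Qed.

Lemma measurable_section (K : R -> R -> R) z :
  meas2 K ->
  measurable_fun setT (K z).
Proof. by move=> mK; exact: (measurableT_comp mK (pair1_measurable z)). Qed.

Lemma measurable_gamK (K : R -> R -> R) :
  meas2 K ->
  meas2 (fun z s => gam s * K z s).
Proof.
move=> mK; apply: measurable_funM; last exact: mK.
by apply: (measurableT_comp measurable_gam); exact: measurable_snd.
Qed.

Lemma measurable_smear K :
  meas2 K ->
  measurable_fun setT (smear K).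
Proof.
move=> mK; apply: measurable_Rintegral2; exact: measurable_gamK.
Qed.

(** Jensen at each [z], then Tonelli so that [z] is integrated first. *)
Lemma smear_L2 (K : R -> R -> R) :
  meas2 K ->
  (\int[mu]_z (smear K z ^+ 2)%:E <=
   \int[mu]_s ((gam s)%:E * \int[mu]_z (K z s ^+ 2)%:E))%E.
Proof.
move=> mK.
have mK2 : meas2 (fun z s => K z s ^+ 2).
  exact: measurable_funX.
have mg2 := measurable_gamK mK2.
apply: (@le_trans _ _ (\int[mu]_z \int[mu]_s (gam s * K z s ^+ 2)%:E)%E).
  apply: ge0_le_integral => //.
  - by move=> z _; rewrite lee_fin sqr_ge0.
  - by apply/measurable_EFinP; apply: measurable_funX; exact: measurable_smear.
  - apply: (@measurable_fun_fubini_tonelli_F _ _ _ _ _ mu (fun p => (gam p.2 * K p.1 p.2 ^+ 2)%:E)) => //.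
      exact/measurable_EFinP.
    by move=> p; rewrite lee_fin mulr_ge0 ?sqr_ge0 ?gam_ge0.
  - move=> z _; apply: jensen_gam; exact: measurable_section.
rewrite (@fubini_tonelli _ _ _ _ _ mu mu (fun p => (gam p.2 * K p.1 p.2 ^+ 2)%:E))//=.
- rewrite le_eqVlt; apply/orP; left; apply/eqP; apply: eq_integral => s _.
  under eq_integral do rewrite EFinM.
  rewrite ge0_integralZl//.
  + by apply/measurable_EFinP; apply: measurable_funX; exact: (measurableT_comp mK (pair2_measurable s)).
  + by move=> z _; rewrite lee_fin sqr_ge0.
  + by rewrite lee_fin gam_ge0.
- exact/measurable_EFinP.
- by move=> p; rewrite lee_fin mulr_ge0 ?sqr_ge0 ?gam_ge0.
Qed.

End std_gauss.

(** * Continuity of translations in [L^2] *)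

Section L2_translation.
Context {R : realType}.
Notation mu := (@lebesgue_measure R).
Implicit Types f g h F G H : R -> R.
Implicit Types a b c : R.

(** The square of the [L^2] norm, with no root taken; extended values allow it to be estimated
    before integrability is known. *)
Definition enorm2 f : \bar R := (\int[mu]_x (f x ^+ 2)%:E)%E.

Lemma enorm2_ge0 f : (0 <= enorm2 f)%E.
Proof. by apply: integral_ge0 => x _; rewrite lee_fin sqr_ge0. Qed.

Lemma L2P f : measurable_fun setT f -> (enorm2 f < +oo)%E -> L2 f.
Proof.
move=> mf nf; split => //; apply: (ge0_integrable_fin (nu := mu)) => //.
- exact: measurable_funX.
- by move=> x; exact: sqr_ge0.
Qed.

Lemma L2_enorm2 f : L2 f -> (enorm2 f < +oo)%E.
Proof.
move=> [mf fi]; rewrite /enorm2.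
by have := integrable_fin_num measurableT fi; rewrite fin_numElt => /andP[].
Qed.

Lemma enorm2_shift f c : measurable_fun setT f -> enorm2 (fun x : R => f (x + c)) = enorm2 f.
Proof.
move=> mf; rewrite /enorm2 (@ge0_integral_affine _ 1 c (fun x : R => (f x ^+ 2)%:E))//.
- by rewrite mul1e; apply: eq_integral => x _; rewrite mul1r.
- by apply/measurable_EFinP; exact: measurable_funX.
- by move=> x; rewrite lee_fin sqr_ge0.
Qed.

Lemma enorm2N f : measurable_fun setT f -> enorm2 (fun x : R => f (- x)) = enorm2 f.
Proof.
move=> mf; rewrite /enorm2 (ge0_integralN (f := fun x : R => (f x ^+ 2)%:E))//.
- by apply/measurable_EFinP; exact: measurable_funX.
- by move=> x; rewrite lee_fin sqr_ge0.
Qed.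

Lemma measurable_shift f c : measurable_fun setT f ->
  measurable_fun setT (fun x : R => f (x + c)).
Proof.
move=> mf; have := measurable_comp_affine 1 c mf.
by under eq_fun do rewrite mul1r.
Qed.

(** Takes the place of the triangle inequality: norms stay squared, and a pointwise inequality
    between squares is integrated. *)
Lemma enorm2_le2 (a b : R) f g h : 0 <= a -> 0 <= b ->
  measurable_fun setT f -> measurable_fun setT g -> measurable_fun setT h ->
  (forall x, f x ^+ 2 <= a * g x ^+ 2 + b * h x ^+ 2) ->
  (enorm2 f <= a%:E * enorm2 g + b%:E * enorm2 h)%E.
Proof.
move=> a0 b0 mf mg mh fgh.
have m2 (k : R -> R) : measurable_fun setT k -> measurable_fun setT (fun x : R => (k x ^+ 2)%:E).
  by move=> mk; apply/measurable_EFinP; exact: measurable_funX.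
have p2 (k : R -> R) (x : R) : (0 <= (k x ^+ 2)%:E)%E by rewrite lee_fin sqr_ge0.
rewrite /enorm2 -!ge0_integralZl//; [|exact: m2..].
rewrite -ge0_integralD//; last 4 first.
- by move=> x _; rewrite mule_ge0// lee_fin.
- by apply: measurable_funeM; exact: m2.
- by move=> x _; rewrite mule_ge0// lee_fin.
- by apply: measurable_funeM; exact: m2.
apply: ge0_le_integral => //.
- exact: m2.
- by apply: emeasurable_funD; apply: measurable_funeM; exact: m2.
- by move=> x _; rewrite -!EFinM -EFinD lee_fin.
Qed.

Definition osc F c : \bar R := enorm2 (fun x : R => F (x + c) - F x).

Lemma osc_le F c : measurable_fun setT F -> (osc F c <= 4%:E * enorm2 F)%E.
Proof.
move=> mF.
have := @enorm2_le2 2 2 (fun x : R => F (x + c) - F x) (fun x : R => F (x + c)) F.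
rewrite enorm2_shift// => /(_ _ _ _ _ mF) h.
have -> : (4%:E = 2%:E + 2%:E :> \bar R)%E by rewrite -EFinD; congr EFin; lra.
rewrite ge0_muleDl; [|by rewrite lee_fin..].
apply: h => //.
- by apply: measurable_funB => //; exact: measurable_shift.
- exact: measurable_shift.
- by move=> x; have := sqr_ge0 (F (x + c) + F x); nra.
Qed.

Lemma osc_approx F H c : measurable_fun setT F -> measurable_fun setT H ->
  (osc F c <= 3%:E * osc H c + 6%:E * enorm2 (fun x : R => F x - H x)%R)%E.
Proof.
move=> mF mH; pose D x := F x - H x.
have mD : measurable_fun setT D by exact: measurable_funB.
have mo G : measurable_fun setT G -> measurable_fun setT (fun x : R => G (x + c) - G x).
  by move=> mG; apply: measurable_funB => //; exact: measurable_shift.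
have oD : (osc D c <= 4%:E * enorm2 D)%E := osc_le c mD.
(* Young's inequality [(p + q)^2 <= 3 p^2 + (3/2) q^2]; the 6 is [3/2] times the 4 of [osc_le]. *)
have := @enorm2_le2 3 (3/2) (fun x : R => F (x + c) - F x) (fun x : R => H (x + c) - H x)
   (fun x : R => D (x + c) - D x) _ _ (mo _ mF) (mo _ mH) (mo _ mD).
move=> h; apply: (le_trans (h _ _ _)); [lra|lra| |].
- by move=> x; rewrite /D; have := sqr_ge0 (2 * (H (x + c) - H x) - (F (x + c) - H (x + c) - (F x - H x))); nra.
rewrite leeD2l// -/(osc D c).
apply: (le_trans (lee_wpmul2l _ oD)); first by rewrite lee_fin; lra.
by rewrite muleA -EFinM (_ : 3 / 2 * 4 = 6)//; field.
Qed.

(** Each point is eventually untouched by the truncation, and the squared error is dominated by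
    [F ^+ 2]. *)
Lemma trunc_approx F : L2 F -> forall e : R, 0 < e -> exists n : nat,
  (enorm2 (fun x : R => F x - (if (`|x| <= n%:R) && (`|F x| <= n%:R) then F x else 0))%R < e%:E)%E.
Proof.
move=> [mF iF] e e0.
pose G n x := if (`|x| <= n%:R) && (`|F x| <= n%:R) then F x else 0.
have mG n : measurable_fun setT (G n).
  apply: measurable_fun_ifT => //.
  apply: measurable_and; apply: measurable_fun_ler => //.
  exact: measurableT_comp.
case: (@dominated_convergence _ _ _ mu setT measurableT
  (fun n x => ((F x - G n x) ^+ 2)%:E) (cst 0%E) (fun x : R => (F x ^+ 2)%:E)) => //.
- by move=> n; apply/measurable_EFinP; apply: measurable_funX; apply: measurable_funB => //; exact: mG.
- apply: aeW => x _; apply: cvg_near_cst.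
  near=> n.
  have -> : G n x = F x.
    rewrite /G ifT//; apply/andP; split; near: n; exact: nbhs_infty_ger.
  by rewrite subrr expr0n.
- apply: aeW => x n _; rewrite /G gee0_abs ?lee_fin ?sqr_ge0//.
  by case: ifP => _; rewrite ?subrr ?subr0 ?expr0n// sqr_ge0.
move=> _ _; rewrite integral0 => /fine_cvgP[fin /cvgr0Pnorm_lt/(_ e e0) h].
near \oo => n; exists n; rewrite -/(G n).
have finn : enorm2 (fun x : R => F x - G n x) \is a fin_num by near: n; exact: fin.
rewrite -(fineK finn) lte_fin (le_lt_trans (ler_norm _))//.
by near: n; exact: h.
Unshelve. all: by end_near. Qed.

Definition clip (M y : R) := if y <= - M then - M else if M <= y then M else y.

Lemma clip_le M y : 0 <= M -> `|clip M y| <= M.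
Proof.
move=> M0; rewrite /clip ler_norml; by case: (lerP y (- M)) => h1; last (case: (lerP M y) => h2); apply/andP; split; lra.
Qed.

Lemma clip_dist M y z : `|z| <= M -> `|z - clip M y| <= `|z - y|.
Proof.
rewrite /clip ler_norml => /andP[zM1 zM2].
case: (lerP y (- M)) => h1.
  have -> : `|z - - M| = z - - M by rewrite ger0_norm; lra.
  by rewrite (le_trans _ (ler_norm _)); lra.
case: (lerP M y) => // h2; have -> : `|z - M| = - (z - M) by rewrite ler0_norm; lra.
by rewrite -normrN (le_trans _ (ler_norm _))//; lra.
Qed.

Lemma clip_lip M y z : 0 <= M -> `|clip M y - clip M z| <= `|y - z|.
Proof.
move=> M0; have := ler_norm (y - z); have := ler_norm (- (y - z)).
rewrite normrN ler_norml /clip.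
by case: (lerP y (- M)) => ?; case: (lerP M y) => ?; case: (lerP z (- M)) => ?;
  case: (lerP M z) => ? ? ?; apply/andP; split; lra.
Qed.

Lemma clip_continuous M (g : R -> R) : 0 <= M -> continuous g -> continuous (fun x : R => clip M (g x)).
Proof.
move=> M0 cg x; apply/cvgrPdist_lt => e e0.
have /cvgrPdist_lt/(_ e e0) := cg x.
by apply: filterS => y; apply: le_lt_trans; exact: clip_lip.
Qed.

(** For continuous [g], a bounded function of bounded support that can be discontinuous only where
    [|x| = n], a null set. *)
Definition cutoff (n : nat) (M : R) (g : R -> R) (x : R) : R :=
  if `|x| <= n%:R then clip M (g x) else 0.

Lemma measurable_cutoff n M g : 0 <= M -> continuous g -> measurable_fun setT (cutoff n M g).
Proof.
move=> M0 cg; apply: measurable_fun_ifT => //.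
  by apply: measurable_fun_ler => //; exact: measurable_normr.
by apply: continuous_measurable_fun; exact: clip_continuous.
Qed.

(** The truncation of [F] is approximated by continuous functions in [L^1] of a bounded interval.
    Clipping at height [n] makes this an [L^2] approximation: the difference of two functions
    bounded by [n] has a square of at most [2 n] times its absolute value. *)
Lemma L2_dense F : L2 F -> forall e : R, 0 < e ->
  exists n M g, [/\ 0 <= M, continuous g & (enorm2 (fun x : R => F x - cutoff n M g x)%R <= e%:E)%E].
Proof.
move=> FL2 e e0; have [n hn] := trunc_approx FL2 (divr_gt0 e0 (ltr0n _ 4)).
pose G x := if (`|x| <= n%:R) && (`|F x| <= n%:R) then F x else 0.
have mF : measurable_fun setT F by case: FL2.
have mG : measurable_fun setT G.
  apply: measurable_fun_ifT => //.
  apply: measurable_and; apply: measurable_fun_ler => //.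
  exact: measurableT_comp.
have Gn x : `|G x| <= n%:R by rewrite /G; case: ifP => [/andP[]//|_]; rewrite normr0.
pose E := `[- n%:R, n%:R]%classic : set R.
have mE : measurable E by exact: measurable_itv.
have muE : (mu E < +oo)%E by rewrite lebesgue_measure_itv/=; case: ifP; rewrite ltry.
have iG : mu.-integrable E (EFin \o G).
  apply: (rintegrable_le (nu := mu) mE (fun=> n%:R)) => //.
    exact: measurable_funTS.
  exact: finite_integrable_cst.
have [g_ [cg ig]] := approximation_continuous_integrable mE muE iG.
(* After multiplication by [2 n] the error is at most [e / 4]; the [+ 1] covers [n = 0]. *)
have e1 : 0 < e / (4 * (2 * n%:R + 1)) by rewrite divr_gt0// mulr_gt0//; have := ler0n R n; lra.
move=> /fine_cvgP[fin /cvgr0Pnorm_lt/(_ _ e1) h].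
near \oo => k.
have fink : (\int[mu]_(z in E) `|(G z - g_ k z)%:E|)%E \is a fin_num by near: k; exact: fin.
have lek : (\int[mu]_(z in E) `|(G z - g_ k z)%:E| <= (e / (4 * (2 * n%:R + 1)))%:E)%E.
  by rewrite -(fineK fink) lee_fin (le_trans (ler_norm _))// ltW//; near: k; exact: h.
exists n, n%:R, (g_ k); split => //.
set H := cutoff n n%:R (g_ k).
have mH : measurable_fun setT H by exact: measurable_cutoff.
have GH : (enorm2 (fun x : R => G x - H x)%R <= (e / 4)%:E)%E.
  apply: (@le_trans _ _ (\int[mu]_(z in E) ((2 * n%:R)%:E * `|(G z - g_ k z)%:E|))%E).
    rewrite [leRHS]integral_mkcond; apply: ge0_le_integral => //.
    - by move=> x _; rewrite lee_fin sqr_ge0.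
    - by apply/measurable_EFinP; apply: measurable_funX; exact: measurable_funB.
    - apply/(measurable_restrictT _ _).1 => //; apply: measurable_funeM; apply: measurableT_comp => //.
      apply/measurable_EFinP; apply: measurable_funB; apply: measurable_funTS => //.
      exact: continuous_measurable_fun.
    - move=> x _; rewrite patchE; case: ifPn => [|].
        rewrite inE /E/= in_itv/= -ler_norml => xn.
        rewrite /= -EFinM lee_fin -[leLHS]real_normK ?num_real// expr2 ler_pM//.
          rewrite (le_trans (ler_normB _ _))// mulr2n mulrDl !mul1r lerD//.
          by rewrite /H /cutoff xn clip_le.
        by rewrite /H /cutoff xn clip_dist.
      rewrite notin_setE /E/= in_itv/= -ler_norml => /negP/negbTE xn.
      by rewrite /G /H /cutoff xn/= subrr expr0n.
  have mGg : measurable_fun E (fun z : R => `|(G z - g_ k z)%:E|%E).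
    apply: measurableT_comp => //.
    apply/measurable_EFinP; apply: measurable_funB; apply: measurable_funTS => //.
    exact: continuous_measurable_fun.
  rewrite ge0_integralZl//.
  apply: (le_trans (lee_wpmul2l _ lek)); first by rewrite lee_fin.
  rewrite -EFinM lee_fin mulrA ler_pdivrMr; last by have := ler0n R n; nra.
  by have := ler0n R n; nra.
have := @enorm2_le2 2 2 (fun x : R => F x - H x) (fun x : R => F x - G x) (fun x : R => G x - H x).
move=> hle; apply: (le_trans (hle _ _ _ _ _ _)) => //; try exact: measurable_funB.
  by move=> x; have := sqr_ge0 (F x - G x - (G x - H x)); nra.
apply: (@le_trans _ _ (2%:E * (e / 4)%:E + 2%:E * (e / 4)%:E)%E).
  by apply: leeD; apply: lee_wpmul2l; rewrite ?lee_fin//; exact: ltW.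
by rewrite -!EFinM -EFinD lee_fin; lra.
Unshelve. all: by end_near. Qed.

Lemma cutoff_continuous_at n (M : R) g (x : R) : 0 <= M -> continuous g -> `|x| != n%:R ->
  {for x, continuous (cutoff n M g)}.
Proof.
move=> M0 cg; rewrite neq_lt => /orP[xn|xn].
- have e : \forall y \near x, clip M (g y) = cutoff n M g y.
    have : `|y| @[y --> x] --> `|x| by exact: norm_continuous.
    move=> /cvgr_lt/(_ _ xn); apply: filterS => y yn.
    by rewrite /cutoff ltW.
  have ex := nbhs_singleton e; rewrite /= in ex.
  change (cutoff n M g y @[y --> x] --> cutoff n M g x); rewrite -ex.
  have h : clip M (g y) @[y --> x] --> clip M (g x) := @clip_continuous M g M0 cg x.
  apply: (cvg_trans _ h); apply: near_eq_cvg; exact: e.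
- have e : \forall y \near x, 0 = cutoff n M g y.
    have : `|y| @[y --> x] --> `|x| by exact: norm_continuous.
    move=> /cvgr_gt/(_ _ xn); apply: filterS => y yn.
    by rewrite /cutoff leNgt yn.
  have ex := nbhs_singleton e; rewrite /= in ex.
  change (cutoff n M g y @[y --> x] --> cutoff n M g x); rewrite -ex.
  by apply: cvg_near_cst; apply: filterS e => y <-.
Qed.

(** By contradiction, which yields a sequence of shifts tending to 0, the form needed for dominated
    convergence. *)
Lemma osc_cutoff n M g : 0 <= M -> continuous g -> forall e : R, 0 < e ->
  exists d : R, 0 < d /\ forall c, `|c| < d -> (osc (cutoff n M g) c <= e%:E)%E.
Proof.
move=> M0 cg e e0; apply: contrapT => nex.
have ex k : exists c, `|c| < k.+1%:R^-1 /\ (e%:E < osc (cutoff n M g) c)%E.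
  apply: contrapT => nk; apply: nex; exists k.+1%:R^-1; split; first by rewrite invr_gt0.
  move=> c ck; rewrite leNgt; apply/negP => h; apply: nk; exists c; split => //.
have [c_ c_P] := choice ex.
have c0 : c_ k @[k --> \oo] --> (0 : R).
  apply/cvgrPdist_lt => r r0; near=> k; rewrite sub0r normrN.
  apply: (lt_trans (c_P k).1); rewrite invf_plt ?posrE//.
  rewrite (@lt_le_trans _ _ k%:R)// ?ler_nat//.
  by near: k; exact: nbhs_infty_gtr.
set H := cutoff n M g.
have mH : measurable_fun setT H by exact: measurable_cutoff.
have HM x : `|H x| <= M by rewrite /H /cutoff; case: ifP => _; rewrite ?clip_le// normr0.
(* All shifts [c_ k] are below 1 in absolute value, so outside [B] both [x] and [x + c_ k] miss the
   support of the cutoff. *)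
pose B := `[- (n%:R + 1), n%:R + 1]%classic : set R.
have mB : measurable B by exact: measurable_itv.
have Hc k x : ~ B x -> H (x + c_ k) - H x = 0.
  rewrite /B/= in_itv/= -ler_norml => /negP; rewrite -ltNge => xn.
  have ck : `|c_ k| < 1 by rewrite (lt_le_trans (c_P k).1)// invf_le1// ler1n.
  have h1 : n%:R < `|x + c_ k|.
    by have := ler_normD (x + c_ k) (- c_ k); rewrite addrK normrN; lra.
  have h2 : n%:R < `|x| by lra.
  by rewrite /H /cutoff !leNgt h1 h2/= subrr.
case: (@dominated_convergence _ _ _ mu setT measurableT
  (fun k x => ((H (x + c_ k) - H x) ^+ 2)%:E) (cst 0%E)
  (EFin \o (fun x : R => (2 * M) ^+ 2 * \1_B x))) => //.
- move=> k; apply/measurable_EFinP; apply: measurable_funX; apply: measurable_funB => //.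
  exact: measurable_shift.
- have mu0 : mu [set n%:R; - n%:R] = 0%E.
    by apply: countable_lebesgue_measure0; apply: finite_set_countable; exact: finite_set2.
  exists [set n%:R; - n%:R]; split => //.
    by apply: measurableU; exact: measurable_set1.
  move=> x /= nP; apply: contrapT => xn; apply: nP => _.
  have xn' : `|x| != n%:R.
    apply/negP => /eqP h; apply: xn => /=; rewrite -h; case: (ger0P x) => _; first by left.
    by right; rewrite opprK.
  have hx : (H (x + c_ k) - H x) ^+ 2 @[k --> \oo] --> (0 : R).
    have h0 : x + c_ k @[k --> \oo] --> x.
      by rewrite -[X in _ --> X]addr0; apply: cvgD => //; exact: cvg_cst.
    have h1 := cvg_comp _ _ h0 (cutoff_continuous_at M0 cg xn').
    have h2 : H (x + c_ k) - H x @[k --> \oo] --> H x - H x.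
      by apply: cvgB; [exact: h1|exact: cvg_cst].
    have h3 : (H (x + c_ k) - H x) * (H (x + c_ k) - H x) @[k --> \oo] --> (H x - H x) * (H x - H x).
      exact: cvgM.
    by rewrite subrr mul0r in h3; exact: h3.
  have h4 : ((H (x + c_ k) - H x) ^+ 2)%:E @[k --> \oo] --> (0 : R)%:E.
    by apply: cvg_EFin; [exact: nearW|exact: hx].
  exact: h4.
- apply: rintegrableZ => //.
  exact: integrable_indic_itv.
- apply: aeW => x k _; rewrite gee0_abs ?lee_fin ?sqr_ge0//= indicE.
  case: (pselect (B x)) => [Bx|nBx].
    rewrite mem_set// mulr1 -[leLHS]real_normK ?num_real// lerXn2r ?nnegrE ?mulr_ge0//.
    by rewrite (le_trans (ler_normB _ _))// mulr2n mulrDl !mul1r lerD.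
  by rewrite Hc// expr0n memNset// mulr0.
move=> _ _; rewrite integral0 => /fine_cvgP[fin /cvgr0Pnorm_lt/(_ e e0) h].
near \oo => k.
have fink : osc H (c_ k) \is a fin_num by near: k; exact: fin.
have := (c_P k).2; rewrite -/H -(fineK fink) lte_fin ltNge => /negP; apply.
rewrite (le_trans (ler_norm _))// ltW//.
by near: k; exact: h.
Unshelve. all: by end_near. Qed.

Lemma osc_small F : L2 F -> forall e : R, 0 < e ->
  exists d : R, 0 < d /\ forall c, `|c| < d -> (osc F c <= e%:E)%E.
Proof.
move=> FL2 e e0.
have [n [M [g [M0 cg FH]]]] := L2_dense FL2 (divr_gt0 e0 (ltr0n _ 12)).
have [d [d0 dP]] := osc_cutoff n M0 cg (divr_gt0 e0 (ltr0n _ 6)).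
exists d; split => // c cd.
have mH : measurable_fun setT (cutoff n M g) by exact: measurable_cutoff.
apply: (le_trans (osc_approx c FL2.1 mH)).
apply: (@le_trans _ _ (3%:E * (e / 6)%:E + 6%:E * (e / 12)%:E)%E).
  by apply: leeD; apply: lee_wpmul2l; rewrite ?lee_fin//; exact: dP.
by rewrite -!EFinM -EFinD lee_fin; lra.
Qed.

(** Small shifts cost at most [e]; for [|c| >= d] the trivial bound [4 * enorm2 F] is inflated by
    [(c / d)^2 >= 1]. The result holds for all shifts, hence for the unbounded Gaussian ones. *)
Lemma osc_quad F : L2 F -> forall e : R, 0 < e ->
  exists B : R, 0 <= B /\ forall c, (osc F c <= (e + B * c ^+ 2)%:E)%E.
Proof.
move=> FL2 e e0; have [d [d0 dP]] := osc_small FL2 e0.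
have nF : enorm2 F \is a fin_num by rewrite ge0_fin_numE ?enorm2_ge0// L2_enorm2.
have N0 : 0 <= fine (enorm2 F) by apply: fine_ge0; exact: enorm2_ge0.
exists (4 * fine (enorm2 F) / d ^+ 2); split.
  by rewrite divr_ge0 ?sqr_ge0// mulr_ge0.
move=> c; case: (ltrP `|c| d) => cd.
  apply: (le_trans (dP c cd)); rewrite lee_fin lerDl mulr_ge0 ?sqr_ge0//.
  by rewrite divr_ge0 ?sqr_ge0// mulr_ge0.
apply: (le_trans (osc_le c FL2.1)); rewrite -(fineK nF) -EFinM lee_fin.
rewrite (@le_trans _ _ (4 * fine (enorm2 F) / d ^+ 2 * c ^+ 2))//; last by rewrite lerDr ltW.
rewrite mulrAC ler_pdivlMr ?exprn_gt0// ler_wpM2l ?mulr_ge0//.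
by rewrite -[leRHS]real_normK ?num_real// lerXn2r ?nnegrE//; exact: ltW.
Qed.

End L2_translation.

(** * Gaussian averaging: contraction, continuity in the parameters, sup bounds *)

Section gaussian_smoothing.
Context {R : realType}.
Notation mu := (@lebesgue_measure R).
Implicit Types f g h F G H : R -> R.
Implicit Types a b c d z : R.

Lemma integrable_expsq a : 0 < a ->
  mu.-integrable setT (EFin \o (fun y : R => expR (- (a * y ^+ 2)))).
Proof.
move=> a0; pose s := Num.sqrt ((2 * a)^-1).
have s0 : 0 < s by rewrite sqrtr_gt0 invr_gt0 mulr_gt0.
have s2 : s ^+ 2 *+ 2 = a^-1.
  by rewrite sqr_sqrtr ?invr_ge0 ?mulr_ge0 ?ltW// -mulr_natl invfM mulrA divff ?mul1r.
have pk : 0 < normal_peak s by rewrite normal_peak_gt0// gt_eqF.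
have ip : mu.-integrable setT (EFin \o normal_pdf 0 s) := integrable_normal_pdf 0 s.
have := rintegrableZ measurableT (normal_peak s)^-1 ip.
apply: eq_integrable => // y _ /=.
rewrite normal_pdfE ?gt_eqF// mulrA mulVf ?mul1r ?gt_eqF//.
by rewrite /normal_fun s2 invrK subr0; congr (expR _)%:E; ring.
Qed.

Lemma gamE s : gam s = normal_peak 1 * expR (- (2^-1 * s ^+ 2)) :> R.
Proof.
rewrite /gam normal_pdfE ?oner_neq0// /normal_fun subr0 expr1n.
by congr (_ * expR _); field.
Qed.

Lemma gam_sq_ge0 s (u : R) : 0 <= gam s * u ^+ 2.
Proof. by rewrite mulr_ge0 ?gam_ge0 ?sqr_ge0. Qed.

Lemma integrable_gam2 : mu.-integrable setT (EFin \o (fun s : R => gam s * s ^+ 2)).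
Proof.
have p0 : 0 <= normal_peak (1 : R) by exact: normal_peak_ge0.
apply: (rintegrable_le (nu := mu) measurableT
  (fun s => (normal_peak 1 * 4) * expR (- (4^-1 * s ^+ 2)))).
- by apply: measurable_funM; [exact: measurable_gam|exact: measurable_funX].
- move=> s _; rewrite ger0_norm ?gam_sq_ge0//.
  rewrite gamE -!mulrA ler_wpM2l//.
  (* Half of the exponent absorbs [s ^+ 2] by [1 + u <= expR u]; the other half provides the
     integrable majorant. *)
  have -> : - (2^-1 * s ^+ 2) = - (4^-1 * s ^+ 2) + - (4^-1 * s ^+ 2) by field.
  rewrite expRD -mulrA (mulrC 4) ler_wpM2l ?expR_ge0//.
  rewrite expRN mulrC ler_pdivrMr ?expR_gt0//.
  have := expR_ge1Dx (4^-1 * s ^+ 2); lra.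
- have i4 : mu.-integrable setT (EFin \o (fun y : R => expR (- (4^-1 * y ^+ 2)))).
    by apply: integrable_expsq; rewrite invr_gt0.
  exact: (rintegrableZ measurableT (normal_peak 1 * 4) i4).
Qed.

Definition gam2 : R := \int[mu]_s (gam s * s ^+ 2).

Lemma gam2_ge0 : 0 <= gam2.
Proof. by apply: Rintegral_ge0 => s _; rewrite mulr_ge0 ?gam_ge0 ?sqr_ge0. Qed.

(** Quadratic growth in [s] is affordable because the Gaussian has a finite second moment;
    [osc_quad] produces bounds of this shape. *)
Lemma smear_L2_quad (K : R -> R -> R) (A B : R) : 0 <= A -> 0 <= B -> meas2 K ->
  (forall s, \int[mu]_z (K z s ^+ 2)%:E <= (A + B * s ^+ 2)%:E)%E ->
  (enorm2 (smear K) <= (A + B * gam2)%:E)%E.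
Proof.
move=> A0 B0 mK KC; apply: (le_trans (smear_L2 mK)).
have iA := rintegrableZ measurableT A (integrable_gam (R:=R)).
have iB := rintegrableZ measurableT B integrable_gam2.
apply: (@le_trans _ _ (\int[mu]_s (A * gam s + B * (gam s * s ^+ 2))%:E)%E).
  apply: ge0_le_integral => //.
  - by move=> s _; rewrite mule_ge0 ?lee_fin ?gam_ge0// integral_ge0// => z _; rewrite lee_fin sqr_ge0.
  - apply: emeasurable_funM; first by apply/measurable_EFinP; exact: measurable_gam.
    apply: (@measurable_fun_fubini_tonelli_G _ _ _ _ _ mu (fun p => (K p.1 p.2 ^+ 2)%:E)) => //.
      by apply/measurable_EFinP; exact: measurable_funX.
    by move=> p; rewrite lee_fin sqr_ge0.
  - apply/measurable_EFinP; apply: measurable_funD.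
      exact: (rintegrable_meas iA).
    exact: (rintegrable_meas iB).
  - move=> s _; apply: (le_trans (lee_wpmul2l _ (KC s))); first by rewrite lee_fin gam_ge0.
    by rewrite -EFinM lee_fin le_eqVlt; apply/orP; left; apply/eqP; ring.
have -> : (\int[mu]_s (A * gam s + B * (gam s * s ^+ 2))%:E = (A + B * gam2)%:E)%E.
  rewrite (RintegralE measurableT); last exact: (rintegrableD measurableT iA iB).
  rewrite RintegralD// RintegralZl//; last exact: integrable_gam.
  rewrite RintegralZl//; last exact: integrable_gam2.
  have -> : \int[mu]_s gam s = 1 :> R by rewrite /Rintegral integral_gam.
  by rewrite mulr1.
by [].
Qed.

(* With [d = sqrt (2 t)] this is the heat semigroup at time [t] applied to [F],
   evaluated at [sg * z + c]. *)
Definition hsm F sg c d : R -> R := smear (fun z s => F (sg * z + (c + d * s))).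

Lemma meas2_hsm F sg c d : measurable_fun setT F ->
  meas2 (fun z s => F (sg * z + (c + d * s))).
Proof.
move=> mF; apply: (measurableT_comp mF).
apply: measurable_funD; first by apply: measurable_funM => //; exact: measurable_fst.
by apply: measurable_funD => //; apply: measurable_funM => //; exact: measurable_snd.
Qed.

Lemma measurable_hsm F sg c d : measurable_fun setT F -> measurable_fun setT (hsm F sg c d).
Proof. by move=> mF; apply: measurable_smear; exact: meas2_hsm. Qed.

Lemma enorm2_comp_sg F sg c : sg = 1 \/ sg = -1 -> measurable_fun setT F ->
  enorm2 (fun z => F (sg * z + c)) = enorm2 F.
Proof.
move=> sgE mF; rewrite -[RHS](enorm2_shift c)//; case: sgE => ->.
  by congr enorm2; apply/funext => z; rewrite mul1r.
rewrite -[RHS]enorm2N; last exact: measurable_shift.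
by congr enorm2; apply/funext => z; rewrite mulN1r.
Qed.

Lemma enorm2_hsm F sg c d : sg = 1 \/ sg = -1 -> L2 F -> (enorm2 (hsm F sg c d) <= enorm2 F)%E.
Proof.
move=> sgE [mF iF].
have nF : enorm2 F \is a fin_num by rewrite ge0_fin_numE ?enorm2_ge0// L2_enorm2.
rewrite -(fineK nF) -[fine _]addr0 -(mul0r gam2).
apply: smear_L2_quad => //.
- by apply: fine_ge0; exact: enorm2_ge0.
- exact: meas2_hsm.
- move=> s; rewrite mul0r addr0 fineK//.
  by rewrite -/(enorm2 (fun z => F (sg * z + (c + d * s)))) enorm2_comp_sg.
Qed.

(** Bound [gam] by 1 and substitute [x = sg * z + c + d * s]: the Jacobian [d^-1] is the source of
    all decay in time. *)
Lemma enorm2_hsm_point F sg c d z : sg = 1 \/ sg = -1 -> 0 < d -> measurable_fun setT F ->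
  (\int[mu]_s (gam s * F (sg * z + (c + d * s)) ^+ 2)%:E <= (d^-1)%:E * enorm2 F)%E.
Proof.
move=> sgE d0 mF.
have m2 : measurable_fun setT (fun s => F (sg * z + (c + d * s)) ^+ 2).
  apply: measurable_funX; have := measurable_comp_affine d (sg * z + c) mF.
  by congr measurable_fun; apply/funext => s; congr F; ring.
apply: (@le_trans _ _ (\int[mu]_s (F (d * s + (sg * z + c)) ^+ 2)%:E)%E).
  apply: ge0_le_integral => //.
  - by move=> s _; rewrite lee_fin mulr_ge0 ?gam_ge0 ?sqr_ge0.
  - by apply/measurable_EFinP; apply: measurable_funM => //; exact: measurable_gam.
  - apply/measurable_EFinP; apply: measurable_funX; exact: measurable_comp_affine.
  - move=> s _; rewrite lee_fin (_ : d * s + _ = sg * z + (c + d * s)); last by ring.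
    by rewrite ler_piMl ?sqr_ge0 ?gam_le1.
rewrite /enorm2 (@ge0_integral_affine _ d (sg * z + c) (fun x => (F x ^+ 2)%:E))//.
- by rewrite muleA -EFinM mulVf ?gt_eqF// mul1e.
- by apply/measurable_EFinP; exact: measurable_funX.
- by move=> x; rewrite lee_fin sqr_ge0.
Qed.

Lemma integrable_hsm F sg c d z : sg = 1 \/ sg = -1 -> 0 <= d -> L2 F ->
  mu.-integrable setT (EFin \o (fun s => gam s * F (sg * z + (c + d * s)))).
Proof.
move=> sgE; rewrite le_eqVlt => /orP[/eqP<-|d0] FL2.
  have := rintegrableZ measurableT (F (sg * z + c)) (integrable_gam (R := R)).
  by apply: eq_integrable => // s _ /=; rewrite mul0r addr0 mulrC.
have m1 : measurable_fun setT (fun s => F (sg * z + (c + d * s))).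
  have := measurable_comp_affine d (sg * z + c) FL2.1.
  by congr measurable_fun; apply/funext => s; congr F; ring.
have mg := @measurable_gam R.
have i2 : mu.-integrable setT (EFin \o (fun s => gam s * F (sg * z + (c + d * s)) ^+ 2)).
  apply: (ge0_integrable_fin (nu := mu)).
  - by apply: measurable_funM => //; exact: measurable_funX.
  - by move=> s; rewrite mulr_ge0 ?gam_ge0 ?sqr_ge0.
  - apply: (le_lt_trans (enorm2_hsm_point c z sgE d0 FL2.1)).
    by rewrite lte_mul_pinfty ?L2_enorm2// lee_fin invr_ge0 ltW.
apply: (rintegrable_le (nu := mu) measurableT (fun s => gam s * F (sg * z + (c + d * s)) ^+ 2 + gam s)).
- exact: measurable_funM.
- move=> s _; rewrite normrM (ger0_norm (gam_ge0 s)).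
  rewrite -[X in _ <= _ + X]mulr1 -mulrDr ler_wpM2l ?gam_ge0//.
  set u := F _; rewrite -[u ^+ 2]real_normK ?num_real//; have := normr_ge0 u; nra.
- by apply: rintegrableD => //; exact: integrable_gam.
Qed.

Lemma smearB (K1 K2 : R -> R -> R) z :
  mu.-integrable setT (EFin \o (fun s => gam s * K1 z s)) ->
  mu.-integrable setT (EFin \o (fun s => gam s * K2 z s)) ->
  smear K1 z - smear K2 z = smear (fun z s => K1 z s - K2 z s) z.
Proof.
move=> i1 i2; rewrite /smear -RintegralB//.
by apply: eq_Rintegral => s _; rewrite mulrBr.
Qed.

(** For fixed [s] the two averages sample [F] at points that differ by the shift
    [c - c' + (d - d') * s], to which [osc_quad] applies. Admitting [d = 0] gives continuity down to
    time zero. *)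
Lemma enorm2_hsmB F : L2 F -> forall e : R, 0 < e -> exists B : R, 0 <= B /\
  forall sg c d c' d', sg = 1 \/ sg = -1 -> 0 <= d -> 0 <= d' ->
  (enorm2 (fun z => hsm F sg c d z - hsm F sg c' d' z)%R <=
     (e + B * ((c - c') ^+ 2 + (d - d') ^+ 2))%:E)%E.
Proof.
move=> FL2 e e0; have [B [B0 BP]] := osc_quad FL2 e0.
have g20 := gam2_ge0.
exists (2 * B * (1 + gam2)); split; first by rewrite !mulr_ge0// addr_ge0.
move=> sg c d c' d' sgE d0 d'0.
have mF := FL2.1.
rewrite (_ : (fun _ => _) = smear (fun z s => F (sg * z + (c + d * s)) - F (sg * z + (c' + d' * s)))); last first.
  by apply/funext => z; apply: smearB; exact: integrable_hsm.
apply: (@le_trans _ _ ((e + 2 * B * (c - c') ^+ 2) + (2 * B * (d - d') ^+ 2) * gam2)%:E).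
  apply: smear_L2_quad.
  - by apply: addr_ge0; [exact: ltW|rewrite mulr_ge0 ?sqr_ge0// mulr_ge0].
  - by rewrite mulr_ge0 ?sqr_ge0// mulr_ge0.
  - by apply: measurable_funB; exact: meas2_hsm.
  - move=> s; set w := c - c' + (d - d') * s.
    have -> : (\int[mu]_z ((F (sg * z + (c + d * s)) - F (sg * z + (c' + d' * s))) ^+ 2)%:E
       = osc F w)%E.
      rewrite /osc -(@enorm2_comp_sg (fun x => F (x + w) - F x) sg (c' + d' * s))//.
        apply: eq_integral => z _; congr ((F _ - _) ^+ 2)%:E; rewrite /w; ring.
      by apply: measurable_funB => //; exact: measurable_shift.
    apply: (le_trans (BP w)); rewrite lee_fin -!addrA lerD2l.
    have -> : 2 * B * (c - c') ^+ 2 + 2 * B * (d - d') ^+ 2 * s ^+ 2 =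
       B * (2 * (c - c') ^+ 2 + 2 * ((d - d') * s) ^+ 2) by ring.
    rewrite ler_wpM2l// /w; have := sqr_ge0 (c - c' - (d - d') * s); nra.
rewrite lee_fin -addrA lerD2l.
have h1 : 0 <= B * (c - c') ^+ 2 * gam2 by rewrite mulr_ge0// mulr_ge0 ?sqr_ge0.
have h2 : 0 <= B * (d - d') ^+ 2 by rewrite mulr_ge0// sqr_ge0.
nra.
Qed.

Lemma hsm_sup F sg c d z : sg = 1 \/ sg = -1 -> 0 < d -> L2 F ->
  hsm F sg c d z ^+ 2 <= d^-1 * fine (enorm2 F).
Proof.
move=> sgE d0 FL2.
have nF : enorm2 F \is a fin_num by rewrite ge0_fin_numE ?enorm2_ge0// L2_enorm2.
have m1 : measurable_fun setT (fun s => F (sg * z + (c + d * s))).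
  have := measurable_comp_affine d (sg * z + c) FL2.1.
  by congr measurable_fun; apply/funext => s; congr F; ring.
have h := le_trans (jensen_gam m1) (enorm2_hsm_point c z sgE d0 FL2.1).
by rewrite -(fineK nF) -EFinM lee_fin in h.
Qed.

Lemma L2_shift F c : L2 F -> L2 (fun x => F (x + c)).
Proof.
move=> FL2; apply: L2P; first by apply: measurable_shift; exact: FL2.1.
by rewrite enorm2_shift ?L2_enorm2//; exact: FL2.1.
Qed.

Lemma L2B F G : L2 F -> L2 G -> L2 (fun x => F x - G x).
Proof.
move=> FL2 GL2; have mF := FL2.1; have mG := GL2.1.
apply: L2P; first exact: measurable_funB.
apply: (@le_lt_trans _ _ (2%:E * enorm2 F + 2%:E * enorm2 G)%E).
  apply: enorm2_le2 => //; first exact: measurable_funB.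
  by move=> x; have := sqr_ge0 (F x + G x); nra.
by rewrite lte_add_pinfty// lte_mul_pinfty ?L2_enorm2// lee_fin.
Qed.

(** Moving [z] amounts to translating [F], so the increment is the average of a function of small
    [L^2] norm, and [hsm_sup] applies to it. *)
Lemma hsm_continuous F sg c d : sg = 1 \/ sg = -1 -> 0 < d -> L2 F -> continuous (hsm F sg c d).
Proof.
move=> sgE d0 FL2 z; apply/cvgrPdist_lt => e e0.
(* Chosen so that the factor [d^-1] of [hsm_sup] leaves [(e / 2) ^+ 2]. *)
have [r [r0 rP]] := osc_small FL2 (mulr_gt0 d0 (exprn_gt0 2 (divr_gt0 e0 (ltr0n _ 2)))).
near=> z'.
pose F' x := F (x + (sg * z - sg * z')) - F x.
have F'L2 : L2 F' by apply: L2B => //; exact: L2_shift.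
have -> : hsm F sg c d z - hsm F sg c d z' = hsm F' sg c d z'.
  have -> : hsm F sg c d z = smear (fun z' s => F (sg * z + (c + d * s))) z' by [].
  rewrite smearB; [|exact: (integrable_hsm c z sgE (ltW d0) FL2)|
                    exact: (integrable_hsm c z' sgE (ltW d0) FL2)].
  by apply: eq_Rintegral => s _; congr (_ * (F _ - _)); ring.
have := hsm_sup c z' sgE d0 F'L2.
have on : (enorm2 F' <= (d * (e / 2) ^+ 2)%:E)%E.
  apply: rP; rewrite -mulrBr normrM.
  have -> : `|sg| = 1 by case: sgE => ->; rewrite ?normrN normr1.
  rewrite mul1r; near: z'.
  by have := @cvg_id _ (nbhs z) => /cvgrPdist_lt; apply.
have nF : enorm2 F' \is a fin_num by rewrite ge0_fin_numE ?enorm2_ge0// L2_enorm2.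
rewrite -(fineK nF) lee_fin in on.
move=> /le_trans /(_ (ler_wpM2l _ on)) -/(_ (ltW _)).
rewrite invr_gt0 mulrA mulVf ?gt_eqF// mul1r => /(_ d0) h.
rewrite (@le_lt_trans _ _ (e / 2))//; last by lra.
rewrite -(@ler_pXn2r _ 2) ?nnegrE//; last by rewrite divr_ge0// ltW.
by rewrite real_normK ?num_real.
Unshelve. all: by end_near. Qed.

End gaussian_smoothing.

(** * Rules of differentiation *)

Section derivatives.
Context {R : realType}.
Implicit Types (f g : R -> R) (x df dg : R).

(** These rules speak of explicit functions [fun y => ...] and of multiplication in [R] instead of
    scaling, so that derivatives are assembled by plain application. *)
Lemma derD f g x df dg : is_derive x 1 f df -> is_derive x 1 g dg ->
  is_derive x 1 (fun y => f y + g y) (df + dg).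
Proof. exact: is_deriveD. Qed.

Lemma derB f g x df dg : is_derive x 1 f df -> is_derive x 1 g dg ->
  is_derive x 1 (fun y => f y - g y) (df - dg).
Proof. exact: is_deriveB. Qed.

Lemma derN f x df : is_derive x 1 f df -> is_derive x 1 (fun y => - f y) (- df).
Proof. exact: is_deriveN. Qed.

Lemma derM f g x df dg : is_derive x 1 f df -> is_derive x 1 g dg ->
  is_derive x 1 (fun y => f y * g y) (df * g x + f x * dg).
Proof.
move=> hf hg.
have h : is_derive x 1 (fun y => f y * g y) (f x *: dg + g x *: df) := is_deriveM hf hg.
by apply: (is_derive_eq h); rewrite addrC [X in X + _]mulrC.
Qed.

Lemma derZ k f x df : is_derive x 1 f df -> is_derive x 1 (fun y => k * f y) (k * df).
Proof. exact: is_deriveZ. Qed.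

Lemma der_comp f g x df dg : is_derive (g x) 1 f df -> is_derive x 1 g dg ->
  is_derive x 1 (fun y => f (g y)) (df * dg).
Proof. by move=> hf hg; have := @is_derive1_comp _ f g x _ _ hf hg. Qed.

Lemma der_exp f x df : is_derive x 1 f df ->
  is_derive x 1 (fun y => expR (f y)) (expR (f x) * df).
Proof. by move=> hf; apply: der_comp. Qed.

Lemma der_affine (a b x : R) : is_derive x 1 (fun y => a * y + b) a.
Proof.
have h1 : is_derive x 1 (fun y : R => a * y) (a * 1) := derZ a (is_derive_id x 1).
have h2 : is_derive x 1 (fun=> b : R) 0 := is_derive_cst b x 1.
by apply: (is_derive_eq (derD h1 h2)); rewrite mulr1 addr0.
Qed.

Lemma derX f n x df : is_derive x 1 f df ->
  is_derive x 1 (fun y => f y ^+ n) (n%:R * f x ^+ n.-1 * df).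
Proof. by move=> hf; have := is_deriveX n hf; rewrite exprfctE. Qed.

Lemma derV f x df : f x != 0 -> is_derive x 1 f df ->
  is_derive x 1 (fun y => (f y)^-1) (- (f x) ^- 2 * df).
Proof.
move=> f0 hf; apply: DeriveDef; first by apply: derivableV => //; case: hf.
by rewrite deriveV//; case: hf => _ ->.
Qed.

Lemma derive1_val f x df : is_derive x 1 f df -> derive1 f x = df.
Proof. by move=> hf; rewrite derive1E; case: hf. Qed.

End derivatives.

(** * A smooth bump function *)

Section smooth_functions.
Context {R : realType}.
Implicit Types (f g : R -> R) (n m k : nat) (x : R).

(** A finite-order version of [smooth_fun], on which closure properties are proved by induction. *)
Definition diffn n f := forall k, (k <= n)%N ->
  forall x, derivable (iter k (@derive1 R R) f) x 1.

Lemma diffn_smooth f : (forall n, diffn n f) -> smooth_fun f.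
Proof. by move=> h n x; exact: (h n n). Qed.

Lemma diffn0 f : (forall x, derivable f x 1) -> diffn 0 f.
Proof. by move=> h k; rewrite leqn0 => /eqP ->. Qed.

Lemma diffnS n f : (forall x, derivable f x 1) -> diffn n (derive1 f) -> diffn n.+1 f.
Proof. by move=> h hn [_ x|k kn x]; [exact: h|rewrite iterSr; exact: hn]. Qed.

Lemma diffnW n f : diffn n.+1 f -> diffn n f.
Proof. by move=> h k kn; apply: h; rewrite ltnW. Qed.

Lemma diffn_derive n f : diffn n.+1 f -> diffn n (derive1 f).
Proof. by move=> h k kn x; rewrite -iterSr; exact: h. Qed.

Lemma diffn_ex n f : diffn n f -> forall x, derivable f x 1.
Proof. by move=> h x; exact: (h 0). Qed.

Arguments diffn_ex {n f} _ x.

Lemma diffnD n f g : diffn n f -> diffn n g -> diffn n (fun x => f x + g x).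
Proof.
elim: n f g => [|n IH] f g fn gn.
  by apply: diffn0 => x; apply: derivableD; [exact: diffn_ex fn x|exact: diffn_ex gn x].
apply: diffnS => [x|]; first by apply: derivableD; [exact: diffn_ex fn x|exact: diffn_ex gn x].
have -> : derive1 (fun x => f x + g x) = (fun x => derive1 f x + derive1 g x).
  apply/funext => x; rewrite !derive1E deriveD//; [exact: diffn_ex fn x|exact: diffn_ex gn x].
by apply: IH; exact: diffn_derive.
Qed.

Lemma diffn_cst n (c : R) : diffn n (fun=> c).
Proof.
elim: n c => [|n IH] c; first by apply: diffn0.
apply: diffnS => //.
have -> : derive1 (fun=> c : R) = (fun=> 0 : R) by apply/funext => x; rewrite derive1_cst.
exact: IH.
Qed.

Lemma diffnM n f g : diffn n f -> diffn n g -> diffn n (fun x => f x * g x).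
Proof.
elim: n f g => [|n IH] f g fn gn.
  by apply: diffn0 => x; apply: derivableM; [exact: diffn_ex fn x|exact: diffn_ex gn x].
apply: diffnS => [x|]; first by apply: derivableM; [exact: diffn_ex fn x|exact: diffn_ex gn x].
have -> : derive1 (fun x => f x * g x) = (fun x => f x * derive1 g x + derive1 f x * g x).
  apply/funext => x; rewrite !derive1E deriveM//; [|exact: diffn_ex fn x|exact: diffn_ex gn x].
  by rewrite /= mulrC -!derive1E; congr (_ + _); exact: mulrC.
by apply: diffnD; apply: IH; [exact: diffnW|exact: diffn_derive|exact: diffn_derive|exact: diffnW].
Qed.

Lemma is_derive_affine f (a b x : R) : derivable f (a * x + b) 1 ->
  is_derive x 1 (fun y => f (a * y + b)) (a * derive1 f (a * x + b)).
Proof.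
move=> df; rewrite mulrC; apply: (der_comp (f := f)); last exact: der_affine.
by apply: DeriveDef => //; rewrite derive1E.
Qed.

Lemma diffn_affine n f (a b : R) : diffn n f -> diffn n (fun x => f (a * x + b)).
Proof.
elim: n f => [|n IH] f fn.
  by apply: diffn0 => x; have [] := @is_derive_affine f a b x (diffn_ex fn _).
apply: diffnS => [x|].
  by have [] := @is_derive_affine f a b x (diffn_ex fn _).
have -> : derive1 (fun x => f (a * x + b)) = (fun x => a * derive1 f (a * x + b)).
  apply/funext => x; rewrite derive1E.
  by have [_ ->] := @is_derive_affine f a b x (diffn_ex fn _).
apply: diffnM; first exact: diffn_cst.
by apply: IH; exact: diffn_derive.
Qed.

(* The span of the [psi n] is stable under differentiation, so [psi 0] is smooth. *)
Definition psi n (x : R) : R := if 0 < x then x^-1 ^+ n * expR (- x^-1) else 0.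

(** Raise [y / N <= expR (y / N)] to the power [N = n + 2] with [y = 1 / x]. The two spare powers of
    [x] make every [psi n] flat at 0, where its derivative is therefore 0. *)
Lemma psi_bound n (x : R) : `|psi n x| <= n.+2%:R ^+ n.+2 * x ^+ 2.
Proof.
rewrite /psi; case: ifPn => [x0|_]; last by rewrite normr0 mulr_ge0 ?sqr_ge0 ?exprn_ge0.
have y0 : 0 < x^-1 by rewrite invr_gt0.
rewrite ger0_norm; last by apply: mulr_ge0; [apply: exprn_ge0; exact: ltW|exact: expR_ge0].
rewrite expRN ler_pdivrMr ?expR_gt0//.
have N0 : 0 < n.+2%:R :> R by rewrite ltr0n.
have h : x^-1 ^+ n.+2 <= n.+2%:R ^+ n.+2 * expR (x^-1).
  have -> : x^-1 = n.+2%:R * (x^-1 / n.+2%:R) by rewrite mulrCA divff ?mulr1 ?gt_eqF.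
  rewrite exprMn ler_wpM2l ?exprn_ge0// expRM_natl lerXn2r ?nnegrE ?expR_ge0//.
    by rewrite divr_ge0// ltW.
  by apply: le_trans (expR_ge1Dx _); rewrite lerDr.
have -> : x^-1 ^+ n = x ^+ 2 * x^-1 ^+ n.+2.
  by rewrite -(addn2 n) exprD mulrCA -exprMn divff ?gt_eqF// expr1n mulr1.
by rewrite -[leRHS]mulrA [leRHS]mulrCA ler_wpM2l ?sqr_ge0.
Qed.

Lemma is_derive_flat f (C : R) : (forall x, `|f x| <= C * x ^+ 2) -> is_derive (0 : R) (1 : R) f (0 : R).
Proof.
move=> fC.
have f0 : f 0 = 0 by apply/eqP; rewrite -normr_le0 (le_trans (fC 0))// expr0n mulr0.
have h : h^-1 *: ((f \o shift 0) (h *: (1 : R)) - f 0) @[h --> (0 : R)^'] --> (0 : R).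
  apply/cvgrPdist_lt => e e0; near=> h.
  have h0 : h != 0 by near: h; exact: nbhs_dnbhs_neq.
  rewrite sub0r normrN f0 subr0 /= addr0 /GRing.scale/= mulr1 normrM normfV.
  rewrite ltr_pdivrMl ?normr_gt0//.
  apply: (le_lt_trans (fC h)); rewrite -real_normK ?num_real// expr2 mulrCA.
  rewrite ltr_pM2l ?normr_gt0//.
  have C1 : 0 < `|C| + 1 by rewrite ltr_wpDl.
  apply: (@le_lt_trans _ _ ((`|C| + 1) * `|h|)).
    by rewrite ler_wpM2r// (le_trans (ler_norm _))// lerDl.
  rewrite -ltr_pdivlMl// mulrC.
  near: h; apply: dnbhs0_lt; by rewrite divr_gt0.
by apply: DeriveDef; [apply/cvg_ex; exists 0|exact: (cvg_lim _ h)].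
Unshelve. all: by end_near. Qed.

Lemma is_derive_psi n (x : R) : is_derive x 1 (psi n) (- n%:R * psi n.+1 x + psi n.+2 x).
Proof.
case: (ltgtP x 0) => x0.
- have -> : - n%:R * psi n.+1 x + psi n.+2 x = 0.
    by rewrite /psi ltNge (ltW x0)/= mulr0 addr0.
  apply: (@near_eq_is_derive _ _ _ (fun=> 0 : R)) => //.
  near=> y; rewrite /psi ifF//; apply/negbTE; rewrite -leNgt.
  by apply/ltW; near: y; exact: lt_nbhsl.
- have e : \near x, x^-1 ^+ n * expR (- x^-1) = psi n x.
    near=> y; rewrite /psi ifT//; near: y; exact: lt_nbhsr.
  apply: (near_eq_is_derive e) => //.
  have xn0 : x != 0 by rewrite gt_eqF.
  have hv : is_derive x 1 (fun y : R => y^-1) (- x ^- 2).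
    by apply: (is_derive_eq (derV xn0 (is_derive_id x 1))); rewrite mulr1.
  apply: (is_derive_eq (derM (derX n hv) (der_exp (derN hv)))).
  rewrite /psi x0 /= opprK -!exprVn.
  case: n {e} => [|n]; rewrite ?mul0r ?add0r ?oppr0 ?mul0r ?add0r/=.
    by rewrite expr0 mul1r mulrC.
  by rewrite !exprS; ring.
- have -> : - n%:R * psi n.+1 x + psi n.+2 x = 0 by rewrite /psi x0 ltxx mulr0 addr0.
  by rewrite x0; apply: is_derive_flat => y; exact: psi_bound.
Unshelve. all: by end_near. Qed.

Lemma diffn_psi m n : diffn m (psi n).
Proof.
elim: m n => [|m IH] n; first by apply: diffn0 => x; have [] := is_derive_psi n x.
apply: diffnS => [x|]; first by have [] := is_derive_psi n x.
have -> : derive1 (psi n) = (fun x => - n%:R * psi n.+1 x + psi n.+2 x).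
  by apply/funext => x; exact: (derive1_val (is_derive_psi n x)).
by apply: diffnD => //; apply: diffnM => //; exact: diffn_cst.
Qed.

Definition bumpf (x : R) : R := psi 0 x * psi 0 (1 - x).

Lemma diffn_bumpf m : diffn m bumpf.
Proof.
apply: diffnM; first exact: diffn_psi.
have := @diffn_affine m _ (-1) 1 (@diffn_psi m 0).
by congr diffn; apply/funext => x; congr psi; ring.
Qed.

Lemma psi0_ge0 x : 0 <= psi 0 x.
Proof. by rewrite /psi; case: ifP => _; rewrite ?expr0 ?mul1r ?expR_ge0. Qed.

Lemma psi0_le1 x : psi 0 x <= 1.
Proof.
rewrite /psi; case: ifPn => [x0|//]; rewrite expr0 mul1r expRN invf_le1 ?expR_gt0//.
by rewrite -expR0 ler_expR invr_ge0 ltW.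
Qed.

Lemma bump_ge0 x : 0 <= bumpf x.
Proof. by rewrite mulr_ge0 ?psi0_ge0. Qed.

Lemma bump_le1 x : bumpf x <= 1.
Proof. by rewrite mulr_ile1 ?psi0_ge0 ?psi0_le1. Qed.

Lemma bump_out x : x <= 0 \/ 1 <= x -> bumpf x = 0.
Proof.
rewrite /bumpf /psi => -[x0|x1]; first by rewrite ltNge x0 mul0r.
by rewrite subr_gt0 [X in _ * X]ifF ?mulr0// ltNge x1.
Qed.

Lemma bump_gt0 x : 0 < x -> x < 1 -> 0 < bumpf x.
Proof.
by move=> x0 x1; rewrite /bumpf /psi x0 subr_gt0 x1 !expr0 !mul1r mulr_gt0 ?expR_gt0.
Qed.

Lemma bump_continuous : continuous bumpf.
Proof.
move=> x; apply: differentiable_continuous; apply/derivable1_diffP.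
exact: (diffn_ex (@diffn_bumpf 0)).
Qed.

End smooth_functions.

(** * Smooth steps and averages at Lebesgue points *)

Section smooth_step.
Context {R : realType}.
Notation mu := (@lebesgue_measure R).
Implicit Types (f g : R -> R) (a b h x : R).

Lemma is_derive_continuous f df : (forall x, is_derive x 1 f (df x)) -> continuous f.
Proof.
move=> hf x; apply: differentiable_continuous; apply/derivable1_diffP.
by case: (hf x).
Qed.

Lemma MVT_line f df a b : (forall x, is_derive x 1 f (df x)) -> a < b ->
  exists2 c, a < c < b & f b - f a = df c * (b - a).
Proof.
move=> hf ab; have [|c cab ->] := MVT ab (fun x _ => hf x).
  by apply: continuous_subspaceT; exact: is_derive_continuous hf.
by exists c => //; move: cab; rewrite in_itv.
Qed.

(** The lower limit lies strictly to the left of the support [[0, 1]] of the bump, so that the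
    fundamental theorem of calculus also applies at [x = 0]. The total mass [thI] is not normalised
    to 1. *)
Definition theta x : R := \int[mu]_(t in `[-1, x]) bumpf t.
Definition thI : R := theta 1.

Lemma integrable_bump a b : mu.-integrable `[a, b] (EFin \o (@bumpf R)).
Proof.
apply: continuous_compact_integrable; first exact: segment_compact.
by apply: continuous_subspaceT; exact: bump_continuous.
Qed.

Lemma theta_le0 x : x <= 0 -> theta x = 0.
Proof.
move=> x0; rewrite /theta (eq_Rintegral mu (g := fun=> 0)).
  by rewrite /Rintegral integral0.
move=> t /set_mem /=; rewrite in_itv/= => /andP[_ tx].
by rewrite bump_out//; left; exact: le_trans x0.
Qed.

Lemma is_derive_theta x : is_derive x 1 theta (bumpf x).
Proof.
case: (ltrP x 0) => x0.
  rewrite bump_out; last by left; exact: ltW.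
  apply: (@near_eq_is_derive _ _ _ (fun=> 0 : R)) => //.
  near=> y; rewrite theta_le0//; apply/ltW; near: y; exact: lt_nbhsl.
have xx : x < x + 1 by rewrite ltrDl.
have x1 : -1 < x by lra.
have [d1 d2] := @continuous_FTC1_closed R bumpf (-1) x (x + 1) xx (@integrable_bump (-1) (x + 1)) x1 (@bump_continuous R x).
by apply: DeriveDef; [exact: d1|rewrite -derive1E].
Unshelve. all: by end_near. Qed.

Lemma theta_nd x y : x <= y -> theta x <= theta y.
Proof.
rewrite le_eqVlt => /orP[/eqP->//|xy].
have [c _ h] := MVT_line is_derive_theta xy.
by rewrite -subr_ge0 h mulr_ge0 ?bump_ge0// subr_ge0 ltW.
Qed.

Lemma theta_ge1 x : 1 <= x -> theta x = thI.
Proof.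
rewrite le_eqVlt => /orP[/eqP<-//|xy].
have [c /andP[c1 _] h] := MVT_line is_derive_theta xy.
by apply/eqP; rewrite -subr_eq0 h bump_out ?mul0r//; right; exact: ltW.
Qed.

Lemma thI_gt0 : 0 < thI.
Proof.
have h : (1 / 4 < 3 / 4 :> R) by lra.
have [c /andP[c1 c2] e] := MVT_line is_derive_theta h.
have : theta (3 / 4) <= thI by apply: theta_nd; lra.
have : 0 <= theta (1 / 4) by rewrite -(@theta_le0 0)//; apply: theta_nd; lra.
have : 0 < bumpf c by apply: bump_gt0; lra.
by move: e; nra.
Qed.

Lemma theta_ge0 x : 0 <= theta x.
Proof.
case: (lerP x 0) => x0; first by rewrite theta_le0.
by rewrite -(@theta_le0 0)//; apply: theta_nd; exact: ltW.
Qed.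

Lemma theta_le x : theta x <= thI.
Proof.
case: (lerP x 1) => x0; first exact: theta_nd.
by rewrite theta_ge1// ltW.
Qed.

Lemma diffn_theta n : diffn n theta.
Proof.
case: n => [|n]; first by apply: diffn0 => x; case: (is_derive_theta x).
apply: diffnS => [x|]; first by case: (is_derive_theta x).
have -> : derive1 theta = (@bumpf R).
  by apply/funext => x; exact: (derive1_val (is_derive_theta x)).
exact: diffn_bumpf.
Qed.

(* A smooth step from [0] to [thI] on [[a, a + h]]; its derivative [bh a h] is an
   approximate identity of mass [thI]. *)
Definition step a h x := theta (h^-1 * x + - (a / h)).
Definition bh a h x := h^-1 * bumpf (h^-1 * x + - (a / h)).

Lemma stepE a h x : h != 0 -> h^-1 * x + - (a / h) = (x - a) / h.
Proof. by move=> h0; field. Qed.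

Lemma is_derive_step a h x : is_derive x 1 (step a h) (bh a h x).
Proof.
rewrite /bh mulrC; apply: (der_comp (f := theta)); last exact: der_affine.
exact: is_derive_theta.
Qed.

Lemma step_le a h x : 0 < h -> x <= a -> step a h x = 0.
Proof.
move=> h0 xa; rewrite /step stepE ?gt_eqF// theta_le0//.
by rewrite pmulr_lle0 ?invr_gt0// subr_le0.
Qed.

Lemma step_ge a h x : 0 < h -> a + h <= x -> step a h x = thI.
Proof.
move=> h0 xa; rewrite /step stepE ?gt_eqF// theta_ge1//.
by rewrite ler_pdivlMr// mul1r; lra.
Qed.

Lemma bh_ge0 a h x : 0 < h -> 0 <= bh a h x.
Proof. by move=> h0; rewrite mulr_ge0 ?bump_ge0// invr_ge0 ltW. Qed.

Lemma bh_le a h x : 0 < h -> bh a h x <= h^-1.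
Proof. by move=> h0; rewrite ler_piMr ?bump_le1// invr_ge0 ltW. Qed.

Lemma bh_out a h x : 0 < h -> x <= a \/ a + h <= x -> bh a h x = 0.
Proof.
move=> h0 xa; rewrite /bh stepE ?gt_eqF// bump_out ?mulr0//.
case: xa => xa; [left|right]; first by rewrite pmulr_lle0 ?invr_gt0// subr_le0.
by rewrite ler_pdivlMr// mul1r; lra.
Qed.

Lemma measurable_bh a h : measurable_fun setT (bh a h).
Proof.
apply: measurable_funM => //; apply: measurable_comp_affine.
by apply: continuous_measurable_fun; exact: bump_continuous.
Qed.

Lemma measurable_step a h : measurable_fun setT (step a h).
Proof.
apply: continuous_measurable_fun; apply: is_derive_continuous.
exact: is_derive_step.
Qed.

Lemma integral_bump : \int[mu]_x bumpf x = thI.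
Proof.
rewrite /thI /theta [RHS]Rintegral_mkcond; apply: eq_Rintegral => x _.
rewrite patchE; case: ifPn => //; rewrite notin_setE/= in_itv/= => /negP.
rewrite negb_and -!ltNge => /orP[x1|x1]; apply: bump_out; [left|right]; last exact: ltW.
by apply/ltW; lra.
Qed.

Lemma integrable_bumpT : mu.-integrable setT (EFin \o (@bumpf R)).
Proof.
have -> : EFin \o (@bumpf R) = (EFin \o (@bumpf R)) \_ `[0, 1].
  apply/funext => x; rewrite patchE; case: ifPn => //.
  rewrite notin_setE/= in_itv/= => /negP.
  rewrite negb_and -!ltNge => /orP[x1|x1]; rewrite bump_out//; [left|right]; exact: ltW.
by apply/integrable_restrict => //=; rewrite setTI; exact: integrable_bump.
Qed.

Lemma integrable_bh a h : 0 < h -> mu.-integrable setT (EFin \o bh a h).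
Proof.
move=> h0; have hi : 0 < h^-1 by rewrite invr_gt0.
have := rintegrableZ measurableT h^-1 (integrable_affine (- (a / h)) hi integrable_bumpT).
by [].
Qed.

Lemma integral_bh a h : 0 < h -> \int[mu]_x bh a h x = thI.
Proof.
move=> h0; have hi : 0 < h^-1 by rewrite invr_gt0.
rewrite /bh RintegralZl//; last exact: (integrable_affine (- (a / h)) hi integrable_bumpT).
by rewrite -(Rintegral_affine _ hi)// ?integral_bump//; exact: integrable_bumpT.
Qed.

Lemma L2_integrable f (E : set R) : L2 f -> measurable E -> (mu E < +oo)%E ->
  mu.-integrable E (EFin \o f).
Proof.
move=> [mf if2] mE fE.
apply: (rintegrable_le (nu := mu) mE (fun x => f x ^+ 2 + 1)).
- exact: measurable_funTS.
- move=> x _; rewrite -[f x ^+ 2]real_normK ?num_real//; have := normr_ge0 (f x); nra.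
- apply: rintegrableD => //; last exact: finite_integrable_cst.
  exact: integrableS if2.
Qed.

Lemma L2_locally_integrable f : L2 f -> locally_integrable setT f.
Proof.
move=> fL2; split => //; first exact: fL2.1.
  exact: openT.
move=> K _ cK; have mK := compact_measurable cK.
have fK : (mu K < +oo)%E by exact: compact_finite_measure.
by have /integrableP[] := L2_integrable fL2 mK fK.
Qed.

Lemma L2_integrable_mul f (k : R -> R) a b (M : R) : L2 f -> measurable_fun setT k ->
  (forall x, `|k x| <= M) -> (forall x, ~ (a <= x <= b) -> k x = 0) ->
  mu.-integrable setT (EFin \o (fun x => f x * k x)).
Proof.
move=> fL2 mk kM k0.
have fI : (mu `[a, b]%classic < +oo)%E.
  by rewrite lebesgue_measure_itv/=; case: ifP; rewrite ltry.
have i1 : mu.-integrable `[a, b] (EFin \o (fun x => M * `|f x|)).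
  apply: rintegrableZ => //.
  have := integrable_abse (L2_integrable fL2 (measurable_itv `[a, b]) fI).
  by [].
have -> : EFin \o (fun x => f x * k x) = (EFin \o (fun x => f x * k x)) \_ `[a, b].
  apply/funext => x; rewrite patchE; case: ifPn => //.
  by rewrite notin_setE/= in_itv/= => xab; rewrite k0// mulr0.
apply/integrable_restrict => //=; rewrite setTI.
apply: (rintegrable_le (nu := mu) _ (fun x => M * `|f x|)) => //.
- apply: measurable_funTS; apply: measurable_funM => //; exact: fL2.1.
- by move=> x _; rewrite normrM mulrC ler_wpM2r.
Qed.

Lemma lebesgue_pt_bound f a : lebesgue_pt f a -> forall e : R, 0 < e ->
  exists2 d : R, 0 < d & forall h, 0 < h < d ->
  (\int[mu]_(y in ball a h) `|(f y - f a)%:E| <= (2 * h * e)%:E)%E.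
Proof.
move=> /fine_cvgP[fin /cvgrPdist_lt h] e e0.
have := filterI fin (h e e0) => -[d /= d0 dP].
exists d => // r /andP[r0 rd].
have [|finr] := dP r _ r0; first by rewrite /ball_/= sub0r normrN gtr0_norm.
rewrite sub0r normrN => davgr.
have muB : mu (ball a r) = (r *+ 2)%:E by rewrite lebesgue_measure_ball// ltW.
move: finr davgr; rewrite /= /davg /iavg muB inver mulrn_eq0/= gt_eqF//= => finr h1.
set I := (\int[mu]_(y in _) _)%E in finr h1 *.
suff : (I <= (2 * r * e)%:E)%E by [].
have [I0 finI] : (0 <= I /\ I \is a fin_num)%E.
  have I0 : (0 <= I)%E by apply: integral_ge0.
  split => //; rewrite ge0_fin_numE// ltey; apply/eqP => Ioo.
  by move: finr; rewrite Ioo gt0_muley// lte_fin invr_gt0 pmulrn_lgt0.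
move: h1; rewrite -(fineK finI) -EFinM/= ger0_norm; last first.
  by rewrite mulr_ge0 ?fine_ge0// invr_ge0 mulrn_wge0// ltW.
move=> h1; rewrite lee_fin.
have r20 : 0 < r *+ 2 by rewrite pmulrn_lgt0.
by rewrite ltr_pdivrMl// in h1; rewrite mulr_natl ltW.
Qed.

(** The kernel [bh a h] is at most [h^-1] and lives on [[a, a + h]], inside the ball of radius
    [2 h]; although it is one-sided, it is thus controlled by the symmetric averages that define
    Lebesgue points. *)
Lemma bh_average f a : L2 f -> lebesgue_pt f a -> forall e : R, 0 < e ->
  exists2 d : R, 0 < d & forall h, 0 < h < d ->
  `|\int[mu]_x (f x * bh a h x) - thI * f a| <= e.
Proof.
move=> fL2 fa e e0.
(* The ball of radius [2 h] gives [2 * (2 * h) * (e / 4)], which [h^-1] turns into [e]. *)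
have [d d0 dP] := lebesgue_pt_bound fa (divr_gt0 e0 (ltr0n _ 4)).
exists (d / 2) => [|h /andP[h0 hd]]; first by rewrite divr_gt0.
have h2 : 0 < 2 * h < d by apply/andP; split; lra.
have hB := dP _ h2.
have i1 : mu.-integrable setT (EFin \o (fun x => f x * bh a h x)).
  apply: (@L2_integrable_mul _ _ a (a + h) (h^-1)) => //.
  - exact: measurable_bh.
  - by move=> x; rewrite ger0_norm ?bh_ge0// bh_le.
  - move=> x /negP; rewrite negb_and -!ltNge => /orP xa; apply: bh_out => //.
    by case: xa => /ltW; [left|right].
have i2 := rintegrableZ measurableT (f a) (integrable_bh a h0).
have -> : thI * f a = \int[mu]_x (f a * bh a h x).
  by rewrite RintegralZl ?integral_bh// 1?mulrC//; exact: integrable_bh.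
rewrite -RintegralB//.
have i3 := rintegrableB measurableT i1 i2.
rewrite -lee_fin.
apply: (le_trans (y := (\int[mu]_x `|(f x * bh a h x - f a * bh a h x)%:E|)%E)).
  rewrite /Rintegral -abse_EFin.
  have := le_abse_integral mu measurableT (measurable_int mu i3).
  rewrite -[X in (X <= _)%E -> _]fineK; last by rewrite abse_fin_num; exact: integrable_fin_num.
  by rewrite fine_abse//; exact: integrable_fin_num.
apply: (@le_trans _ _ (\int[mu]_(x in ball a (2 * h)) ((h^-1)%:E * `|(f x - f a)%:E|))%E).
  have mfa : measurable_fun setT (fun x => `|(f x - f a)%:E|%E).
    apply: measurableT_comp => //; apply/measurable_EFinP; apply: measurable_funB => //.
    exact: fL2.1.
  rewrite [leRHS]integral_mkcond; apply: ge0_le_integral => //.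
  - by apply: measurableT_comp => //; exact: (measurable_int mu i3).
  - apply/(measurable_restrictT _ _).1; first exact: measurable_ball.
    by apply: measurable_funeM; exact: measurable_funTS.
  - move=> x _; rewrite patchE; case: ifPn => [_|].
      rewrite -mulrBl /= -EFinM lee_fin normrM mulrC ler_wpM2r//.
      by rewrite ger0_norm ?bh_ge0// bh_le.
    rewrite notin_setE /ball/= => /negP; rewrite -leNgt => xh.
    have -> : bh a h x = 0.
      apply: bh_out => //; case: (lerP x a) => ax; [by left|right].
      by move: xh; rewrite ltr0_norm ?subr_lt0//; lra.
    by rewrite !mulr0 subrr /= normr0.
rewrite ge0_integralZl//.
- apply: (le_trans (lee_wpmul2l _ hB)); first by rewrite lee_fin invr_ge0 ltW.
  rewrite -EFinM lee_fin le_eqVlt; apply/orP; left; apply/eqP; field.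
  by rewrite gt_eqF.
- exact: measurable_ball.
- apply: measurable_funTS; apply: measurableT_comp => //; apply/measurable_EFinP; apply: measurable_funB => //.
  exact: fL2.1.
- by rewrite lee_fin invr_ge0 ltW.
Qed.

End smooth_step.

(** * Weak derivatives and absolutely continuous representatives *)

Section du_bois_reymond.
Context {R : realType}.
Notation mu := (@lebesgue_measure R).
Implicit Types (f g u : R -> R) (a b h x : R).

Lemma mu_itv_fin a b : (mu `[a, b]%classic < +oo)%E.
Proof. by rewrite lebesgue_measure_itv/=; case: ifP; rewrite ltry. Qed.

Lemma L2_itv g a b : L2 g -> mu.-integrable `[a, b] (EFin \o g).
Proof. by move=> gL2; apply: L2_integrable => //; exact: mu_itv_fin. Qed.

Definition window a b h x := step a h x - step b h x.

Lemma window_le a b h x : `|window a b h x| <= thI.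
Proof.
have := theta_ge0 (h^-1 * x + - (a / h)); have := theta_ge0 (h^-1 * x + - (b / h)).
have := theta_le (h^-1 * x + - (a / h)); have := theta_le (h^-1 * x + - (b / h)).
by rewrite /window /step ler_norml => *; apply/andP; split; lra.
Qed.

Lemma window_out a b h x : 0 < h -> a < b -> x <= a \/ b + h <= x -> window a b h x = 0.
Proof.
move=> h0 ab [xa|xb]; rewrite /window.
  by rewrite !step_le// ?subrr//; lra.
by rewrite !step_ge// ?subrr//; lra.
Qed.

Lemma window_integrable f a b h : L2 f -> 0 < h -> a < b ->
  mu.-integrable setT (EFin \o (fun x => f x * window a b h x)).
Proof.
move=> fL2 h0 ab; apply: (@L2_integrable_mul _ _ _ a (b + h) thI) => //.
- by apply: measurable_funB; exact: measurable_step.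
- by move=> x; exact: window_le.
- move=> x /negP; rewrite negb_and -!ltNge => /orP xa; apply: window_out => //.
  by case: xa => /ltW; [left|right].
Qed.

(** The window tends pointwise to [thI] on []a, b]] and to 0 elsewhere, since each step still
    vanishes at its own starting point. The widths are at most 1, so everything is dominated on
    [[a, b + 1]]. *)
Lemma window_limit g a b : L2 g -> a < b ->
  \int[mu]_x (g x * window a b k.+1%:R^-1 x) @[k --> \oo] --> thI * \int[mu]_(x in `[a, b]) g x.
Proof.
move=> gL2 ab.
have hk (k : nat) : 0 < k.+1%:R^-1 :> R by rewrite invr_gt0.
have hk1 (k : nat) : k.+1%:R^-1 <= 1 :> R by rewrite invf_le1// ler1n.
have mg := gL2.1.
pose G x := thI * (g x * \1_(`]a, b]%classic : set R) x).
have ig : mu.-integrable `]a, b] (EFin \o g).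
  by apply: integrableS (L2_itv a b gL2) => //; exact: subset_itv_oc_cc.
have igi : mu.-integrable setT (EFin \o (fun x => g x * \1_(`]a, b]%classic : set R) x)).
  have -> : EFin \o (fun x => g x * \1_(`]a, b]%classic : set R) x) = (EFin \o g) \_ `]a, b].
    apply/funext => x; rewrite patchE /= indicE; case: ifPn => _; rewrite ?mulr1 ?mulr0//.
  by apply/integrable_restrict => //=; rewrite setTI.
have GE : \int[mu]_x G x = thI * \int[mu]_(x in `[a, b]) g x.
  rewrite RintegralZl//; congr (_ * _).
  rewrite -(Rintegral_itv_obnd_cbnd ig) [RHS]Rintegral_mkcond.
  by apply: eq_Rintegral => x _; rewrite patchE indicE; case: ifPn => _; rewrite ?mulr1 ?mulr0.
case: (@dominated_convergence _ _ _ mu setT measurableT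
  (fun k x => (g x * window a b k.+1%:R^-1 x)%:E) (EFin \o G)
  (EFin \o (fun x => `|g x * (thI * \1_(`[a, b + 1]%classic : set R) x)|))) => //.
- move=> k; apply/measurable_EFinP; apply: measurable_funM => //.
  by apply: measurable_funB; exact: measurable_step.
- exact: (measurable_int mu (rintegrableZ measurableT thI igi)).
- apply: aeW => x _; apply: cvg_near_cst; rewrite /G /=.
  have nd (r : R) : 0 < r -> \forall k \near \oo, k.+1%:R^-1 <= r.
    move=> r0; near=> k; rewrite invf_ple ?posrE//.
    rewrite (@le_trans _ _ k%:R)// ?ler_nat//.
    by near: k; exact: nbhs_infty_ger.
  case: (lerP x a) => xa.
    near=> k; rewrite window_out//; last by left.
    by rewrite indicE memNset ?mulr0//= in_itv/= ltNge xa.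
  have h1 : \forall k \near \oo, k.+1%:R^-1 <= x - a by apply: nd; rewrite subr_gt0.
  case: (lerP x b) => xb.
    apply: filterS h1 => k kx.
    rewrite indicE mem_set/= ?in_itv/= ?xa ?xb// mulr1 mulrC /window.
    have -> : step a k.+1%:R^-1 x = thI by apply: step_ge => //; move: kx; rewrite lerBrDl.
    by rewrite step_le// subr0.
  have h2 : \forall k \near \oo, k.+1%:R^-1 <= x - b by apply: nd; rewrite subr_gt0.
  apply: filterS h2 => k kx.
  rewrite window_out//; last by right; move: kx; rewrite lerBrDl.
  by rewrite indicE memNset ?mulr0//= in_itv/= => /andP[_]; rewrite leNgt xb.
- have := @L2_integrable_mul _ g (fun x => thI * \1_(`[a, b + 1]%classic : set R) x) a (b + 1) thI gL2.
  move=> h; have := integrable_abse (h _ _ _).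
  apply => [|x|x /negP xab].
  + by apply: measurable_funM.
  + have t0 : 0 <= thI :> R by rewrite ltW// thI_gt0.
    rewrite normrM (ger0_norm t0) ler_piMr// indicE; case: (_ \in _); by rewrite ?normr1 ?normr0.
  + by rewrite indicE memNset ?mulr0//= in_itv/=; exact/negP.
- apply: aeW => x k _; rewrite /= lee_fin !normrM ler_wpM2l//.
  rewrite indicE; case: (pselect (a <= x <= b + 1)) => [xab|/negP xab].
    by rewrite mem_set/= ?in_itv//= normr1 mulr1 (ger0_norm (ltW thI_gt0)) window_le.
  rewrite window_out ?normr0 ?mulr_ge0//.
  move: xab; rewrite negb_and -!ltNge => /orP[/ltW|xb]; [by left|right].
  by apply: (le_trans _ (ltW xb)); rewrite lerD2l.
move=> _ _; rewrite (RintegralE measurableT (rintegrableZ measurableT thI igi)) GE.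
by move=> /fine_cvgP[_]; exact.
Unshelve. all: by end_near. Qed.

Lemma window_test a b h : 0 < h -> a < b -> test_fun (window a b h).
Proof.
move=> h0 ab; split.
  apply: diffn_smooth => n.
  have -> : window a b h = (fun x => step a h x + (-1) * step b h x).
    by apply/funext => x; rewrite /window mulN1r.
  apply: diffnD; first by apply: diffn_affine; exact: diffn_theta.
  by apply: diffnM; [exact: diffn_cst|apply: diffn_affine; exact: diffn_theta].
exists (`|a| + `|b| + h) => x xM; apply: window_out => //.
have := ler_norm a; have := ler_norm b; have := ler_norm (- a); rewrite normrN => *.
case: (lerP x a) => xa; [by left|right].
move: xM; case: (ger0P x) => x0 xM; have := normr_ge0 a; have := normr_ge0 b; lra.
Qed.

Lemma derive_window a b h : derive1 (window a b h) = (fun x => bh a h x - bh b h x).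
Proof.
apply/funext => x; apply: derive1_val; apply: derB; exact: is_derive_step.
Qed.

(* Test against [window a b h], a smoothed indicator of [[a, b]], and let [h] tend to [0]. *)
Lemma weak_deriv_lebesgue_pt f g a b : L2 f -> L2 g -> weak_deriv f g -> a < b ->
  lebesgue_pt f a -> lebesgue_pt f b -> f b - f a = \int[mu]_(x in `[a, b]) g x.
Proof.
move=> fL2 gL2 fg ab fa fb.
have t0 := thI_gt0 (R := R).
apply/eqP; rewrite -subr_eq0 -normr_le0; apply/ler_addgt0Pr => e e0; rewrite add0r.
have e1 : 0 < e * thI / 3 by rewrite divr_gt0// mulr_gt0.
have [d1 d10 d1P] := bh_average fL2 fa e1.
have [d2 d20 d2P] := bh_average fL2 fb e1.
have /cvgrPdist_le/(_ _ e1) wl := window_limit gL2 ab.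
have nd (r : R) : 0 < r -> \forall k \near \oo, k.+1%:R^-1 < r.
  move=> r0; near=> k0; rewrite invf_plt ?posrE//.
  rewrite (@lt_le_trans _ _ k0%:R)// ?ler_nat//.
  by near: k0; exact: nbhs_infty_gtr.
near \oo => k.
have h0 : 0 < k.+1%:R^-1 :> R by rewrite invr_gt0.
have A := d1P k.+1%:R^-1; have B := d2P k.+1%:R^-1.
have k1d : k.+1%:R^-1 < d1 by near: k; exact: nd.
have k2d : k.+1%:R^-1 < d2 by near: k; exact: nd.
have k1 : 0 < (k.+1%:R^-1 : R) < d1 by apply/andP.
have k2 : 0 < (k.+1%:R^-1 : R) < d2 by apply/andP.
have {}A := A k1; have {}B := B k2.
have C : `|thI * \int[mu]_(x in `[a, b]) g x - \int[mu]_x (g x * window a b k.+1%:R^-1 x)| <= e * thI / 3.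
  by near: k; exact: wl.
have ib c : mu.-integrable setT (EFin \o (fun x => f x * bh c k.+1%:R^-1 x)).
  apply: (@L2_integrable_mul _ _ _ c (c + k.+1%:R^-1) (k.+1%:R^-1)^-1) => //.
  - exact: measurable_bh.
  - by move=> x; rewrite ger0_norm ?bh_ge0// bh_le.
  - move=> x /negP; rewrite negb_and -!ltNge => /orP xa; apply: bh_out => //.
    by case: xa => /ltW; [left|right].
have E : \int[mu]_x (f x * bh a k.+1%:R^-1 x) - \int[mu]_x (f x * bh b k.+1%:R^-1 x) =
   - \int[mu]_x (g x * window a b k.+1%:R^-1 x).
  rewrite -RintegralB//; have := fg _ (window_test h0 ab).
  rewrite derive_window.
  have -> : (fun x => (f x * (bh a k.+1%:R^-1 x - bh b k.+1%:R^-1 x))%:E) =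
    (fun x => (f x * bh a k.+1%:R^-1 x - f x * bh b k.+1%:R^-1 x)%:E).
    by apply/funext => x; rewrite mulrBr.
  rewrite RintegralE//; last exact: (rintegrableB measurableT (ib a) (ib b)).
  by rewrite RintegralE ?window_integrable// -EFinN => -[].
have : thI * `|f b - f a - \int[mu]_(x in `[a, b]) g x| <= e * thI.
  rewrite -[X in X * _](ger0_norm (ltW t0)) -normrM.
  have -> : thI * (f b - f a - \int[mu]_(x in `[a, b]) g x) =
   (\int[mu]_x (f x * bh a k.+1%:R^-1 x) - thI * f a) - (\int[mu]_x (f x * bh b k.+1%:R^-1 x) - thI * f b)
   - (thI * \int[mu]_(x in `[a, b]) g x - \int[mu]_x (g x * window a b k.+1%:R^-1 x)).
    by lra.
  apply: (le_trans (ler_normB _ _)); apply: (@le_trans _ _ (e * thI / 3 + e * thI / 3 + e * thI / 3)); last by lra.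
  by apply: lerD => //; apply: (le_trans (ler_normB _ _)); apply: lerD.
by rewrite mulrC ler_pM2r.
Unshelve. all: by end_near. Qed.

(** Absolute continuity in integrated form; weak derivatives of the data are used in this form from
    here on. *)
Definition abscont u g := forall a b, a <= b -> u b - u a = \int[mu]_(x in `[a, b]) g x.

Lemma Rintegral_cat g a b c : L2 g -> a <= b -> b <= c ->
  \int[mu]_(x in `[a, b]) g x + \int[mu]_(x in `[b, c]) g x = \int[mu]_(x in `[a, c]) g x.
Proof.
move=> gL2 ab bc.
have h := @Rintegral_itvB R g (BLeft a) (BRight c) b (L2_itv a c gL2).
rewrite -(Rintegral_itv_obnd_cbnd (r := b)); last first.
  by apply: integrableS (L2_itv b c gL2) => //; exact: subset_itv_oc_cc.
by rewrite -h ?bnd_simp//; lra.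
Qed.

(** The signed integral from [p] to [x]: at least one of the two intervals is empty or a single
    point. *)
Definition prim g p x := \int[mu]_(y in `[p, x]) g y - \int[mu]_(y in `[x, p]) g y.

Lemma Rintegral_itv_ge g a b : b <= a -> \int[mu]_(y in `[a, b]) g y = 0.
Proof.
rewrite le_eqVlt => /orP[/eqP->|ba]; first by rewrite set_itv1 Rintegral_set1.
by rewrite set_itv_ge ?Rintegral_set0// bnd_simp -ltNge.
Qed.

Lemma AC_prim g p : L2 g -> abscont (prim g p) g.
Proof.
move=> gL2 a b ab; rewrite /prim.
case: (lerP p a) => pa.
  rewrite !(@Rintegral_itv_ge _ _ p)//; last exact: (le_trans pa).
  by rewrite -(Rintegral_cat gL2 pa ab); lra.
case: (lerP p b) => pb.
  rewrite (@Rintegral_itv_ge _ p a) ?ltW// (@Rintegral_itv_ge _ b p)//.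
  by rewrite -(Rintegral_cat gL2 (ltW pa) pb); lra.
rewrite !(@Rintegral_itv_ge _ p) ?ltW//.
by rewrite -(Rintegral_cat gL2 ab (ltW pb)); lra.
Qed.

(** Take one Lebesgue point of [f] as base point; at every other one [weak_deriv_lebesgue_pt]
    identifies [f] with the primitive of [g], and Lebesgue points have full measure. *)
Lemma weak_deriv_rep f g : L2 f -> L2 g -> weak_deriv f g ->
  exists u, abscont u g /\ {ae mu, forall x, f x = u x}.
Proof.
move=> fL2 gL2 fg.
have lp := lebesgue_differentiation (L2_locally_integrable fL2).
(* Otherwise the exceptional null set would contain [[0, 1]]. *)
have [p fp] : exists p, lebesgue_pt f p.
  apply: contrapT => np; case: lp => N [mN N0 NP].
  have N1 : `[(0 : R), 1]%classic `<=` N by move=> x _; apply: NP => /= h; apply: np; exists x.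
  have : (mu (`[0%R, 1%R]%classic : set R) <= mu N)%E by apply: le_measure; rewrite ?inE.
  by rewrite N0 lebesgue_measure_itv/= lte_fin ltr01 oppr0 adde0 lee_fin ler10.
exists (fun x => f p + prim g p x); split.
  by move=> a b ab; rewrite -(AC_prim p gL2 ab); lra.
apply: filterS lp; first exact: (ae_filter_ringOfSetsType mu).
move=> x fx; rewrite /prim; case: (ltgtP p x) => [px|xp|<-].
- rewrite (@Rintegral_itv_ge _ x p) ?ltW// -(weak_deriv_lebesgue_pt fL2 gL2 fg px fp fx); lra.
- rewrite (@Rintegral_itv_ge _ p x) ?ltW// -(weak_deriv_lebesgue_pt fL2 gL2 fg xp fx fp); lra.
- by rewrite subrr addr0.
Qed.

End du_bois_reymond.

(** * Absolutely continuous functions with square integrable derivative *)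

Section absolutely_continuous.
Context {R : realType}.
Notation mu := (@lebesgue_measure R).
Implicit Types (f g u q : R -> R) (a b x y : R).

Lemma Rintegral_itv_cst a b c : a <= b -> \int[mu]_(y in `[a, b]) c = c * (b - a).
Proof.
move=> ab; rewrite Rintegral_cst//= lebesgue_measure_itv/=.
case: ifPn => [_|]; first by rewrite -EFinB.
rewrite lte_fin -leNgt => ba; have -> : a = b by apply/eqP; rewrite eq_le ab.
by rewrite subrr.
Qed.

Lemma L2_sq_itv g a b : L2 g -> mu.-integrable `[a, b] (EFin \o (fun y => g y ^+ 2)).
Proof. by move=> [_ gi]; apply: integrableS gi. Qed.

Lemma integrable_itv_cst a b c : mu.-integrable `[a, b] (EFin \o (fun=> c)).
Proof. by apply: finite_integrable_cst => //; exact: mu_itv_fin. Qed.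

Lemma rintegrable_itvZ k f a b : mu.-integrable `[a, b] (EFin \o f) ->
  mu.-integrable `[a, b] (EFin \o (fun y => k * f y)).
Proof. by move=> fi; apply: rintegrableZ. Qed.

Lemma rintegrable_itvD f g a b : mu.-integrable `[a, b] (EFin \o f) ->
  mu.-integrable `[a, b] (EFin \o g) -> mu.-integrable `[a, b] (EFin \o (fun y => f y + g y)).
Proof. by move=> fi gi; apply: rintegrableD. Qed.

Lemma rintegrable_itvB f g a b : mu.-integrable `[a, b] (EFin \o f) ->
  mu.-integrable `[a, b] (EFin \o g) -> mu.-integrable `[a, b] (EFin \o (fun y => f y - g y)).
Proof. by move=> fi gi; apply: rintegrableB. Qed.

(** The integral of [(g - m) ^+ 2] is nonnegative, with [m] the mean of [g] over the interval. *)
Lemma cauchy_itv g a b : L2 g -> a <= b ->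
  (\int[mu]_(y in `[a, b]) g y) ^+ 2 <= (b - a) * \int[mu]_(y in `[a, b]) (g y ^+ 2).
Proof.
move=> gL2 ab; set I := \int[mu]_(y in _) g y; set J := \int[mu]_(y in _) _.
have [ba|ba] := eqVneq a b.
  by rewrite /I Rintegral_itv_ge ?ba// expr0n/= subrr mul0r.
have d0 : 0 < b - a by rewrite subr_gt0 lt_neqAle ba.
pose m := I / (b - a).
have i1 := rintegrable_itvZ (2 * m) (L2_itv a b gL2).
have i2 := L2_sq_itv a b gL2.
have i3 := @integrable_itv_cst a b (m ^+ 2).
have : 0 <= \int[mu]_(y in `[a, b]) (g y - m) ^+ 2.
  by apply: Rintegral_ge0 => y _; exact: sqr_ge0.
have -> : \int[mu]_(y in `[a, b]) (g y - m) ^+ 2 =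
  \int[mu]_(y in `[a, b]) (g y ^+ 2 - (2 * m) * g y + m ^+ 2).
  by apply: eq_Rintegral => y _; ring.
rewrite RintegralD//; last exact: (rintegrable_itvB i2 i1).
rewrite RintegralB// RintegralZl//; last exact: L2_itv.
rewrite Rintegral_itv_cst// -/I -/J.
have -> : I = m * (b - a) by rewrite /m mulfVK ?gt_eqF.
by move=> h; nra.
Qed.

(** The half-line version: the flows are set to zero for negative arguments, and may jump at 0. *)
Definition abscontp u g := forall y, 0 <= y -> u y - u 0 = \int[mu]_(x in `[0, y]) g x.

Lemma AC_ACp u g : abscont u g -> abscontp u g.
Proof. by move=> h y y0; exact: h. Qed.

Lemma enorm2_itv_le g a b : L2 g -> 0 <= \int[mu]_(y in `[a, b]) (g y ^+ 2) <= fine (enorm2 g).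
Proof.
move=> gL2; apply/andP; split; first by apply: Rintegral_ge0 => y _; exact: sqr_ge0.
rewrite -lee_fin -RintegralE//; last exact: L2_sq_itv.
rewrite fineK; last by rewrite ge0_fin_numE ?enorm2_ge0// L2_enorm2.
rewrite /enorm2; apply: ge0_subset_integral => //.
- by apply/measurable_EFinP; apply: measurable_funX; exact: gL2.1.
- by move=> y _; rewrite lee_fin sqr_ge0.
Qed.

Lemma AC_holder u g a b : L2 g -> abscont u g -> (u b - u a) ^+ 2 <= `|b - a| * fine (enorm2 g).
Proof.
move=> gL2 h; wlog ab : a b / a <= b => [H|].
  case: (leP a b) => [|/ltW] ab; first exact: H.
  by have := H _ _ ab; rewrite -(sqrrN (u a - u b)) opprB distrC.
rewrite (h _ _ ab) (le_trans (cauchy_itv gL2 ab))// ger0_norm ?subr_ge0//.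
by rewrite ler_wpM2l ?subr_ge0//; have /andP[] := enorm2_itv_le a b gL2.
Qed.

Lemma AC_continuous u g : L2 g -> abscont u g -> continuous u.
Proof.
move=> gL2 h x; apply/cvgrPdist_lt => e e0.
have n0 : 0 <= fine (enorm2 g) by apply: fine_ge0; exact: enorm2_ge0.
have d0 : 0 < (e ^+ 2 / (fine (enorm2 g) + 1)) by rewrite divr_gt0 ?exprn_gt0// ltr_wpDl.
near=> y.
have xy : `|x - y| < e ^+ 2 / (fine (enorm2 g) + 1).
  by near: y; have := @cvg_id _ (nbhs x) => /cvgrPdist_lt; apply.
rewrite -(@ltr_pXn2r _ 2) ?nnegrE// ?ltW//.
rewrite real_normK ?num_real//; apply: (le_lt_trans (AC_holder _ _ gL2 h)).
move: xy; rewrite ltr_pdivlMr; last by rewrite ltr_wpDl.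
by apply: le_lt_trans; rewrite ler_wpM2l// lerDl.
Unshelve. all: by end_near. Qed.

(** Average [u x ^+ 2 <= 2 u y ^+ 2 + 2 (u y - u x) ^+ 2] over [y] in [[x, x + 1]] and apply
    Cauchy-Schwarz to the increment. Being local, the bound gives decay at infinity as well as
    boundedness. *)
Lemma AC_sobolev u g x : L2 u -> L2 g -> abscont u g ->
  u x ^+ 2 <= 2 * \int[mu]_(y in `[x, x + 1]) (u y ^+ 2) + 2 * \int[mu]_(y in `[x, x + 1]) (g y ^+ 2).
Proof.
move=> uL2 gL2 h; set J := \int[mu]_(y in `[x, x + 1]) (g y ^+ 2).
have i1 := rintegrable_itvZ 2 (L2_sq_itv x (x + 1) uL2).
have i2 := @integrable_itv_cst x (x + 1) (2 * J).
have xx : x <= x + 1 by rewrite lerDl.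
have -> : u x ^+ 2 = \int[mu]_(y in `[x, x + 1]) (u x ^+ 2).
  by rewrite Rintegral_itv_cst// addrAC subrr add0r mulr1.
have -> : 2 * \int[mu]_(y in `[x, x + 1]) u y ^+ 2 + 2 * J =
  \int[mu]_(y in `[x, x + 1]) (2 * u y ^+ 2 + 2 * J).
  rewrite RintegralD// RintegralZl//; last exact: L2_sq_itv.
  by rewrite Rintegral_itv_cst// [x + 1]addrC addrK mulr1.
apply: le_Rintegral => //.
- exact: integrable_itv_cst.
- exact: (rintegrable_itvD i1 i2).
- move=> y; rewrite /= in_itv/= => /andP[xy yx].
  have hd : (u y - u x) ^+ 2 <= J.
    rewrite (h _ _ xy) (le_trans (cauchy_itv gL2 xy))//.
    have J1 : \int[mu]_(t in `[x, y]) (g t ^+ 2) <= J.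
      have := Rintegral_itvB (L2_sq_itv x (x + 1) gL2) (x := y).
      rewrite !bnd_simp => /(_ xy yx) e; rewrite -subr_ge0 e.
      by apply: Rintegral_ge0 => t _; exact: sqr_ge0.
    have J0 : 0 <= \int[mu]_(t in `[x, y]) (g t ^+ 2).
      by apply: Rintegral_ge0 => t _; exact: sqr_ge0.
    by rewrite (le_trans _ J1)// ler_piMl//; lra.
  have := sqr_ge0 (2 * u y - u x); nra.
Qed.

Lemma AC_bounded u g : L2 u -> L2 g -> abscont u g -> forall x,
  u x ^+ 2 <= 2 * (fine (enorm2 u) + fine (enorm2 g)).
Proof.
move=> uL2 gL2 h x; have := AC_sobolev x uL2 gL2 h.
by have := enorm2_itv_le x (x + 1) uL2; have := enorm2_itv_le x (x + 1) gL2; lra.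
Qed.

Lemma tail_integral f : mu.-integrable setT (EFin \o f) -> (forall x, 0 <= f x) ->
  forall e : R, 0 < e -> exists M : R, forall x, M <= x -> \int[mu]_(y in `[x, x + 1]) f y <= e.
Proof.
move=> fi f0 e e0.
case: (@dominated_convergence _ _ _ mu setT measurableT
  (fun n => (EFin \o f) \_ `[(n%:R : R), +oo[) (cst 0%E) (EFin \o f)) => //.
- move=> n; apply/(measurable_restrictT _ _).1 => //.
  by apply: measurable_funTS; exact: (measurable_int mu fi).
- apply: aeW => x _; apply: cvg_near_cst; near=> n.
  rewrite patchE memNset//= in_itv/= andbT; apply/negP; rewrite -ltNge.
  by near: n; exact: nbhs_infty_gtr.
- by apply: aeW => x n _; rewrite patchE; case: ifPn => _; rewrite ?abse0/= ?lee_fin// ger0_norm.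
move=> _ _; rewrite integral0 => /fine_cvgP[fin /cvgr0Pnorm_lt/(_ e e0) h].
near \oo => n; exists n%:R => x nx.
have finn : (\int[mu]_x ((EFin \o f) \_ `[(n%:R : R), +oo[) x)%E \is a fin_num by near: n; exact: fin.
rewrite -lee_fin -RintegralE//; last by apply: integrableS fi.
apply: (@le_trans _ _ (\int[mu]_x ((EFin \o f) \_ `[(n%:R : R), +oo[) x)%E).
  rewrite -integral_mkcond; apply: ge0_subset_integral => //.
  - by apply: measurable_funTS; exact: (measurable_int mu fi).
  - by move=> y _; rewrite lee_fin.
  - move=> y; rewrite /= !in_itv/= andbT => /andP[xy _]; exact: le_trans xy.
rewrite -(fineK finn) lee_fin (le_trans (ler_norm _))// ltW//; near: n; exact: h.
Unshelve. all: by end_near. Qed.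

(** Both sides integrate [P y * Q z] over the region [z <= y]; integration by parts is derived from
    this exchange. *)
Lemma fubini_triangle (P Q : R -> R) :
  mu.-integrable setT (EFin \o P) -> mu.-integrable setT (EFin \o Q) ->
  \int[mu]_y (P y * \int[mu]_z (if z <= y then Q z else 0)) =
  \int[mu]_z (Q z * \int[mu]_y (if z <= y then P y else 0)).
Proof.
move=> iP iQ.
have mP := rintegrable_meas iP; have mQ := rintegrable_meas iQ.
pose K (p : measurableTypeR R * measurableTypeR R) : \bar R :=
  (if p.2 <= p.1 then P p.1 * Q p.2 else 0)%:E.
have mK : measurable_fun setT K.
  apply/measurable_EFinP; apply: measurable_fun_ifT => //.
    by apply: measurable_fun_ler; [exact: measurable_snd|exact: measurable_fst].
  by apply: measurable_funM; [exact: (measurableT_comp mP)|exact: (measurableT_comp mQ)].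
have iK : (mu \x mu)%E.-integrable setT K.
  apply/integrable12ltyP => //.
  apply: (@le_lt_trans _ _ (\int[mu]_y ((`|P y|)%:E * \int[mu]_z (`|Q z|)%:E))%E).
    apply: ge0_le_integral => //.
    - by move=> y _; apply: integral_ge0.
    - have mAK : measurable_fun setT (abse \o K) by exact: measurableT_comp.
      by apply: (@measurable_fun_fubini_tonelli_F _ _ _ _ _ mu (abse \o K)) => // p; exact: abse_ge0.
    - by apply: emeasurable_funM => //; apply/measurable_EFinP; exact: measurableT_comp.
    - move=> y _; rewrite -ge0_integralZl//; last by apply/measurable_EFinP; exact: measurableT_comp.
      apply: ge0_le_integral => //.
      + by apply: measurableT_comp => //; exact: (measurableT_comp mK (pair1_measurable y)).
      + by apply: measurable_funeM; apply/measurable_EFinP; exact: measurableT_comp.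
      + move=> z _; rewrite /K/= -EFinM lee_fin; case: ifP => _; first by rewrite normrM.
        by rewrite normr0 mulr_ge0.
  have /integrableP[_ lP] := iP; have /integrableP[_ lQ] := iQ.
  rewrite ge0_integralZr//.
  - by rewrite lte_mul_pinfty//; [exact: integral_ge0|rewrite ge0_fin_numE ?integral_ge0].
  - by apply/measurable_EFinP; exact: measurableT_comp.
  - exact: integral_ge0.
have := Fubini iK; rewrite /Rintegral.
have sP y : mu.-integrable setT (EFin \o (fun z => if z <= y then Q z else 0)).
  apply: (rintegrable_le (nu := mu) measurableT (fun z => `|Q z|)) => //.
  - by apply: measurable_fun_ifT => //; apply: measurable_fun_ler.
  - by move=> z _; case: ifP => _; rewrite ?normr0.
  - by have := integrable_abse iQ.
have sQ z : mu.-integrable setT (EFin \o (fun y => if z <= y then P y else 0)).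
  apply: (rintegrable_le (nu := mu) measurableT (fun z => `|P z|)) => //.
  - by apply: measurable_fun_ifT => //; apply: measurable_fun_ler.
  - by move=> y _; case: ifP => _; rewrite ?normr0.
  - by have := integrable_abse iP.
move=> h; congr fine; move: h; congr (_ = _); apply: eq_integral => t _.
- rewrite EFinM -RintegralE//.
  rewrite -(integralZl measurableT (sP t)).
  by apply: eq_integral => z _; rewrite /K/= -EFinM; case: ifP => _; rewrite ?mulr0.
- rewrite EFinM -RintegralE//.
  rewrite -(integralZl measurableT (sQ t)).
  by apply: eq_integral => z _; rewrite /K/= -EFinM; case: ifP => _; rewrite ?mulr0// mulrC.
Qed.

End absolutely_continuous.

(** * Integration by parts on the half line *)

Section half_line.
Context {R : realType}.
Notation mu := (@lebesgue_measure R).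
Implicit Types (f g u q F p phi : R -> R) (a b x y : R).

Lemma continuous_itv_integrable f a b : continuous f -> mu.-integrable `[a, b] (EFin \o f).
Proof.
move=> cf; apply: continuous_compact_integrable; first exact: segment_compact.
exact: continuous_subspaceT.
Qed.

Lemma FTC2_line q q' a b : (forall x, is_derive x 1 q (q' x)) -> continuous q' -> a <= b ->
  \int[mu]_(x in `[a, b]) q' x = q b - q a.
Proof.
move=> hq cq'; rewrite le_eqVlt => /orP[/eqP->|ab]; first by rewrite set_itv1 Rintegral_set1 subrr.
have cq := is_derive_continuous hq.
rewrite /Rintegral (@continuous_FTC2 _ q' q a b ab)//.
- exact: continuous_subspaceT.
- split.
  + by move=> x _; case: (hq x).
  + by apply: cvg_at_right_filter; exact: cq.
  + by apply: cvg_at_left_filter; exact: cq.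
- by move=> x _; exact: derive1_val.
Qed.

Lemma Rintegral_restrict_if f a b y : a <= y -> y <= b ->
  \int[mu]_z (if z <= y then (f \_ `[a, b]) z else 0) = \int[mu]_(z in `[a, y]) f z.
Proof.
move=> ay yb; rewrite [RHS]Rintegral_mkcond; apply: eq_Rintegral => z _.
rewrite !patchE !mem_setE !in_itv/=; case: (leP z y) => zy; last by rewrite andbF.
by rewrite andbT (le_trans zy yb) andbT.
Qed.

Lemma Rintegral_restrict_ifr f a b z : a <= z ->
  \int[mu]_y (if z <= y then (f \_ `[a, b]) y else 0) = \int[mu]_(y in `[z, b]) f y.
Proof.
move=> ay; rewrite [RHS]Rintegral_mkcond; apply: eq_Rintegral => y _.
rewrite !patchE !mem_setE !in_itv/=; case: (leP z y) => zy //=.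
by rewrite (le_trans ay zy).
Qed.

Lemma integrable_patch f a b : mu.-integrable `[a, b] (EFin \o f) ->
  mu.-integrable setT (EFin \o (f \_ `[a, b])).
Proof.
by move=> fi; rewrite -restrict_EFin; apply/integrable_restrict => //=; rewrite setTI.
Qed.

Lemma abscontp_ext u g : L2 g -> abscontp u g ->
  exists2 U, continuous U & forall y, 0 <= y -> u y = U y.
Proof.
move=> gL2 h; exists (fun y => u 0 + prim g 0 y).
  move=> y; apply: cvgD; first exact: cvg_cst.
  exact: (AC_continuous gL2 (AC_prim 0 gL2)).
move=> y y0; have := AC_prim 0 gL2 y0; rewrite -(h _ y0) /prim.
by rewrite set_itv1 !Rintegral_set1; lra.
Qed.

(** Write [u y - u 0] as the integral of [g] and exchange the order of integration: the inner
    integral of [q'] is then explicit, and [u] need not be differentiable at any given point. *)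
Lemma ibp0 u g q q' b : L2 g -> abscontp u g -> (forall x, is_derive x 1 q (q' x)) ->
  continuous q' -> 0 <= b ->
  \int[mu]_(y in `[0, b]) (u y * q' y) =
  u b * q b - u 0 * q 0 - \int[mu]_(y in `[0, b]) (g y * q y).
Proof.
move=> gL2 h hq cq' b0.
have cq := is_derive_continuous hq.
have [U cU uU] := abscontp_ext gL2 h.
have iP := integrable_patch (continuous_itv_integrable 0 b cq').
have iQ := integrable_patch (L2_itv 0 b gL2).
have := fubini_triangle iP iQ.
have -> : \int[mu]_y ((q' \_ `[0, b]) y * \int[mu]_z (if z <= y then (g \_ `[0, b]) z else 0)) =
  \int[mu]_(y in `[0, b]) (u y * q' y - u 0 * q' y).
  rewrite [RHS]Rintegral_mkcond; apply: eq_Rintegral => y _.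
  rewrite !patchE; case: ifPn => [|_]; last by rewrite mul0r.
  rewrite mem_setE in_itv/= => /andP[y0 yb].
  by rewrite Rintegral_restrict_if// -(h y y0); ring.
have -> : \int[mu]_z ((g \_ `[0, b]) z * \int[mu]_y (if z <= y then (q' \_ `[0, b]) y else 0)) =
  \int[mu]_(z in `[0, b]) (q b * g z - g z * q z).
  rewrite [RHS]Rintegral_mkcond; apply: eq_Rintegral => y _.
  rewrite !patchE; case: ifPn => [|_]; last by rewrite mul0r.
  rewrite mem_setE in_itv/= => /andP[y0 yb].
  by rewrite Rintegral_restrict_ifr// (FTC2_line hq)//; ring.
have i1 : mu.-integrable `[0, b] (EFin \o (fun y => u y * q' y)).
  have : mu.-integrable `[0, b] (EFin \o (fun y => U y * q' y)).
    apply: continuous_itv_integrable => y; apply: cvgM; [exact: cU|exact: cq'].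
  apply: eq_integrable => // y; rewrite inE/= in_itv/= => /andP[y0 _].
  by rewrite uU.
have i2 := rintegrable_itvZ (u 0) (continuous_itv_integrable 0 b cq').
have i3 := rintegrable_itvZ (q b) (L2_itv 0 b gL2).
have i4 : mu.-integrable `[0, b] (EFin \o (fun y => g y * q y)).
  have [M MP] : exists M, forall y, 0 <= y <= b -> `|q y| <= M.
    have cqn : {within `[0, b], continuous (fun y => `|q y|)}.
      apply: continuous_subspaceT => y; apply: cvg_norm; exact: cq.
    have [c _ cP] := EVT_max b0 cqn.
    by exists `|q c| => y yb; apply: cP; rewrite in_itv.
  have mq : measurable_fun setT q by exact: continuous_measurable_fun.
  apply: (rintegrable_le (nu := mu) _ (fun y => M * `|g y|)) => //.
  - by apply: measurable_funTS; apply: measurable_funM => //; exact: gL2.1.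
  - move=> y; rewrite /= in_itv/= => yb; rewrite normrM mulrC ler_wpM2r//; exact: MP.
  - apply: rintegrable_itvZ; have := integrable_abse (L2_itv 0 b gL2); exact.
rewrite RintegralB// RintegralZl//; last exact: continuous_itv_integrable.
rewrite RintegralB// RintegralZl//; last exact: L2_itv.
by rewrite (FTC2_line hq)// -(h _ b0); lra.
Qed.

Lemma Rintegral_halfline_lim f : mu.-integrable `[0, +oo[ (EFin \o f) ->
  \int[mu]_(y in `[0, n%:R]) f y @[n --> \oo] --> \int[mu]_(y in `[0, +oo[) f y.
Proof.
move=> fi.
have mf := measurable_int mu fi.
have sub (n : nat) : `[(0:R), n%:R] `<=` `[0, +oo[ by move=> y; rewrite /= !in_itv/= andbT => /andP[].
case: (@dominated_convergence _ _ _ mu setT measurableT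
  (fun n => (EFin \o f) \_ `[0, n%:R]) ((EFin \o f) \_ `[0, +oo[) ((abse \o (EFin \o f)) \_ `[0, +oo[)) => //.
- move=> n; apply/(measurable_restrictT _ _).1 => //.
  exact: measurable_funS mf.
- exact/(measurable_restrictT _ _).1.
- apply: aeW => x _; apply: cvg_near_cst; near=> n.
  rewrite !patchE !mem_setE !in_itv/= andbT; case: (leP 0 x) => //= x0.
  by rewrite ifT//; near: n; exact: nbhs_infty_ger.
- by apply/integrable_restrict => //=; rewrite setTI; exact: integrable_abse.
- apply: aeW => x n _; rewrite !patchE; case: ifPn => [h|_]; last first.
    by rewrite abse0; case: ifP => _; rewrite ?abse_ge0.
  by rewrite ifT//; move: h; rewrite !inE; exact: sub.
move=> _ _; rewrite -!integral_mkcond.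
have -> : (\int[mu]_(x in `[0%R, +oo[) (EFin \o f) x = (\int[mu]_(x in `[0%R, +oo[) f x)%:E)%E.
  by rewrite -RintegralE.
move=> h; have {}h := fine_cvg h.
have e : (fun n : nat => \int[mu]_(y in `[0, n%:R]) f y) =
    (fun n : nat => fine (\int[mu]_x ((EFin \o f) \_ (`[0%R, n%:R%R]%classic : set R)) x)%E).
  by apply/funext => n; rewrite /= -integral_mkcond.
by rewrite e; exact: h.
Unshelve. all: by end_near. Qed.

(** Shared by test functions and heat kernels, so that one integration by parts serves for weak
    derivatives as well as for kernels. *)
Definition gdecay q := exists C c : R, [/\ 0 <= C, 0 < c & forall y, `|q y| <= C * expR (- (c * y ^+ 2))].

Lemma gdecay_L2 q : measurable_fun setT q -> gdecay q -> L2 q.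
Proof.
move=> mq [C [c [C0 c0 qC]]]; split => //.
have i : mu.-integrable setT (EFin \o (fun y => C ^+ 2 * expR (- (2 * c * y ^+ 2)))).
  exact: (rintegrableZ measurableT (C ^+ 2) (@integrable_expsq R (2 * c) (mulr_gt0 _ c0))).
apply: (rintegrable_le (nu := mu) measurableT (fun y => C ^+ 2 * expR (- (2 * c * y ^+ 2)))) => //.
  exact: measurable_funX.
move=> y _; rewrite ger0_norm ?sqr_ge0// -[leLHS]real_normK ?num_real//.
apply: (@le_trans _ _ ((C * expR (- (c * y ^+ 2))) ^+ 2)).
  by rewrite lerXn2r ?nnegrE// mulr_ge0// expR_ge0.
by rewrite exprMn -expRM_natl ler_wpM2l ?sqr_ge0// ler_expR; lra.
Qed.

Lemma L2_mul_integrable f g : L2 f -> L2 g -> mu.-integrable setT (EFin \o (fun y => f y * g y)).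
Proof.
move=> [mf fi] [mg gi].
apply: (rintegrable_le (nu := mu) measurableT (fun y => f y ^+ 2 + g y ^+ 2)).
- exact: measurable_funM.
- move=> y _; rewrite normrM -[f y ^+ 2]real_normK ?num_real// -[g y ^+ 2]real_normK ?num_real//.
  have := sqr_ge0 (`|f y| - `|g y|); have := sqr_ge0 (`|f y| + `|g y|); nra.
- exact: rintegrableD.
Qed.

Lemma gdecay_integrable q : measurable_fun setT q -> gdecay q -> mu.-integrable setT (EFin \o q).
Proof.
move=> mq [C [c [C0 c0 qC]]].
apply: (rintegrable_le (nu := mu) measurableT (fun y => C * expR (- (c * y ^+ 2)))) => //.
exact: (rintegrableZ measurableT C (integrable_expsq c0)).
Qed.

Lemma gdecay_cvg0 q : gdecay q -> q n%:R @[n --> \oo] --> (0 : R).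
Proof.
move=> [C [c [C0 c0 qC]]]; apply/cvgrPdist_lt => e e0; near=> n.
rewrite sub0r normrN (le_lt_trans (qC _))// expRN.
rewrite ltr_pdivrMr ?expR_gt0//.
have n1 : C < e * c * n%:R.
  rewrite -ltr_pdivrMl ?mulr_gt0//; near: n; exact: nbhs_infty_gtr.
have enorm2 : (1 : R) <= n%:R by rewrite ler1n; near: n; exists 1%N.
apply: (lt_le_trans n1); rewrite -mulrA ler_wpM2l ?(ltW e0)//.
have := expR_ge1Dx (c * n%:R ^+ 2); have : c * n%:R <= c * n%:R ^+ 2.
  by rewrite ler_wpM2l ?(ltW c0)// expr2 ler_peMl// (le_trans _ enorm2).
by lra.
Unshelve. all: by end_near. Qed.

(** Let the right end of [ibp0] tend to infinity: [u] is bounded and [q] decays, so only the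
    boundary term at 0 survives. *)
Lemma ibp_halfline u g q q' (B : R) : L2 g -> abscontp u g -> (forall y, 0 <= y -> `|u y| <= B) ->
  (forall x, is_derive x 1 q (q' x)) -> continuous q' -> gdecay q -> gdecay q' ->
  \int[mu]_(y in `[0, +oo[) (u y * q' y) = - u 0 * q 0 - \int[mu]_(y in `[0, +oo[) (g y * q y).
Proof.
move=> gL2 h uB hq cq' dq dq'.
have cq := is_derive_continuous hq.
have [U cU uU] := abscontp_ext gL2 h.
have mq : measurable_fun setT q by exact: continuous_measurable_fun.
have mq' : measurable_fun setT q' by exact: continuous_measurable_fun.
have i1 : mu.-integrable `[0, +oo[ (EFin \o (fun y => u y * q' y)).
  have : mu.-integrable `[0, +oo[ (EFin \o (fun y => U y * q' y)).
    have iq' := gdecay_integrable mq' dq'.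
    apply: (rintegrable_le (nu := mu) _ (fun y => B * `|q' y|)) => //.
    - by apply: measurable_funTS; apply: measurable_funM => //; exact: continuous_measurable_fun.
    - by move=> y; rewrite /= in_itv/= andbT => y0; rewrite normrM ler_wpM2r// -uU// uB.
    - have iq : mu.-integrable setT (EFin \o (fun y => `|q' y|)).
        by have := integrable_abse iq'; exact.
      by have := rintegrableZ measurableT B iq; exact: integrableS.
  apply: eq_integrable => // y; rewrite inE/= in_itv/= andbT => y0.
  by rewrite uU.
have i2 : mu.-integrable `[0, +oo[ (EFin \o (fun y => g y * q y)).
  have := L2_mul_integrable gL2 (gdecay_L2 mq dq); exact: integrableS.
have l1 := Rintegral_halfline_lim i1.
have l2 := Rintegral_halfline_lim i2.
have l3 : u n%:R * q n%:R @[n --> \oo] --> (0 : R).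
  have := gdecay_cvg0 dq => l.
  have B0 : 0 <= B by apply: le_trans (uB 0 _).
  apply/cvgrPdist_lt => e e0; near=> n; rewrite sub0r normrN normrM.
  apply: (@le_lt_trans _ _ (B * `|q n%:R|)); first by rewrite ler_wpM2r// uB.
  apply: (@le_lt_trans _ _ ((B + 1) * `|q n%:R|)); first by rewrite ler_wpM2r// lerDl.
  rewrite -ltr_pdivlMl; last by lra.
  have : `|0 - q n%:R| < (B + 1)^-1 * e.
    by near: n; move/cvgrPdist_lt: l; apply; rewrite mulr_gt0// invr_gt0; lra.
  by rewrite sub0r normrN.
have l4 : \int[mu]_(y in `[0, n%:R]) (u y * q' y) @[n --> \oo] -->
   0 - u 0 * q 0 - \int[mu]_(y in `[0, +oo[) (g y * q y).
  have -> : (fun n => \int[mu]_(y in `[0, n%:R]) (u y * q' y)) =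
    (fun n => u n%:R * q n%:R - u 0 * q 0 - \int[mu]_(y in `[0, n%:R]) (g y * q y)).
    by apply/funext => n; apply: ibp0.
  by apply: cvgB => //; apply: cvgB => //; exact: cvg_cst.
rewrite (cvg_unique _ l1 l4)//; by rewrite mulNr sub0r.
Unshelve. all: by end_near. Qed.

End half_line.

(** * Odd and even extensions and their weak derivatives *)

Section odd_extension.
Context {R : realType}.
Notation mu := (@lebesgue_measure R).
Implicit Types (f g u q F p phi : R -> R) (a b x y : R).

Lemma integrableN f : mu.-integrable setT (EFin \o f) ->
  mu.-integrable setT (EFin \o (fun x => f (- x))).
Proof.
move=> /integrableP[/measurable_EFinP mf lf]; apply/integrableP; split.
  by apply/measurable_EFinP; apply: (measurableT_comp mf).
move: lf; rewrite (ge0_integralN (f := fun x => `|(EFin \o f) x|%E))//.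
by apply/measurableT_comp => //; exact/measurable_EFinP.
Qed.

Lemma RintegralN f : mu.-integrable setT (EFin \o f) ->
  \int[mu]_x f x = \int[mu]_x f (- x).
Proof.
move=> fi; have fi' := integrableN fi.
have mf : measurable_fun setT (EFin \o f) by case/integrableP : fi.
rewrite /Rintegral; congr fine.
rewrite (integralE mu setT (fun x => (f x)%:E)).
rewrite (integralE mu setT (fun x => (f (- x))%:E)).
rewrite (ge0_integralN (measurable_funepos mf))//.
rewrite (ge0_integralN (measurable_funeneg mf))//.
by congr (_ - _)%E; apply: eq_integral => x _; rewrite ?funeposE ?funenegE.
Qed.

Lemma Rintegral_fold F : mu.-integrable setT (EFin \o F) ->
  \int[mu]_x F x = \int[mu]_(x in `]0, +oo[) (F x + F (- x)).
Proof.
move=> Fi.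
have Fni := integrableN Fi.
have sub D : measurable D -> mu.-integrable D (EFin \o F) by move=> mD; apply: integrableS Fi.
have pat (D : set R) f : measurable D -> mu.-integrable setT (EFin \o f) ->
   mu.-integrable setT (EFin \o (f \_ D)).
  move=> mD fi; rewrite -restrict_EFin; apply/integrable_restrict => //=; rewrite setTI.
  exact: integrableS fi.
rewrite RintegralD//; [|exact: integrableS Fi|exact: integrableS Fni].
have E : \int[mu]_x F x = \int[mu]_x ((F \_ `]0, +oo[) x + (F \_ `]-oo, 0]) x).
  apply: eq_Rintegral => x _; rewrite !patchE !mem_setE !in_itv/= andbT.
  by case: ltP => _; rewrite ?addr0 ?add0r.
rewrite E RintegralD//; [|exact: pat|exact: pat]; congr (_ + _).
  by rewrite -Rintegral_mkcond.
rewrite RintegralN; last exact: pat.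
rewrite [RHS](Rintegral_itv_obnd_cbnd (r := 0)); last exact: integrableS Fni.
rewrite [RHS]Rintegral_mkcond; apply: eq_Rintegral => x _.
by rewrite !patchE !mem_setE !in_itv/= andbT oppr_le0.
Qed.

(** The value at 0 is [p 0], so this is an odd function only when [p 0 = 0]. *)
Definition oddx p x := if 0 <= x then p x else - p (- x).
Definition evenx p x := p `|x|.

Lemma oddx_pos p x : 0 <= x -> oddx p x = p x.
Proof. by rewrite /oddx => ->. Qed.

Lemma oddx_neg p x : 0 < x -> oddx p (- x) = - p x.
Proof. by move=> x0; rewrite /oddx oppr_ge0 leNgt x0 opprK. Qed.

Lemma evenx_pos p x : 0 <= x -> evenx p x = p x.
Proof. by move=> x0; rewrite /evenx ger0_norm. Qed.

Lemma evenx_neg p x : 0 <= x -> evenx p (- x) = p x.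
Proof. by move=> x0; rewrite /evenx normrN ger0_norm. Qed.

Lemma measurable_oddx p : measurable_fun setT p -> measurable_fun setT (oddx p).
Proof.
move=> mp; apply: measurable_fun_ifT => //; first exact: measurable_fun_ler.
by apply: measurableT_comp => //; exact: (measurableT_comp mp).
Qed.

Lemma measurable_evenx p : measurable_fun setT p -> measurable_fun setT (evenx p).
Proof. by move=> mp; exact: (measurableT_comp mp). Qed.

Lemma enorm2_sym_le f p : measurable_fun setT f -> measurable_fun setT p ->
  (forall x, 0 <= x -> f x ^+ 2 = p x ^+ 2) -> (forall x, 0 <= x -> f (- x) ^+ 2 = p x ^+ 2) ->
  (enorm2 f <= 2%:E * enorm2 p)%E.
Proof.
move=> mf mp h1 h2.
have mpN : measurable_fun setT (fun x => p (- x)) by exact: (measurableT_comp mp).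
have := @enorm2_le2 R 1 1 f p (fun x => p (- x)) ler01 ler01 mf mp mpN.
rewrite enorm2N// -ge0_muleDl ?lee_fin// -EFinD => h.
apply: h => x; rewrite !mul1r; case: (leP 0 x) => x0.
  by rewrite h1// lerDl sqr_ge0.
have xn : 0 <= - x by rewrite oppr_ge0 ltW.
by have := h2 _ xn; rewrite opprK => ->; rewrite lerDr sqr_ge0.
Qed.

Lemma enorm2_oddx p : measurable_fun setT p -> (enorm2 (oddx p) <= 2%:E * enorm2 p)%E.
Proof.
move=> mp; apply: enorm2_sym_le => // [|x x0|x]; first exact: measurable_oddx.
- by rewrite oddx_pos.
- rewrite le_eqVlt => /orP[/eqP<-|x0]; first by rewrite oppr0 oddx_pos.
  by rewrite oddx_neg// sqrrN.
Qed.

Lemma enorm2_evenx p : measurable_fun setT p -> (enorm2 (evenx p) <= 2%:E * enorm2 p)%E.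
Proof.
move=> mp; apply: enorm2_sym_le => // [|x x0|x x0]; first exact: measurable_evenx.
- by rewrite evenx_pos.
- by rewrite evenx_neg.
Qed.

Lemma L2_of_enorm2 f p : measurable_fun setT f -> L2 p -> (enorm2 f <= 2%:E * enorm2 p)%E -> L2 f.
Proof.
move=> mf pL2 h; apply: L2P => //; apply: (le_lt_trans h).
by rewrite lte_mul_pinfty ?L2_enorm2// lee_fin.
Qed.

Lemma L2_oddx p : L2 p -> L2 (oddx p).
Proof.
by move=> pL2; apply: (L2_of_enorm2 _ pL2); [apply: measurable_oddx|apply: enorm2_oddx]; exact: pL2.1.
Qed.

Lemma L2_evenx p : L2 p -> L2 (evenx p).
Proof.
by move=> pL2; apply: (L2_of_enorm2 _ pL2); [apply: measurable_evenx|apply: enorm2_evenx]; exact: pL2.1.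
Qed.

Lemma test_fun_der phi : test_fun phi -> forall x, is_derive x 1 phi (derive1 phi x).
Proof.
move=> [sp _] x; apply: DeriveDef; first exact: (sp 0%N).
by rewrite derive1E.
Qed.

Lemma test_fun_cont phi : test_fun phi -> continuous phi.
Proof. by move=> /test_fun_der; exact: is_derive_continuous. Qed.

Lemma test_fun_derive phi : test_fun phi -> test_fun (derive1 phi).
Proof.
move=> [sp [M MP]]; split; first by move=> n x; rewrite -iterSr; exact: sp.
exists M => x Mx; apply: derive1_val.
apply: (@near_eq_is_derive _ _ _ (fun=> 0 : R)) => //.
have : `|y| @[y --> x] --> `|x| by exact: norm_continuous.
by move=> /cvgr_gt/(_ _ Mx); apply: filterS => y yn; rewrite MP.
Qed.

Lemma test_fun_bounded phi : test_fun phi -> exists2 B, 0 <= B & forall x, `|phi x| <= B.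
Proof.
move=> tp; have cp := test_fun_cont tp; case: tp => _ [M MP].
have cqn : {within `[- `|M|, `|M|], continuous (fun y => `|phi y|)}.
  apply: continuous_subspaceT => y; apply: cvg_norm; exact: cp.
have MM : - `|M| <= `|M| by have := normr_ge0 M; lra.
have [c _ cP] := EVT_max MM cqn.
exists `|phi c| => // x; case: (leP `|x| `|M|) => xM; last first.
  by rewrite MP ?normr0// (le_lt_trans (ler_norm _)).
by apply: cP; rewrite in_itv/= -ler_norml.
Qed.

Lemma test_fun_gdecay phi : test_fun phi -> gdecay phi.
Proof.
move=> tp; have [B B0 BP] := test_fun_bounded tp; case: tp => _ [M MP].
exists (B * expR (M ^+ 2)), 1; split => //; first by rewrite mulr_ge0// expR_ge0.
move=> y; rewrite mul1r -mulrA -expRD; case: (leP `|y| M) => yM.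
  rewrite (le_trans (BP y))// ler_peMr//.
  rewrite -expR0 ler_expR subr_ge0 -[y ^+ 2]real_normK ?num_real//.
  by rewrite lerXn2r ?nnegrE// (le_trans _ yM).
by rewrite MP// normr0 mulr_ge0// expR_ge0.
Qed.

Lemma gdecayD f g (s : R) : `|s| = 1 -> gdecay f -> gdecay g -> gdecay (fun x => f x + s * g (- x)).
Proof.
move=> s1 [C [c [C0 c0 fC]]] [D [d [D0 d0 gD]]].
exists (C + D), (Num.min c d); split; [exact: addr_ge0|by rewrite lt_min c0|].
move=> y; apply: (le_trans (ler_normD _ _)); rewrite mulrDl; apply: lerD.
  apply: (le_trans (fC y)); rewrite ler_wpM2l// ler_expR lerN2 ler_wpM2r ?sqr_ge0//.
  by rewrite ge_min lexx.
rewrite normrM s1 mul1r; apply: (le_trans (gD _)); rewrite sqrrN ler_wpM2l// ler_expR lerN2 ler_wpM2r ?sqr_ge0//.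
by rewrite ge_min lexx orbT.
Qed.

Lemma der_fold phi (s : R) x : test_fun phi ->
  is_derive x 1 (fun x => phi x + s * phi (- x)) (derive1 phi x + (- s) * derive1 phi (- x)).
Proof.
move=> tp; apply: derD; first exact: test_fun_der.
have h : is_derive x 1 (fun y => phi (- y)) (derive1 phi (- x) * -1).
  exact: (der_comp (f := phi) (test_fun_der tp _) (derN (is_derive_id x 1))).
by apply: (is_derive_eq (derZ s h)); ring.
Qed.

Lemma continuous_fold f (s : R) : continuous f -> continuous (fun x => f x + s * f (- x)).
Proof.
move=> cf x; apply: cvgD; first exact: cf.
apply: cvgM; first exact: cvg_cst.
by apply: (cvg_comp -%R f); [apply: cvgN; exact: cvg_id|exact: cf].
Qed.

Lemma Rintegral_sym F p q (s : R) : mu.-integrable setT (EFin \o F) -> measurable_fun setT p ->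
  (forall x, 0 < x -> F x + F (- x) = p x * (q x + s * q (- x))) -> 
  L2 p -> L2 (fun x => q x + s * q (- x)) ->
  \int[mu]_x F x = \int[mu]_(x in `[0, +oo[) (p x * (q x + s * q (- x))).
Proof.
move=> Fi mp Fp pL2 qL2; rewrite Rintegral_fold//.
rewrite -(Rintegral_itv_obnd_cbnd (r := 0)); last first.
  have := L2_mul_integrable pL2 qL2; exact: integrableS.
apply: eq_Rintegral => x; rewrite inE/= in_itv/= andbT => x0; exact: Fp.
Qed.

Lemma L2_test_mul f phi : L2 f -> test_fun phi -> mu.-integrable setT (EFin \o (fun x => f x * phi x)).
Proof.
move=> fL2 tp; apply: L2_mul_integrable => //; apply: gdecay_L2; last exact: test_fun_gdecay.
by apply: continuous_measurable_fun; exact: test_fun_cont.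
Qed.

Lemma L2_fold phi (s : R) : `|s| = 1 -> test_fun phi -> L2 (fun x => phi x + s * phi (- x)).
Proof.
move=> s1 tp; apply: gdecay_L2; last by apply: gdecayD => //; exact: test_fun_gdecay.
by apply: continuous_measurable_fun; apply: continuous_fold; exact: test_fun_cont.
Qed.

Lemma weak_derivE f g : L2 f -> L2 g ->
  (forall phi, test_fun phi -> \int[mu]_x (f x * derive1 phi x) = - \int[mu]_x (g x * phi x)) ->
  weak_deriv f g.
Proof.
move=> fL2 gL2 h phi tp.
rewrite RintegralE//; last by apply: L2_test_mul => //; exact: test_fun_derive.
by rewrite RintegralE//; [rewrite h|exact: L2_test_mul].
Qed.

(** Folding onto the half line replaces [phi'] by the derivative of [phi x + phi (- x)], which need
    not vanish at 0; the boundary term disappears because [p 0 = 0]. *)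
Lemma weak_deriv_oddx p p1 (B : R) : L2 p -> L2 p1 -> p 0 = 0 -> abscontp p p1 ->
  (forall y, 0 <= y -> `|p y| <= B) -> weak_deriv (oddx p) (evenx p1).
Proof.
move=> pL2 p1L2 p0 pp1 pB; apply: weak_derivE; [exact: L2_oddx|exact: L2_evenx|].
move=> phi tp; have tp' := test_fun_derive tp.
rewrite (@Rintegral_sym _ p (derive1 phi) (-1))//; last 4 first.
- by apply: L2_test_mul => //; exact: L2_oddx.
- exact: pL2.1.
- by move=> x x0; rewrite oddx_pos ?ltW// oddx_neg//; ring.
- by apply: L2_fold => //; rewrite normrN normr1.
rewrite (@Rintegral_sym _ p1 phi 1)//; last 4 first.
- by apply: L2_test_mul => //; exact: L2_evenx.
- exact: p1L2.1.
- by move=> x x0; rewrite evenx_pos ?ltW// evenx_neg ?ltW//; ring.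
- by apply: L2_fold => //; rewrite normr1.
have g1 : gdecay (fun x => phi x + 1 * phi (- x)).
  by apply: gdecayD; rewrite ?normr1//; exact: test_fun_gdecay.
have g2 : gdecay (fun x => derive1 phi x + (-1) * derive1 phi (- x)).
  by apply: gdecayD; rewrite ?normrN ?normr1//; exact: test_fun_gdecay.
rewrite (ibp_halfline p1L2 pp1 pB (fun x => der_fold 1 x tp)
  (continuous_fold (s := -1) (test_fun_cont tp')) g1 g2).
by rewrite p0 oppr0 mul0r sub0r.
Qed.

(** Here the folded test function is [phi x - phi (- x)], which vanishes at 0, so [p 0] is free:
    this is why [f'] may be nonzero at the boundary while the extension stays in [H^2]. *)
Lemma weak_deriv_evenx p p1 (B : R) : L2 p -> L2 p1 -> abscontp p p1 ->
  (forall y, 0 <= y -> `|p y| <= B) -> weak_deriv (evenx p) (oddx p1).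
Proof.
move=> pL2 p1L2 pp1 pB; apply: weak_derivE; [exact: L2_evenx|exact: L2_oddx|].
move=> phi tp; have tp' := test_fun_derive tp.
(* The sign [- -1] is kept unreduced to match the derivative given by [der_fold (-1)]. *)
rewrite (@Rintegral_sym _ p (derive1 phi) (- -1))//; last 4 first.
- by apply: L2_test_mul => //; exact: L2_evenx.
- exact: pL2.1.
- by move=> x x0; rewrite evenx_pos ?ltW// evenx_neg ?ltW//; ring.
- by apply: L2_fold => //; rewrite opprK normr1.
rewrite (@Rintegral_sym _ p1 phi (-1))//; last 4 first.
- by apply: L2_test_mul => //; exact: L2_oddx.
- exact: p1L2.1.
- by move=> x x0; rewrite oddx_pos ?ltW// oddx_neg//; ring.
- by apply: L2_fold => //; rewrite normrN normr1.
have g1 : gdecay (fun x => phi x + (-1) * phi (- x)).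
  by apply: gdecayD; rewrite ?normrN ?normr1//; exact: test_fun_gdecay.
have g2 : gdecay (fun x => derive1 phi x + (- -1) * derive1 phi (- x)).
  by apply: gdecayD; rewrite ?opprK ?normr1//; exact: test_fun_gdecay.
rewrite (ibp_halfline p1L2 pp1 pB (fun x => der_fold (-1) x tp)
  (continuous_fold (s := - -1) (test_fun_cont tp')) g1 g2).
by rewrite oppr0 mulN1r subrr mulr0 sub0r.
Qed.

Lemma weak_deriv_ae f f' g g' : L2 f -> L2 f' -> L2 g -> L2 g' ->
  {ae mu, forall x, f x = f' x} -> {ae mu, forall x, g x = g' x} ->
  weak_deriv f g -> weak_deriv f' g'.
Proof.
move=> fL2 f'L2 gL2 g'L2 ff' gg' h phi tp.
have E u v psi' : L2 u -> L2 v -> test_fun psi' -> {ae mu, forall x, u x = v x} ->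
   (\int[mu]_x (u x * psi' x)%:E = \int[mu]_x (v x * psi' x)%:E)%E.
  move=> uL2 vL2 tpsi uv; apply: ae_eq_integral => //.
  - by have := measurable_int mu (L2_test_mul uL2 tpsi).
  - by have := measurable_int mu (L2_test_mul vL2 tpsi).
  - apply: filterS uv; first exact: (ae_filter_ringOfSetsType mu).
    by move=> x /= -> .
have tp' := test_fun_derive tp.
by rewrite -(E f f' _ fL2 f'L2 tp' ff') (h _ tp) (E g g' phi).
Qed.

Lemma weak_derivB f f' g g' : L2 f -> L2 f' -> L2 g -> L2 g' ->
  weak_deriv f g -> weak_deriv f' g' -> weak_deriv (fun x => f x - f' x) (fun x => g x - g' x).
Proof.
move=> fL2 f'L2 gL2 g'L2 h h'; apply: weak_derivE; [exact: L2B|exact: L2B|].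
move=> phi tp; have tp' := test_fun_derive tp.
have R1 u v psi' : L2 u -> L2 v -> test_fun psi' ->
  \int[mu]_x ((u x - v x) * psi' x) = \int[mu]_x (u x * psi' x) - \int[mu]_x (v x * psi' x).
  move=> uL2 vL2 tps; rewrite -RintegralB//; [|exact: L2_test_mul..].
  by apply: eq_Rintegral => x _; rewrite mulrBl.
have R2 u v : L2 u -> L2 v -> weak_deriv u v ->
  \int[mu]_x (u x * derive1 phi x) = - \int[mu]_x (v x * phi x).
  move=> uL2 vL2 uv; have := uv _ tp; rewrite RintegralE//; last exact: L2_test_mul.
  by rewrite RintegralE//; [move=> -[]|exact: L2_test_mul].
by rewrite (R1 f f')// (R1 g g')// (R2 f g)// (R2 f' g')// opprD.
Qed.

End odd_extension.

(** * The heat kernel on the half line and its derivatives *)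

Section heat_kernel.
Context {R : realType}.
Notation mu := (@lebesgue_measure R).
Implicit Types (f g u : R -> R) (a b c t w x y z : R).

(* The kernel [(4 pi t)^(-1/2) expR (- z^2 / (4 t))], with the power of [t] moved
   into the exponent to make it easy to differentiate in [t]. *)
Definition heat t z := normal_peak 1 * expR (- (ln (2 * t) / 2) - z ^+ 2 / (4 * t)) :> R.

Definition heat_z t z := heat t z * (- (z / (2 * t))).
Definition heat_zz t z := heat t z * (z ^+ 2 / (4 * t ^+ 2) - (2 * t)^-1).

Lemma heat_ge0 t z : 0 <= heat t z.
Proof. by rewrite mulr_ge0 ?normal_peak_ge0 ?expR_ge0. Qed.

Lemma is_derive_heat_z t z : t != 0 -> is_derive z 1 (heat t) (heat_z t z).
Proof.
move=> t0.
have h1 : is_derive z 1 (fun z => - (ln (2 * t) / 2) - z ^+ 2 / (4 * t)) (- (z / (2 * t))).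
  have hs : is_derive z 1 (fun z => (4 * t)^-1 * z ^+ 2) ((4 * t)^-1 * (2 * z ^+ 1 * 1)).
    by apply: derZ; apply: (derX 2); exact: is_derive_id.
  have hc : is_derive z 1 (fun=> - (ln (2 * t) / 2)) 0 := is_derive_cst _ z 1.
  have := derB hc hs; rewrite sub0r expr1 mulr1.
  have -> : (fun y => - (ln (2 * t) / 2) - (4 * t)^-1 * y ^+ 2) = (fun z => - (ln (2 * t) / 2) - z ^+ 2 / (4 * t)).
    by apply/funext => y; rewrite (mulrC _ (y ^+ 2)).
  by move=> h; apply: (is_derive_eq h); field.
by apply: (is_derive_eq (derZ (normal_peak 1) (der_exp h1))); rewrite /heat_z /heat mulrA.
Qed.

Lemma is_derive_heat_zz t z : t != 0 -> is_derive z 1 (heat_z t) (heat_zz t z).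
Proof.
move=> t0.
have h1 : is_derive z 1 (fun z => - (z / (2 * t))) (- (2 * t)^-1).
  have h := der_affine (- (2 * t)^-1) 0 z.
  have -> : (fun z => - (z / (2 * t))) = (fun y => - (2 * t)^-1 * y + 0).
    by apply/funext => y; rewrite addr0 mulNr mulrC.
  exact: h.
apply: (is_derive_eq (derM (is_derive_heat_z z t0) h1)).
by rewrite /heat_zz /heat_z -mulrA -mulrDr; congr (_ * _); field.
Qed.

(** Time acts twice along the line [z = c + s]: through the kernel, which gives [heat_zz] by the
    heat equation, and through the moving point, which gives [heat_z]. This is how the drift
    enters. *)
Lemma is_derive_heat_line c t : 0 < t ->
  is_derive t 1 (fun s => heat s (c + s)) (heat_zz t (c + t) + heat_z t (c + t)).
Proof.
move=> t0; have tn0 : t != 0 by rewrite gt_eqF.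
have hl : is_derive t 1 (fun s => ln (2 * s)) ((2 * t)^-1 * 2).
  apply: (der_comp (f := @ln R)); first by apply: is_derive1_ln; rewrite mulr_gt0.
  by apply: (is_derive_eq (derZ 2 (is_derive_id t 1))); rewrite mulr1.
have hz : is_derive t 1 (fun s => c + s) 1.
  by apply: (is_derive_eq (derD (is_derive_cst c t 1) (is_derive_id t 1))); rewrite add0r.
have hv : is_derive t 1 (fun s => (4 * s)^-1) (- (4 * t) ^- 2 * 4).
  apply: (derV (f := fun s => 4 * s)); first by rewrite mulf_neq0.
  by apply: (is_derive_eq (derZ 4 (is_derive_id t 1))); rewrite mulr1.
have hl2 : is_derive t 1 (fun s => - (ln (2 * s) / 2)) (- (2^-1 * ((2 * t)^-1 * 2))).
  have := derN (derZ 2^-1 hl).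
  by congr is_derive; apply/funext => s; rewrite mulrC.
have h := derZ (normal_peak 1) (der_exp (derB hl2 (derM (derX 2 hz) hv))).
apply: (is_derive_eq h); rewrite /heat_zz /heat_z /heat -mulrDr mulrA; congr (_ * _).
by rewrite /= expr1; field.
Qed.

Lemma sq_expR_le b z : 0 < b -> (1 + z ^+ 2) * expR (- (z ^+ 2 / (8 * b))) <= 1 + 8 * b.
Proof.
move=> b0; have b8 : 0 < 8 * b by rewrite mulr_gt0.
set v := z ^+ 2 / (8 * b).
have v0 : 0 <= v by rewrite divr_ge0 ?sqr_ge0// ltW.
have -> : z ^+ 2 = 8 * b * v by rewrite /v mulrC mulfVK ?gt_eqF.
rewrite expRN ler_pdivrMr ?expR_gt0//.
have := expR_ge1Dx v; nra.
Qed.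

(** A single Gaussian in [y] for all [t] in []a, b[] and [|w| <= W], as differentiation under the
    integral requires; the factor [1 + (w - y) ^+ 2] leaves room for the polynomial factors of
    [heat_z] and [heat_zz]. *)
Lemma heat_dom a b W : 0 < a -> 0 <= W -> exists2 C, 0 <= C &
  forall t w y, a < t -> t < b -> `|w| <= W ->
   (1 + (w - y) ^+ 2) * heat t (w - y) <= C * expR (- ((16 * b)^-1 * y ^+ 2)).
Proof.
move=> a0 W0.
case: (leP b a) => ab.
  by exists 0 => // t w y at_ tb; have := lt_trans at_ (lt_le_trans tb ab); rewrite ltxx.
have b0 := lt_trans a0 ab.
have b8 : 0 < 8 * b by rewrite mulr_gt0.
pose C := normal_peak 1 * expR (- (ln (2 * a) / 2)) * (1 + 8 * b) * expR (W ^+ 2 / (8 * b)).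
exists C.
  rewrite /C !mulr_ge0 ?normal_peak_ge0 ?expR_ge0//; lra.
move=> t w y at_ tb wW; have t0 := lt_trans a0 at_.
set z := w - y.
have e1 : heat t z <= normal_peak 1 * expR (- (ln (2 * a) / 2)) * expR (- (z ^+ 2 / (4 * b))).
  rewrite /heat -mulrA ler_wpM2l ?normal_peak_ge0// -expRD ler_expR lerD//.
    rewrite lerN2 ler_pM2r// ler_ln ?posrE ?mulr_gt0//.
    by rewrite ler_pM2l// ltW.
  rewrite lerN2 ler_wpM2l ?sqr_ge0// lef_pV2 ?posrE ?mulr_gt0//.
  by rewrite ler_pM2l// ltW.
(* One half of the exponent absorbs [1 + z ^+ 2]; the other is converted into decay in [y] by
   [y ^+ 2 <= 2 z ^+ 2 + 2 w ^+ 2], hence the rate [(16 * b)^-1]. *)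
have e2 : expR (- (z ^+ 2 / (4 * b))) = expR (- (z ^+ 2 / (8 * b))) * expR (- (z ^+ 2 / (8 * b))).
  by rewrite -expRD; congr expR; field; rewrite gt_eqF.
have e3 : expR (- (z ^+ 2 / (8 * b))) <= expR (W ^+ 2 / (8 * b)) * expR (- ((16 * b)^-1 * y ^+ 2)).
  rewrite -expRD ler_expR.
  have -> : (16 * b)^-1 * y ^+ 2 = (y ^+ 2 / 2) / (8 * b) by field; rewrite gt_eqF.
  rewrite -!mulrBl -mulNr ler_pM2r ?invr_gt0//.
  have : w ^+ 2 <= W ^+ 2.
    by rewrite -[w ^+ 2]real_normK ?num_real// lerXn2r ?nnegrE.
  have := sqr_ge0 (2 * w - y); rewrite /z; nra.
have e4 := sq_expR_le z b0.
have z1 : 0 <= 1 + z ^+ 2 by rewrite addr_ge0 ?sqr_ge0.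
apply: (le_trans (ler_wpM2l z1 e1)).
rewrite e2 /C.
set p := normal_peak 1; set q := expR (- (ln (2 * a) / 2)).
have p0 : 0 <= p by exact: normal_peak_ge0.
have q0 : 0 <= q by exact: expR_ge0.
set E := expR (- (z ^+ 2 / (8 * b))) in e3 e4 *.
set E' := expR (W ^+ 2 / (8 * b)) in e3 *; set Y := expR _ in e3 *.
rewrite [leLHS](_ : _ = p * (q * (((1 + z ^+ 2) * E) * E))); last by ring.
rewrite [leRHS](_ : _ = p * (q * ((1 + 8 * b) * (E' * Y)))); last by ring.
rewrite ler_wpM2l// ler_wpM2l// ler_pM//.
  by rewrite mulr_ge0// expR_ge0.
exact: expR_ge0.
Qed.

(** The parameter is left abstract because it is the space variable in one use and time along the
    drift line in the other. *)
Lemma under_integral_derive (k k' : R -> R -> R) f (u v x C c B : R) :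
  u < x < v -> 0 <= C -> 0 < c -> 0 <= B ->
  (forall s y, u < s < v -> is_derive s 1 (k ^~ y) (k' s y)) ->
  (forall s, u < s < v -> measurable_fun setT (k s)) ->
  (forall s y, u < s < v -> `|k s y| <= C * expR (- (c * y ^+ 2))) ->
  (forall s y, u < s < v -> `|k' s y| <= C * expR (- (c * y ^+ 2))) ->
  measurable_fun setT f -> (forall y, 0 <= y -> `|f y| <= B) ->
  is_derive x 1 (fun s => \int[mu]_(y in `[0, +oo[) (k s y * f y))
    (\int[mu]_(y in `[0, +oo[) (k' x y * f y)).
Proof.
move=> xuv C0 c0 B0 dk mk kC k'C mf fB.
pose I : set R := `]u, v[%classic.
have Ix : I x by rewrite /I/= in_itv.
pose D := `[(0:R), +oo[%classic.
have mD : measurable D by exact: measurable_itv.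
have iG : mu.-integrable D (EFin \o (fun y => (B * C) * expR (- (c * y ^+ 2)))).
  have := rintegrableZ measurableT (B * C) (@integrable_expsq R c c0).
  exact: integrableS.
have bnd (h : R) y : D y -> `|h| <= C * expR (- (c * y ^+ 2)) ->
    `|h * f y| <= (B * C) * expR (- (c * y ^+ 2)).
  rewrite /D/= in_itv/= andbT => y0 hC; rewrite normrM mulrC -mulrA.
  by apply: ler_pM => //; exact: fB.
have intk s : I s -> mu.-integrable D (EFin \o (fun y => k s y * f y)).
  rewrite /I/= in_itv/= => sI.
  apply: (rintegrable_le (nu := mu) mD (fun y => (B * C) * expR (- (c * y ^+ 2)))) => //.
  - by apply: measurable_funTS; apply: measurable_funM => //; exact: mk.
  - by move=> y Dy; apply: bnd => //; exact: kC.
have dkf s y : I s -> is_derive s 1 (fun s => k s y * f y) (k' s y * f y).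
  rewrite /I/= in_itv/= => sI.
  have := derZ (f y) (dk s y sI); rewrite mulrC; congr is_derive.
  by apply/funext => r; rewrite mulrC.
have p1 s y : I s -> partial1of2 (fun s y => k s y * f y) s y = k' s y * f y.
  by move=> sI; rewrite /partial1of2; exact: derive1_val (dkf s y sI).
have H1 : forall s y, I s -> D y -> derivable ((fun s y => k s y * f y) ^~ y) s 1.
  by move=> s y sI _; case: (dkf s y sI).
have H2 : forall y, 0 <= (B * C) * expR (- (c * y ^+ 2)) :> R.
  by move=> y; rewrite !mulr_ge0// expR_ge0.
have H3 : forall s y, I s -> D y ->
   `|partial1of2 (fun s y => k s y * f y) s y| <= (B * C) * expR (- (c * y ^+ 2)).
  move=> s y sI Dy; rewrite p1//; apply: bnd => //; apply: k'C.
  by move: sI; rewrite /I/= in_itv.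
have d1 := @derivable_under_integral R _ _ mu (fun s y => k s y * f y) D mD x u v Ix intk H1 (fun y => (B * C) * expR (- (c * y ^+ 2))) H2 iG H3.
have d2 := @differentiation_under_integral R _ _ mu (fun s y => k s y * f y) D mD x u v Ix intk H1 (fun y => (B * C) * expR (- (c * y ^+ 2))) H2 iG H3.
apply: DeriveDef; first exact: d1.
rewrite -derive1E d2; apply: eq_Rintegral => y _; exact: p1.
Qed.

(** Heat evolution of [f] extended by zero, in the form suited to differentiation; [hA_hsm]
    identifies it with the averaged form suited to norm estimates. *)
Definition hA f t w := \int[mu]_(y in `[0, +oo[) (heat t (w - y) * f y).
Definition hAz f t w := \int[mu]_(y in `[0, +oo[) (heat_z t (w - y) * f y).

Lemma heat_shift_continuous t w : t != 0 -> continuous (fun y => heat t (w - y)).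
Proof.
move=> t0 y.
apply: (cvg_comp (fun y => w - y) (heat t)); first by apply: cvgB; [exact: cvg_cst|exact: cvg_id].
exact: (is_derive_continuous (fun z => is_derive_heat_z z t0)).
Qed.

Lemma heat_z_shift_continuous t w : t != 0 -> continuous (fun y => heat_z t (w - y)).
Proof.
move=> t0 y.
apply: (cvg_comp (fun y => w - y) (heat_z t)); first by apply: cvgB; [exact: cvg_cst|exact: cvg_id].
exact: (is_derive_continuous (fun z => is_derive_heat_zz z t0)).
Qed.

Lemma heat_zz_shift_continuous t w : t != 0 -> continuous (fun y => heat_zz t (w - y)).
Proof.
move=> t0 y; apply: cvgM; first exact: heat_shift_continuous.
apply: cvgB; last exact: cvg_cst.
apply: cvgM; last exact: cvg_cst.
have h : w - x @[x --> y] --> w - y by apply: cvgB; [exact: cvg_cst|exact: cvg_id].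
have h2 : (w - x) * (w - x) @[x --> y] --> (w - y) * (w - y) by exact: cvgM.
exact: h2.
Qed.

Lemma measurable_heat_shift t w : t != 0 -> measurable_fun setT (fun y => heat t (w - y)).
Proof. by move=> t0; apply: continuous_measurable_fun; exact: heat_shift_continuous. Qed.

Lemma heat_bounds a b W : 0 < a -> a < b -> 0 <= W -> exists2 C, 0 <= C &
  forall t w y, a < t -> t < b -> `|w| <= W ->
   [/\ `|heat t (w - y)| <= C * expR (- ((16 * b)^-1 * y ^+ 2)),
      `|heat_z t (w - y)| <= C * expR (- ((16 * b)^-1 * y ^+ 2)),
      `|heat_zz t (w - y)| <= C * expR (- ((16 * b)^-1 * y ^+ 2)) &
      `|heat_zz t (w - y) + heat_z t (w - y)| <= C * expR (- ((16 * b)^-1 * y ^+ 2))].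
Proof.
move=> a0 ab W0; have [C C0 CP] := heat_dom b a0 W0.
have ai : 0 < a^-1 by rewrite invr_gt0.
pose M := 1 + a^-1 + (a^-1 ^+ 2 + a^-1).
have M0 : 0 <= M by rewrite /M; have := sqr_ge0 a^-1; lra.
exists (M * C); first exact: mulr_ge0.
move=> t w y at_ tb wW; have t0 := lt_trans a0 at_.
set z := w - y; set E := expR _.
have {}CP := CP t w y at_ tb wW.
have h0 := heat_ge0 t z.
have ti : 0 < t^-1 by rewrite invr_gt0.
have tia : t^-1 <= a^-1 by rewrite lef_pV2 ?posrE// ltW.
have key c : `|c| <= M * (1 + z ^+ 2) -> `|heat t z * c| <= M * C * E.
  move=> cM; rewrite normrM (ger0_norm h0) -mulrA.
  apply: (le_trans (ler_wpM2l h0 cM)).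
  by rewrite mulrCA ler_wpM2l// mulrC.
have z2 := sqr_ge0 z.
have zz : `|z| <= 1 + z ^+ 2.
  by rewrite -[z ^+ 2]real_normK ?num_real//; have := normr_ge0 z; nra.
have c1 : `|- (z / (2 * t))| <= a^-1 * (1 + z ^+ 2).
  have -> : z / (2 * t) = 2^-1 * (z * t^-1) by field; rewrite gt_eqF.
  rewrite normrN normrM normrM (gtr0_norm ti).
  rewrite (@gtr0_norm _ 2^-1) ?invr_gt0//.
  have : `|z| * t^-1 <= (1 + z ^+ 2) * a^-1 by apply: ler_pM => //; exact: ltW.
  have : 0 <= `|z| * t^-1 by rewrite mulr_ge0// ltW.
  lra.
have c2 : `|z ^+ 2 / (4 * t ^+ 2) - (2 * t)^-1| <= (a^-1 ^+ 2 + a^-1) * (1 + z ^+ 2).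
  apply: (le_trans (ler_normB _ _)).
  have -> : (4 * t ^+ 2)^-1 = 4^-1 * t^-1 ^+ 2 by field; rewrite gt_eqF.
  have -> : (2 * t)^-1 = 2^-1 * t^-1 by field; rewrite gt_eqF.
  have t2 := sqr_ge0 t^-1.
  have -> : `|z ^+ 2 * (4^-1 * t^-1 ^+ 2)| = z ^+ 2 * (4^-1 * t^-1 ^+ 2).
    by rewrite ger0_norm// mulr_ge0// mulr_ge0// invr_ge0.
  have -> : `|2^-1 * t^-1| = 2^-1 * t^-1.
    by rewrite ger0_norm// mulr_ge0 ?invr_ge0// ltW.
  have : t^-1 ^+ 2 <= a^-1 ^+ 2 by rewrite lerXn2r ?nnegrE// ltW.
  nra.
have zM (r : R) : r <= M -> r * (1 + z ^+ 2) <= M * (1 + z ^+ 2).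
  by move=> rM; rewrite ler_wpM2r// addr_ge0.
have s2 := sqr_ge0 a^-1.
split.
- rewrite -[heat t z]mulr1; apply: key; rewrite normr1.
  by rewrite -[leLHS]mulr1; apply: ler_pM => //; rewrite /M; lra.
- by apply: key; apply: (le_trans c1); apply: zM; rewrite /M; lra.
- by apply: key; apply: (le_trans c2); apply: zM; rewrite /M; lra.
- rewrite /heat_zz /heat_z -mulrDr; apply: key; apply: (le_trans (ler_normD _ _)).
  apply: (le_trans (lerD c2 c1)); rewrite -mulrDl; apply: zM; rewrite /M; lra.
Qed.

Lemma heat_bounds_at t w : 0 < t -> exists C b, [/\ 0 <= C, t < b &
  forall t' w' y, t / 2 < t' < b -> w - 1 < w' < w + 1 ->
   [/\ `|heat t' (w' - y)| <= C * expR (- ((16 * b)^-1 * y ^+ 2)),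
      `|heat_z t' (w' - y)| <= C * expR (- ((16 * b)^-1 * y ^+ 2)),
      `|heat_zz t' (w' - y)| <= C * expR (- ((16 * b)^-1 * y ^+ 2)) &
      `|heat_zz t' (w' - y) + heat_z t' (w' - y)| <= C * expR (- ((16 * b)^-1 * y ^+ 2))]].
Proof.
move=> t0; have h1 : 0 < t / 2 by rewrite divr_gt0.
have h2 : t / 2 < t + 1 by lra.
have h3 : 0 <= `|w| + 1 by rewrite addr_ge0.
have [C C0 CP] := heat_bounds h1 h2 h3.
exists C, (t + 1); split=> //; first by lra.
move=> t' w' y /andP[ta tb] /andP[w1 w2]; apply: CP => //.
have := ler_norm w; have := ler_norm (- w); rewrite normrN ler_norml => *.
by apply/andP; split; lra.
Qed.

Lemma is_derive_hA_z f t w (B : R) : 0 < t -> 0 <= B -> measurable_fun setT f ->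
  (forall y, 0 <= y -> `|f y| <= B) -> is_derive w 1 (hA f t) (hAz f t w).
Proof.
move=> t0 B0 mf fB; have tn0 : t != 0 by rewrite gt_eqF.
have [C [b [C0 tb CP]]] := heat_bounds_at w t0.
have tt : t / 2 < t < b by apply/andP; split => //; lra.
apply: (@under_integral_derive (fun s y => heat t (s - y)) (fun s y => heat_z t (s - y)) f
   (w - 1) (w + 1) w C (16 * b)^-1 B) => //.
- by apply/andP; split; lra.
- by rewrite invr_gt0 mulr_gt0//; lra.
- move=> s y _; have hs : is_derive s 1 (fun s => s - y) 1.
    by apply: (is_derive_eq (derB (is_derive_id s 1) (is_derive_cst y s 1))); rewrite subr0.
  by have h := der_comp (f := heat t) (g := fun s => s - y) (is_derive_heat_z (s - y) tn0) hs; rewrite mulr1 in h; exact: h.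
- by move=> s _; exact: measurable_heat_shift.
- by move=> s y sw; have [] := CP t s y tt sw.
- by move=> s y sw; have [] := CP t s y tt sw.
Qed.

Lemma is_derive_hA_line f c t (B : R) : 0 < t -> 0 <= B -> measurable_fun setT f ->
  (forall y, 0 <= y -> `|f y| <= B) ->
  is_derive t 1 (fun s => hA f s (c + s))
   (\int[mu]_(y in `[0, +oo[) ((heat_zz t (c + t - y) + heat_z t (c + t - y)) * f y)).
Proof.
move=> t0 B0 mf fB.
have [C [b [C0 tb CP]]] := heat_bounds_at (c + t) t0.
(* Time and the moving point vary together: [s] must stay in []t / 2, b[] and [c + s] within 1 of
   [c + t]. *)
pose m := Num.max (t / 2) (t - 1); pose M := Num.min b (t + 1).
have sI s : m < s < M -> t / 2 < s < b /\ c + t - 1 < c + s < c + t + 1.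
  rewrite /m /M gt_max lt_min => /andP[/andP[a1 a2] /andP[a3 a4]].
  by split; apply/andP; split; lra.
apply: (@under_integral_derive (fun s y => heat s (c + s - y))
   (fun s y => heat_zz s (c + s - y) + heat_z s (c + s - y)) f m M t C (16 * b)^-1 B) => //.
- by rewrite /m /M gt_max lt_min tb; apply/andP; split; [apply/andP; split|]; lra.
- by rewrite invr_gt0 mulr_gt0//; lra.
- move=> s y /sI[/andP[s1 _] _].
  have s0 : 0 < s by lra.
  have := is_derive_heat_line (c - y) s0.
  have -> : (fun s => heat s (c - y + s)) = (fun s => heat s (c + s - y)).
    by apply/funext => r; congr heat; ring.
  by rewrite (_ : c - y + s = c + s - y); last by ring.
- move=> s /sI[/andP[s1 _] _]; apply: measurable_heat_shift; rewrite gt_eqF//; lra.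
- by move=> s y /sI[h1 h2]; have [] := CP s (c + s) y h1 h2.
- by move=> s y /sI[h1 h2]; have [] := CP s (c + s) y h1 h2.
Qed.

(** Moves one derivative from the kernel to the datum. The price is a kernel term weighted by [u 0],
    which the method of images has to cancel. *)
Lemma heat_ibp u g t w (B : R) : 0 < t -> L2 g -> abscontp u g -> (forall y, 0 <= y -> `|u y| <= B) ->
  \int[mu]_(y in `[0, +oo[) (heat_z t (w - y) * u y) = u 0 * heat t w + hA g t w /\
  \int[mu]_(y in `[0, +oo[) (heat_zz t (w - y) * u y) = u 0 * heat_z t w + hAz g t w.
Proof.
move=> t0 gL2 h uB; have tn0 : t != 0 by rewrite gt_eqF.
have [C [b [C0 tb CP]]] := heat_bounds_at w t0.
have tt : t / 2 < t < b by apply/andP; split => //; lra.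
have ww : w - 1 < w < w + 1 by apply/andP; split; lra.
have c0 : 0 < (16 * b)^-1 by rewrite invr_gt0 mulr_gt0//; lra.
have hs y : is_derive y 1 (fun s => w - s) (-1).
  by apply: (is_derive_eq (derB (is_derive_cst w y 1) (is_derive_id y 1))); rewrite sub0r.
have d0 : gdecay (fun y => heat t (w - y)).
  by exists C, (16 * b)^-1; split => // y; have [] := CP t w y tt ww.
have d1 : gdecay (fun y => heat_z t (w - y)).
  by exists C, (16 * b)^-1; split => // y; have [] := CP t w y tt ww.
have d1' : gdecay (fun y => - heat_z t (w - y)).
  by exists C, (16 * b)^-1; split => // y; rewrite normrN; have [] := CP t w y tt ww.
have d2' : gdecay (fun y => - heat_zz t (w - y)).
  by exists C, (16 * b)^-1; split => // y; rewrite normrN; have [] := CP t w y tt ww.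
have q1 y : is_derive y 1 (fun y => heat t (w - y)) (- heat_z t (w - y)).
  by have r := der_comp (f := heat t) (g := fun s => w - s) (is_derive_heat_z (w - y) tn0) (hs y); rewrite mulrN1 in r; exact: r.
have q2 y : is_derive y 1 (fun y => heat_z t (w - y)) (- heat_zz t (w - y)).
  by have r := der_comp (f := heat_z t) (g := fun s => w - s) (is_derive_heat_zz (w - y) tn0) (hs y); rewrite mulrN1 in r; exact: r.
have cc1 : continuous (fun y => - heat_z t (w - y)).
  by move=> y; apply: cvgN; exact: heat_z_shift_continuous.
have cc2 : continuous (fun y => - heat_zz t (w - y)).
  by move=> y; apply: cvgN; exact: heat_zz_shift_continuous.
have L0 : L2 (fun y => heat t (w - y)).
  by apply: gdecay_L2 => //; exact: measurable_heat_shift.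
have [U cU uU] := abscontp_ext gL2 h.
have neg k : continuous k -> gdecay k -> \int[mu]_(y in `[0, +oo[) (k y * u y) = - \int[mu]_(y in `[0, +oo[) (u y * - k y).
  move=> ck dk; have mk : measurable_fun setT k by exact: continuous_measurable_fun.
  have ik : mu.-integrable `[0, +oo[ (EFin \o (fun y => k y * u y)).
    have : mu.-integrable `[0, +oo[ (EFin \o (fun y => k y * U y)).
      have iq' := gdecay_integrable mk dk.
      apply: (rintegrable_le (nu := mu) _ (fun y => B * `|k y|)) => //.
      - by apply: measurable_funTS; apply: measurable_funM => //; exact: continuous_measurable_fun.
      - by move=> y; rewrite /= in_itv/= andbT => y0; rewrite normrM mulrC ler_wpM2r// -uU// uB.
      - have iq : mu.-integrable setT (EFin \o (fun y => `|k y|)).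
          by have := integrable_abse iq'; exact.
        by have := rintegrableZ measurableT B iq; exact: integrableS.
    apply: eq_integrable => // y; rewrite inE/= in_itv/= andbT => y0.
    by rewrite uU.
  have -> : (fun y => u y * - k y) = (fun y => (-1) * (k y * u y)).
    by apply/funext => y; rewrite mulN1r mulrN mulrC.
  by rewrite RintegralZl// mulN1r opprK.
split.
- rewrite neg//; last exact: heat_z_shift_continuous.
  rewrite (ibp_halfline gL2 h uB q1 cc1 d0 d1') subr0 opprB mulNr opprK addrC; congr (_ + _).
  by apply: eq_Rintegral => y _; rewrite mulrC.
- rewrite neg//; [|exact: heat_zz_shift_continuous|].
    rewrite (ibp_halfline gL2 h uB q2 cc2 d1 d2') subr0 opprB mulNr opprK addrC; congr (_ + _).
    by apply: eq_Rintegral => y _; rewrite mulrC.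
  by exists C, (16 * b)^-1; split => // y; have [] := CP t w y tt ww.
Qed.

(** The substitution [y = w + sqrt (2 t) * s] carries the standard normal density to the heat
    kernel. *)
Lemma hA_hsm f sg c t z : 0 < t -> L2 (f \_ `[0, +oo[) ->
  sg = 1 \/ sg = -1 ->
  hsm (f \_ `[0, +oo[) sg c (Num.sqrt (2 * t)) z = hA f t (sg * z + c).
Proof.
move=> t0 fL2 sgE.
have t2 : 0 < 2 * t by rewrite mulr_gt0.
set d := Num.sqrt (2 * t).
have d0 : 0 < d by rewrite sqrtr_gt0.
have di : 0 < d^-1 by rewrite invr_gt0.
have d2 : d ^+ 2 = 2 * t by rewrite sqr_sqrtr// ltW.
have dE : d^-1 = expR (- (ln (2 * t) / 2)).
  have e : expR (ln (2 * t) / 2) = d.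
    apply/eqP; rewrite -(@eqrXn2 _ 2) ?expR_ge0 ?ltW// d2 -expRM_natl mulrC mulfVK// lnK//.
  by rewrite expRN e.
set w := sg * z + c.
rewrite /hsm /smear (@Rintegral_affine _ d^-1 (- (w / d)) _ di); last first.
  exact: (integrable_hsm c z sgE (ltW d0) fL2).
rewrite -RintegralZl//; last first.
  apply: (integrable_affine (- (w / d)) di (f := fun s => gam s * (f \_ `[0, +oo[) (sg * z + (c + d * s)))).
  exact: (integrable_hsm c z sgE (ltW d0) fL2).
rewrite /hA [RHS]Rintegral_mkcond; apply: eq_Rintegral => y _.
have -> : sg * z + (c + d * (d^-1 * y + - (w / d))) = y by rewrite /w; field; rewrite gt_eqF.
rewrite !patchE; case: ifP => _; last by rewrite !mulr0.
have -> : d^-1 * y + - (w / d) = (y - w) / d by field; rewrite gt_eqF.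
rewrite mulrA; congr (_ * _); rewrite gamE exprMn exprVn d2 /heat expRD dE mulrCA.
by congr (_ * (_ * expR _)); field; rewrite gt_eqF.
Qed.

(* This identity makes the boundary terms of the direct and reflected parts cancel. *)
Lemma heat_reflect t x : t != 0 -> heat t (x + t) = expR (- x) * heat t (t - x).
Proof.
by move=> t0; rewrite /heat mulrCA -expRD; congr (_ * expR _); field.
Qed.

End heat_kernel.

(** * Weak maximum principle on the half line *)

Section maximum_principle.
Context {R : realType}.
Implicit Types (f g : R -> R) (t x : R).

Lemma derive_eps f x : derivable f x 1 -> forall e : R, 0 < e -> exists2 d : R, 0 < d &
  forall h, h != 0 -> `|h| < d -> `|h^-1 * (f (x + h) - f x) - derive1 f x| < e.
Proof.
move=> df e e0; rewrite derive1E.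
have /cvgrPdist_lt/(_ e e0) := df; rewrite -/('D_1 f x) => -[d /= d0 dP].
exists d => // h h0 hd.
have := dP h; rewrite /ball_/= sub0r normrN => /(_ hd h0).
by rewrite distrC /GRing.scale/= mulr1 (addrC h).
Qed.

(** If the second derivative were negative at a minimum, the first would be negative just to the
    right of [x], and the mean value theorem would make [f] drop below [f x]. *)
Lemma second_derivative_min f x : 0 < x -> (forall y, 0 < y -> derivable f y 1) ->
  derivable (derive1 f) x 1 -> (forall y, 0 < y -> f x <= f y) ->
  derive1 f x = 0 /\ 0 <= derive1 (derive1 f) x.
Proof.
move=> x0 df ddf fm.
have d0 : derive1 f x = 0.
  have xI : x \in `]0, (x + 1)[ by rewrite in_itv/= x0/= ltrDl.
  apply: derive1_val; apply: (@derive1_at_min R f 0 (x + 1) x) => //.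
  - by lra.
  - by move=> y; rewrite in_itv/= => /andP[y0 _]; exact: df.
  - by move=> y; rewrite in_itv/= => /andP[y0 _]; exact: fm.
split => //; rewrite leNgt; apply/negP => neg.
have en : 0 < - derive1 (derive1 f) x by rewrite oppr_gt0.
have [d dp dP] := derive_eps ddf en.
pose h := d / 2; have h0 : 0 < h by rewrite divr_gt0.
have cf y : 0 < y -> {for y, continuous f}.
  by move=> y0; apply: differentiable_continuous; apply/derivable1_diffP; exact: df.
have [|||c cI] := @MVT R f (derive1 f) x (x + h).
- by rewrite ltrDl.
- move=> y; rewrite in_itv/= => /andP[xy _]; apply: DeriveDef; last by rewrite derive1E.
  by apply: df; exact: lt_trans xy.
- apply: continuous_in_subspaceT => y; rewrite inE/= in_itv/= => /andP[xy _].
  by apply: cf; exact: lt_le_trans xy.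
move: cI; rewrite in_itv/= => /andP[xc cx] e.
have hc : c - x != 0 by rewrite subr_eq0 gt_eqF.
have := dP (c - x) hc; rewrite ger0_norm ?subr_ge0 ?ltW// => /(_ _).
have -> : x + (c - x) = c by ring.
rewrite d0 subr0 => q.
have {}q : `|(c - x)^-1 * derive1 f c - derive1 (derive1 f) x| < - derive1 (derive1 f) x.
  by apply: q; rewrite /h in cx; lra.
have cn : derive1 f c < 0.
  have : (c - x)^-1 * derive1 f c < 0 by move: q; rewrite ltr_norml => /andP[_]; lra.
  by rewrite pmulr_rlt0// invr_gt0 subr_gt0.
have : f x <= f (x + h) by apply: fm; rewrite addr_gt0.
by move: e; nra.
Qed.

(** The open half line is not compact: the conditions at 0 and at infinity confine negative values,
    and continuity in time, uniform in [x] and valid down to time zero, makes the infimum over [x]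
    continuous. *)
Lemma weak_max_principle (z : R -> R -> R) :
  (forall x, 0 < x -> 0 <= z 0 x) ->
  (forall t x, 0 < t -> 0 < x ->
    [/\ derivable (fun s => z s x) t 1, derivable (z t) x 1, derivable (derive1 (z t)) x 1 &
     derive1 (fun s => z s x) t = derive1 (z t) x + derive1 (derive1 (z t)) x]) ->
  (forall t, 0 < t -> forall e : R, 0 < e -> exists2 d : R, 0 < d & forall x, 0 < x < d -> - e <= z t x) ->
  (forall t, 0 < t -> forall e : R, 0 < e -> exists M : R, forall x, M < x -> - e <= z t x) ->
  (forall t0, 0 <= t0 -> forall e : R, 0 < e -> exists2 d : R, 0 < d &
     forall t, 0 <= t -> `|t - t0| < d -> forall x, 0 < x -> `|z t x - z t0 x| <= e) ->
  forall t x, 0 <= t -> 0 < x -> 0 <= z t x.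
Proof.
move=> Z0 ZE Zb Zoo ZT T X; rewrite le_eqVlt => /orP[/eqP<-|T0] X0; first exact: Z0.
rewrite leNgt; apply/negP => zneg.
have zc t x : 0 < t -> 0 < x -> {for x, continuous (z t)}.
  by move=> t0 x0; apply: differentiable_continuous; apply/derivable1_diffP; case: (ZE t x t0 x0).
(* Values below [- e] occur only in a compact interval of positive numbers, where a minimum is
   attained. *)
have attain t (e : R) : 0 < t -> 0 < e -> exists2 xm, 0 < xm & forall x, 0 < x ->
    - e <= z t x \/ z t xm <= z t x.
  move=> t0 e0; have [d d0 dP] := Zb t t0 e e0; have [M MP] := Zoo t t0 e e0.
  pose M' := Num.max M d.
  have dM : d / 2 <= M' by rewrite le_max; apply/orP; right; lra.
  have cz : {within `[d / 2, M'], continuous (z t)}.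
    apply: continuous_in_subspaceT => y; rewrite inE/= in_itv/= => /andP[y1 _].
    by apply: zc => //; apply: lt_le_trans y1; rewrite divr_gt0.
  have [xm xmI xmP] := EVT_min dM cz.
  exists xm; first by move: xmI; rewrite in_itv/= => /andP[y1 _]; apply: lt_le_trans y1; rewrite divr_gt0.
  move=> x x0; case: (ltP x d) => xd; first by left; apply: dP; rewrite x0.
  case: (ltP M x) => Mx; first by left; exact: MP.
  right; apply: xmP; rewrite in_itv/=; apply/andP; split; first by lra.
  by rewrite le_max Mx.
(* If [z T X < 0], then [m t + eta * t], with [m t] the infimum of [z t], has a negative
   minimum over [[0, T]], attained at some [(ts, xs)] with [ts > 0] and [xs > 0]; there
   [z_t <= - eta] while [z_x + z_xx >= 0]. *)
pose E t := [set z t x | x in [set x | 0 < x]].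
have E0 t : E t !=set0 by exists (z t 1), 1 => //=.
have El t : 0 <= t -> has_lbound (E t).
  rewrite le_eqVlt => /orP[/eqP<-|t0].
    by exists 0 => _ [x /= x0 <-]; exact: Z0.
  have [xm xm0 xmP] := attain t 1 t0 ltr01.
  exists (Num.min (-1) (z t xm)) => _ [x /= x0 <-]; rewrite ge_min.
  by case: (xmP x x0) => ->; rewrite ?orbT.
pose m t := inf (E t).
have m_le t x : 0 <= t -> 0 < x -> m t <= z t x.
  by move=> t0 x0; apply: ge_inf; [exact: El|exists x].
have m_ge t y : (forall x, 0 < x -> y <= z t x) -> y <= m t.
  by move=> h; apply: lb_le_inf => // _ [x /= x0 <-]; exact: h.
have m_cont t0 : 0 <= t0 -> forall e : R, 0 < e -> exists2 d : R, 0 < d &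
    forall t, 0 <= t -> `|t - t0| < d -> `|m t - m t0| <= e.
  move=> t00 e e0; have [d d0 dP] := ZT t0 t00 e e0; exists d => // t t1 td.
  rewrite ler_distl; apply/andP; split.
    apply: m_ge => x x0; have := dP t t1 td x x0; have := m_le t0 x t00 x0.
    by rewrite ler_distl => ? /andP[]; lra.
  rewrite -lerBlDr; apply: m_ge => x x0; have := dP t t1 td x x0; have := m_le t x t1 x0.
  by rewrite ler_distl => ? /andP[]; lra.
(* Half of the deficit is spent: [z T X + eta * T = z T X / 2] is still negative. *)
pose eta := - z T X / (2 * T).
have eta0 : 0 < eta by rewrite divr_gt0 ?oppr_gt0// mulr_gt0.
have etaT : z T X + eta * T < 0.
  have -> : eta * T = - z T X / 2 by rewrite /eta; field; rewrite gt_eqF.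
  lra.
have cm : {within `[0, T], continuous (fun t => m t + eta * t)}.
  have cmx : {within `[0, T], continuous m}.
    apply/continuous_within_itvP => //; split.
    - move=> t; rewrite in_itv/= => /andP[t0 tT]; apply/cvgrPdist_le => e e0.
      have [d d0 dP] := m_cont t (ltW t0) e e0.
      near=> s; rewrite distrC; apply: dP.
        by apply/ltW; near: s; exact: lt_nbhsr.
      rewrite distrC; near: s; have := @cvg_id _ (nbhs t) => /cvgrPdist_lt; exact.
    - apply/cvgrPdist_le => e e0.
      have [d d0 dP] := m_cont 0 (lexx 0) e e0.
      near=> s; rewrite distrC; apply: dP; first by near: s; exact: nbhs_right_ge.
      rewrite subr0 ger0_norm; last by near: s; exact: nbhs_right_ge.
      by near: s; exact: nbhs_right_lt.
    - apply/cvgrPdist_le => e e0.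
      have [d d0 dP] := m_cont T (ltW T0) e e0.
      near=> s; rewrite distrC; apply: dP; first by apply/ltW; near: s; exact: nbhs_left_gt.
      rewrite distrC; near: s.
      have : (x @[x --> T^'-] --> T) by apply: cvg_at_left_filter; exact: cvg_id.
      by move=> /cvgrPdist_lt; exact.
  move=> t; apply: cvgD; first exact: cmx.
  by apply: cvgM; [exact: cvg_cst|apply: continuous_subspaceT => ?; exact: cvg_id].
have [ts tsI tsP] := EVT_min (ltW T0) cm.
have mts : m ts + eta * ts < 0.
  apply: (@le_lt_trans _ _ (m T + eta * T)); first by apply: tsP; rewrite in_itv/= lexx ltW.
  by apply: le_lt_trans etaT; rewrite lerD2r; apply: m_le => //; exact: ltW.
move: tsI; rewrite in_itv/= le_eqVlt => /andP[/orP[/eqP ts0|ts0] tsT].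
  have : 0 <= m 0 by exact: m_ge.
  by move: mts; rewrite -ts0 mulr0 addr0; lra.
have mneg : m ts < 0 by have := mulr_gt0 eta0 ts0; lra.
(* The level [m ts / 2] lies above the infimum [m ts], so [attain] at this level shows that the
   infimum is a minimum. *)
have e20 : 0 < - m ts / 2 by lra.
have [xs xs0 xsP] := attain ts _ ts0 e20.
have zm : z ts xs = m ts.
  apply/eqP; rewrite eq_le; apply/andP; split; last by apply: m_le => //; exact: ltW.
  rewrite leNgt; apply/negP => lt.
  have : Num.min (z ts xs) (m ts / 2) <= m ts.
    apply: m_ge => x x0; rewrite ge_min; case: (xsP x x0) => [h|->//].
    by apply/orP; right; lra.
  by rewrite ge_min => /orP[|]; lra.
have zx y : 0 < y -> derivable (z ts) y 1 by move=> y0; case: (ZE ts y ts0 y0).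
have [dt dx dxx EQ] := ZE ts xs ts0 xs0.
have [|z1 z2] := second_derivative_min xs0 zx dxx.
  by move=> y y0; rewrite zm; apply: m_le => //; exact: ltW.
(* Only backward difference quotients are available, since [ts] may be the end point [T]. *)
have zt : derive1 (fun s => z s xs) ts <= - eta.
  rewrite leNgt; apply/negP => lt.
  have e0 : 0 < derive1 (fun s => z s xs) ts + eta by lra.
  have [d d0 dP] := derive_eps dt e0.
  pose h := Num.min (d / 2) (ts / 2).
  have h0 : 0 < h by rewrite lt_min !divr_gt0.
  have hd : h < d by rewrite gt_min; apply/orP; left; lra.
  have ht : h < ts by rewrite gt_min; apply/orP; right; lra.
  have := dP (- h); rewrite oppr_eq0 gt_eqF// normrN gtr0_norm// => /(_ isT hd).
  have hz : m ts + eta * ts <= z (ts - h) xs + eta * (ts - h).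
    apply: (@le_trans _ _ (m (ts - h) + eta * (ts - h))).
      by apply: tsP; rewrite in_itv/=; apply/andP; split; lra.
    by rewrite lerD2r; apply: m_le => //; lra.
  rewrite zm ltr_norml => /andP[lo _].
  have {}lo : - eta < (- h)^-1 * (z (ts - h) xs - m ts) by lra.
  move: lo; rewrite invrN mulNr ltrN2 ltr_pdivrMl//.
  by move: hz; nra.
lra.
Unshelve. all: by end_near. Qed.

End maximum_principle.

(** * Squared norms, null sets and pointwise bounds on the half line *)

Section sobolev_norms.
Context {R : realType}.
Notation mu := (@lebesgue_measure R).
Implicit Types (f g h u : R -> R) (a b x : R).

(** Again the square of the norm. An infinite value would be sent to 0 by [fine], hence the [L2]
    hypotheses in the lemmas that compare norms. *)
Definition norm2 f : R := fine (enorm2 f).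

Lemma norm2_ge0 f : 0 <= norm2 f. Proof. by apply: fine_ge0; exact: enorm2_ge0. Qed.

Lemma norm2E f : L2 f -> enorm2 f = (norm2 f)%:E.
Proof. by move=> fL2; rewrite /norm2 fineK// ge0_fin_numE ?enorm2_ge0// L2_enorm2. Qed.

Lemma norm2_le f g : L2 f -> L2 g -> (enorm2 f <= enorm2 g)%E -> norm2 f <= norm2 g.
Proof. by move=> fL2 gL2; rewrite !norm2E// lee_fin. Qed.

Lemma norm2_le2 f g h a b : 0 <= a -> 0 <= b -> L2 f -> L2 g -> L2 h ->
  (forall x, f x ^+ 2 <= a * g x ^+ 2 + b * h x ^+ 2) -> norm2 f <= a * norm2 g + b * norm2 h.
Proof.
move=> a0 b0 fL2 gL2 hL2 fgh.
have := enorm2_le2 a0 b0 fL2.1 gL2.1 hL2.1 fgh.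
by rewrite !norm2E// -!EFinM -EFinD lee_fin.
Qed.

Lemma L2_lin a b f g : L2 f -> L2 g -> L2 (fun x => a * f x + b * g x).
Proof.
move=> fL2 gL2; apply: L2P.
  by apply: measurable_funD; apply: measurable_funM => //; [exact: fL2.1|exact: gL2.1].
apply: (@le_lt_trans _ _ ((2 * a ^+ 2)%:E * enorm2 f + (2 * b ^+ 2)%:E * enorm2 g)%E).
  apply: enorm2_le2; [by rewrite mulr_ge0 ?sqr_ge0|by rewrite mulr_ge0 ?sqr_ge0| |exact: fL2.1|exact: gL2.1|].
    by apply: measurable_funD; apply: measurable_funM => //; [exact: fL2.1|exact: gL2.1].
  by move=> x; have := sqr_ge0 (a * f x - b * g x); nra.
by rewrite !norm2E// -!EFinM -EFinD ltry.
Qed.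

Lemma L2_patch f (D : set R) : measurable D -> L2 f -> L2 (f \_ D).
Proof.
move=> mD fL2; apply: L2P.
  by apply/(measurable_restrictT _ _).1 => //; apply: measurable_funTS; exact: fL2.1.
apply: le_lt_trans (L2_enorm2 fL2); apply: ge0_le_integral => //.
- by move=> x _; rewrite lee_fin sqr_ge0.
- apply/measurable_EFinP; apply: measurable_funX.
  by apply/(measurable_restrictT _ _).1 => //; apply: measurable_funTS; exact: fL2.1.
- by apply/measurable_EFinP; apply: measurable_funX; exact: fL2.1.
- by move=> x _; rewrite patchE lee_fin; case: ifP => _; rewrite ?expr0n ?sqr_ge0.
Qed.

Lemma norm2_patch f (D : set R) : measurable D -> L2 f -> norm2 (f \_ D) <= norm2 f.
Proof.
move=> mD fL2; have pL2 := L2_patch mD fL2.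
have := @norm2_le2 (f \_ D) f f 1 0 ler01 (lexx 0) pL2 fL2 fL2.
rewrite mul1r mul0r addr0; apply => x; rewrite mul1r mul0r addr0 patchE.
by case: ifP => _; rewrite ?expr0n ?sqr_ge0.
Qed.

Lemma enorm2_ae f g : measurable_fun setT f -> measurable_fun setT g ->
  {ae mu, forall x, f x = g x} -> enorm2 f = enorm2 g.
Proof.
move=> mf mg fg; apply: ae_eq_integral => //.
- by apply/measurable_EFinP; exact: measurable_funX.
- by apply/measurable_EFinP; exact: measurable_funX.
- apply: filterS fg; first exact: (ae_filter_ringOfSetsType mu).
  by move=> x /= -> .
Qed.

Lemma L2_ae f g : measurable_fun setT g -> L2 f -> {ae mu, forall x, f x = g x} -> L2 g.
Proof.
move=> mg fL2 fg; apply: L2P => //; rewrite -(enorm2_ae fL2.1 mg fg); exact: L2_enorm2.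
Qed.

Lemma aeS (P Q : R -> Prop) : (forall x, P x -> Q x) -> {ae mu, forall x, P x} -> {ae mu, forall x, Q x}.
Proof. by move=> PQ; apply: filterS => //; exact: (ae_filter_ringOfSetsType mu). Qed.

Lemma aeS2 (P Q S : R -> Prop) : (forall x, P x -> Q x -> S x) ->
  {ae mu, forall x, P x} -> {ae mu, forall x, Q x} -> {ae mu, forall x, S x}.
Proof. by move=> PQ; apply: filterS2 => //; exact: (ae_filter_ringOfSetsType mu). Qed.

Lemma aeN (P : R -> Prop) : {ae mu, forall x, P x} -> {ae mu, forall x, P (- x)}.
Proof.
move=> [N [mN N0 NP]]; exists (-%R @^-1` N); split.
- have mo : measurable_fun setT (-%R : measurableTypeR R -> measurableTypeR R) by [].
  by rewrite -[X in measurable X]setTI; exact: mo.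
- by rewrite -[RHS]N0; exact: (lebesgue_measureN mN).
- by move=> x /= nPx; apply: NP.
Qed.

Lemma ae_neq0 : {ae mu, forall x : R, x != 0}.
Proof.
exists [set 0]; split => //; first exact: lebesgue_measure_set1.
by move=> x /= /negP; rewrite negbK => /eqP.
Qed.

Lemma ae_eq_continuous_at f p : {ae mu, forall x, f x = 0} -> {for p, continuous f} -> f p = 0.
Proof.
move=> [N [mN N0 NP]] cf; apply/eqP; rewrite -normr_le0 leNgt; apply/negP => fp.
have /cvgrPdist_lt/(_ _ fp) [d /= d0 dP] := cf.
have sub : ball p d `<=` N.
  move=> y py; apply: NP => /= fy; have := dP y py.
  by rewrite fy subr0 ltxx.
have : (mu (ball p d) <= mu N)%E by apply: le_measure; rewrite ?inE//; exact: measurable_ball.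
by rewrite N0 (lebesgue_measure_ball _ (ltW d0)) lee_fin leNgt pmulrn_lgt0// d0.
Qed.

Lemma H2_norm_ltP f (e : R) : H2_norm_lt f e <-> exists g1 g2 : R -> R,
  [/\ L2 f, L2 g1, L2 g2, weak_deriv f g1 /\ weak_deriv g1 g2 & norm2 f + norm2 g1 + norm2 g2 < e ^+ 2].
Proof.
have E g1 g2 : L2 f -> L2 g1 -> L2 g2 ->
   Rintegral mu setT (fun x => f x ^+ 2 + g1 x ^+ 2 + g2 x ^+ 2) = norm2 f + norm2 g1 + norm2 g2.
  move=> fL2 g1L2 g2L2; rewrite RintegralD//; [|exact: rintegrableD fL2.2 g1L2.2|exact: g2L2.2].
  by rewrite RintegralD//; [exact: fL2.2|exact: g1L2.2].
by split=> -[g1 [g2 [h1 h2 h3 h4 h5]]]; exists g1, g2; split => //; move: h5; rewrite E.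
Qed.

Lemma H2_norm_lt_ae f h g1 g2 (e : R) : measurable_fun setT f -> L2 h -> L2 g1 -> L2 g2 ->
  {ae mu, forall x, h x = f x} -> weak_deriv h g1 -> weak_deriv g1 g2 ->
  norm2 h + norm2 g1 + norm2 g2 < e ^+ 2 -> H2_norm_lt f e.
Proof.
move=> mf hL2 g1L2 g2L2 hf w1 w2 lt.
have fL2 := L2_ae mf hL2 hf.
apply/H2_norm_ltP; exists g1, g2; split => //.
  split => //; apply: (weak_deriv_ae hL2 fL2 g1L2 g1L2 hf _ w1).
  by apply: aeW.
have -> : norm2 f = norm2 h by rewrite /norm2 -(enorm2_ae hL2.1 mf hf).
by [].
Qed.

(** Functions equal almost everywhere agree wherever both are continuous; so pointwise bounds pass
    from the representative to [h] itself for [x > 0]. *)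
Lemma weak_deriv_half_rep h g : L2 h -> L2 g -> weak_deriv h g ->
  (forall x, 0 < x -> {for x, continuous h}) ->
  exists u, [/\ abscont u g, L2 u, {ae mu, forall x, h x = u x} & forall x, 0 < x -> h x = u x].
Proof.
move=> hL2 gL2 hg ch; have [u [ug hu]] := weak_deriv_rep hL2 gL2 hg.
have cu := AC_continuous gL2 ug.
have mu_ : measurable_fun setT u by exact: continuous_measurable_fun.
exists u; split => //; first exact: L2_ae hL2 hu.
move=> x x0; apply/eqP; rewrite -subr_eq0; apply/eqP.
apply: (@ae_eq_continuous_at (fun y => h y - u y)).
  by apply: aeS hu => y ->; rewrite subrr.
by apply: cvgB; [exact: ch|exact: cu].
Qed.

Lemma half_sup h g : L2 h -> L2 g -> weak_deriv h g ->
  (forall x, 0 < x -> {for x, continuous h}) ->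
  forall x, 0 < x -> h x ^+ 2 <= 2 * (norm2 h + norm2 g).
Proof.
move=> hL2 gL2 hg ch x x0; have [u [ug uL2 hu hx]] := weak_deriv_half_rep hL2 gL2 hg ch.
rewrite hx// (le_trans (AC_bounded uL2 gL2 ug x))// /norm2 -(enorm2_ae hL2.1 uL2.1 hu).
exact: lexx.
Qed.

Lemma sqr_norm_le x (e : R) : 0 <= e -> x ^+ 2 <= e ^+ 2 -> `|x| <= e.
Proof.
by move=> e0 h; rewrite -(@ler_pXn2r _ 2) ?nnegrE// real_normK ?num_real.
Qed.

Lemma half_tail h g : L2 h -> L2 g -> weak_deriv h g ->
  (forall x, 0 < x -> {for x, continuous h}) ->
  forall e : R, 0 < e -> exists M : R, forall x, M < x -> `|h x| <= e.
Proof.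
move=> hL2 gL2 hg ch e e0; have [u [ug uL2 hu hx]] := weak_deriv_half_rep hL2 gL2 hg ch.
have e4 : 0 < e ^+ 2 / 4 by rewrite divr_gt0 ?exprn_gt0.
have [M1 MP1] := tail_integral uL2.2 (fun x => sqr_ge0 (u x)) e4.
have [M2 MP2] := tail_integral gL2.2 (fun x => sqr_ge0 (g x)) e4.
exists (Num.max 0 (Num.max M1 M2)) => x.
rewrite !gt_max => /andP[x0 /andP[/ltW x1 /ltW x2]].
apply: sqr_norm_le; first exact: ltW.
rewrite hx//; have := AC_sobolev x uL2 gL2 ug.
by have := MP1 x x1; have := MP2 x x2; lra.
Qed.

(** The continuous representative inherits oddness almost everywhere, hence vanishes at 0. *)
Lemma half_zero h g : L2 h -> L2 g -> weak_deriv h g -> odd_fun h ->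
  (forall x, 0 < x -> {for x, continuous h}) ->
  forall e : R, 0 < e -> exists2 d : R, 0 < d & forall x, 0 < x < d -> `|h x| <= e.
Proof.
move=> hL2 gL2 hg oh ch e e0; have [u [ug uL2 hu hx]] := weak_deriv_half_rep hL2 gL2 hg ch.
have cu := AC_continuous gL2 ug.
have u0 : u 0 = 0.
  have : u 0 + u (- 0) = 0.
    apply: (@ae_eq_continuous_at (fun y => u y + u (- y))).
      apply: aeS2 hu (aeN hu) => y <- <-; by rewrite oh subrr.
    apply: cvgD; first exact: cu.
    by apply: (cvg_comp -%R u); [apply: cvgN; exact: cvg_id|exact: cu].
  by rewrite oppr0; lra.
have /cvgrPdist_lt/(_ _ e0)[d /= d0 dP] := cu 0.
exists d => // x /andP[x0 xd]; rewrite hx//.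
have := dP x; rewrite /ball_/= sub0r normrN gtr0_norm// => /(_ xd).
by rewrite u0 sub0r normrN => /ltW.
Qed.

End sobolev_norms.

(** * The flow of the linear equation by the method of images *)

Section drift_semigroup.
Context {R : realType}.
Notation mu := (@lebesgue_measure R).
Notation P := (`[(0 : R), +oo[%classic).
Implicit Types (A B f g h u : R -> R) (a b t x w : R).

(* Method of images: [A] travels along the drift, and the reflected datum [B] enters
   through the solution map [u |-> expR (- x) * u t (- x)]. *)
Definition drift_flow A B t x : R :=
  hsm (A \_ P) 1 t (Num.sqrt (2 * t)) x + expR (- x) * hsm (B \_ P) (-1) t (Num.sqrt (2 * t)) x.

Lemma L2P0 f : L2 f -> L2 (f \_ P).
Proof. by apply: L2_patch. Qed.

Let sg1 : (1 : R) = 1 \/ (1 : R) = -1. Proof. by left. Qed.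
Let sgN1 : (-1 : R) = 1 \/ (-1 : R) = -1. Proof. by right. Qed.

Lemma L2_hsm f sg c d : sg = 1 \/ sg = -1 -> L2 f -> L2 (hsm f sg c d).
Proof.
move=> sgE fL2; apply: L2P; first by apply: measurable_hsm; exact: fL2.1.
by apply: le_lt_trans (enorm2_hsm _ _ sgE fL2) _; exact: L2_enorm2.
Qed.

Lemma norm2_hsm f sg c d : sg = 1 \/ sg = -1 -> L2 f -> norm2 (hsm f sg c d) <= norm2 f.
Proof. by move=> sgE fL2; apply: norm2_le => //; [exact: L2_hsm|exact: enorm2_hsm]. Qed.

Lemma expRN_sq_le1 x : 0 <= x -> 0 <= expR (- x) <= 1.
Proof. by move=> x0; rewrite expR_ge0/= -expR0 ler_expR oppr_le0. Qed.

(** The weight is at most 1 only for [x >= 0], which is why [L^2] bounds are taken for flows cut off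
    to the half line. *)
Lemma drift_flow_sq_le x (p q : R) : 0 <= x -> (p + expR (- x) * q) ^+ 2 <= 2 * p ^+ 2 + 2 * q ^+ 2.
Proof.
move=> /expRN_sq_le1 /andP[e0 e1]; set e := expR _ in e0 e1 *.
have : (e * q) ^+ 2 <= q ^+ 2 by rewrite exprMn ler_piMl ?sqr_ge0// expr_le1.
by have := sqr_ge0 (p - e * q); nra.
Qed.

Lemma measurable_drift_flow A B t : L2 A -> L2 B -> measurable_fun setT (drift_flow A B t).
Proof.
move=> AL2 BL2; apply: measurable_funD.
  by apply: measurable_hsm; exact: (L2P0 AL2).1.
apply: measurable_funM; last by apply: measurable_hsm; exact: (L2P0 BL2).1.
by apply: measurableT_comp => //; exact: measurable_oppr.
Qed.

Lemma L2_drift_flow_gen (p q r : R -> R) : L2 p -> L2 q -> measurable_fun setT r ->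
  (forall x, 0 <= x -> r x ^+ 2 <= 2 * p x ^+ 2 + 2 * q x ^+ 2) ->
  L2 (r \_ P) /\ norm2 (r \_ P) <= 2 * norm2 p + 2 * norm2 q.
Proof.
move=> pL2 qL2 mr rpq.
have mrP : measurable_fun setT (r \_ P).
  by apply/(measurable_restrictT _ _).1 => //; exact: measurable_funTS.
have H x : (r \_ P) x ^+ 2 <= 2 * p x ^+ 2 + 2 * q x ^+ 2.
  rewrite patchE; case: ifPn => [|_].
    by rewrite mem_setE in_itv/= andbT; exact: rpq.
  by rewrite expr0n/= addr_ge0// mulr_ge0// sqr_ge0.
have rL2 : L2 (r \_ P).
  apply: L2P => //; apply: (@le_lt_trans _ _ (2%:E * enorm2 p + 2%:E * enorm2 q)%E).
    by apply: enorm2_le2 => //; [exact: pL2.1|exact: qL2.1].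
  by rewrite !norm2E// -!EFinM -EFinD ltry.
by split => //; apply: norm2_le2.
Qed.

Lemma L2_drift_flow A B t : L2 A -> L2 B -> L2 (drift_flow A B t \_ P) /\
  norm2 (drift_flow A B t \_ P) <= 2 * norm2 A + 2 * norm2 B.
Proof.
move=> AL2 BL2; have A'L2 := L2P0 AL2; have B'L2 := L2P0 BL2.
have [h1 h2] := L2_drift_flow_gen (L2_hsm t (Num.sqrt (2 * t)) sg1 A'L2)
  (L2_hsm t (Num.sqrt (2 * t)) sgN1 B'L2) (measurable_drift_flow t AL2 BL2)
  (fun x hx => @drift_flow_sq_le x _ _ hx).
split => //; apply: (le_trans h2); apply: lerD; rewrite ler_pM2l//.
  by apply: le_trans (norm2_hsm _ _ sg1 A'L2) _; exact: norm2_patch.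
by apply: le_trans (norm2_hsm _ _ sgN1 B'L2) _; exact: norm2_patch.
Qed.

(** The bound is kept in terms of [sqrt (2 t)], the width of the average, because this is continuous
    at time zero although not differentiable there. *)
Lemma norm2_drift_flowB A B : L2 A -> L2 B -> forall e : R, 0 < e -> exists2 D : R, 0 <= D & forall t t',
  0 <= t -> 0 <= t' ->
  norm2 ((fun x => drift_flow A B t x - drift_flow A B t' x) \_ P) <=
    e + D * ((t - t') ^+ 2 + (Num.sqrt (2 * t) - Num.sqrt (2 * t')) ^+ 2).
Proof.
move=> AL2 BL2 e e0; have A'L2 := L2P0 AL2; have B'L2 := L2P0 BL2.
have e4 : 0 < e / 4 by rewrite divr_gt0.
have [D1 [D10 D1P]] := enorm2_hsmB A'L2 e4; have [D2 [D20 D2P]] := enorm2_hsmB B'L2 e4.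
exists (2 * D1 + 2 * D2) => [|t t' t0 t'0]; first by rewrite addr_ge0// mulr_ge0.
pose d s := Num.sqrt (2 * s : R).
have LA := L2B (L2_hsm t (d t) sg1 A'L2) (L2_hsm t' (d t') sg1 A'L2).
have LB := L2B (L2_hsm t (d t) sgN1 B'L2) (L2_hsm t' (d t') sgN1 B'L2).
have mr : measurable_fun setT (fun x => drift_flow A B t x - drift_flow A B t' x).
  by apply: measurable_funB; exact: measurable_drift_flow.
have Hr x : 0 <= x -> (drift_flow A B t x - drift_flow A B t' x) ^+ 2 <=
   2 * (hsm (A \_ P) 1 t (d t) x - hsm (A \_ P) 1 t' (d t') x) ^+ 2 +
   2 * (hsm (B \_ P) (-1) t (d t) x - hsm (B \_ P) (-1) t' (d t') x) ^+ 2.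
  move=> x0; rewrite /drift_flow -/(d t) -/(d t').
  have := drift_flow_sq_le (hsm (A \_ P) 1 t (d t) x - hsm (A \_ P) 1 t' (d t') x)
    (hsm (B \_ P) (-1) t (d t) x - hsm (B \_ P) (-1) t' (d t') x) x0.
  by congr (_ ^+ 2 <= _); ring.
have [_ h2] := L2_drift_flow_gen LA LB mr Hr.
have N1 := D1P 1 t (d t) t' (d t') sg1 (sqrtr_ge0 _) (sqrtr_ge0 _).
have N2 := D2P (-1) t (d t) t' (d t') sgN1 (sqrtr_ge0 _) (sqrtr_ge0 _).
rewrite norm2E// lee_fin in N1; rewrite norm2E// lee_fin in N2.
apply: (le_trans h2); rewrite /d in N1 N2 *.
set S := (t - t') ^+ 2 + _ in N1 N2 *.
by rewrite /S in N1 N2 *; nra.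
Qed.

Lemma drift_flow_sup A B t x : L2 A -> L2 B -> 0 < t -> 0 <= x ->
  drift_flow A B t x ^+ 2 <= 2 * (Num.sqrt (2 * t))^-1 * (norm2 A + norm2 B).
Proof.
move=> AL2 BL2 t0 x0; have A'L2 := L2P0 AL2; have B'L2 := L2P0 BL2.
have d0 : 0 < Num.sqrt (2 * t) by rewrite sqrtr_gt0 mulr_gt0.
apply: (le_trans (drift_flow_sq_le _ _ x0)).
have h1 := hsm_sup t x sg1 d0 A'L2; have h2 := hsm_sup t x sgN1 d0 B'L2.
have di : 0 <= (Num.sqrt (2 * t))^-1 by rewrite invr_ge0 ltW.
have n1 := ler_wpM2l di (norm2_patch (measurable_itv `[0, +oo[) AL2).
have n2' := ler_wpM2l di (norm2_patch (measurable_itv `[0, +oo[) BL2).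
rewrite -!/(norm2 _) in h1 h2.
rewrite -mulrA mulrDr; lra.
Qed.

Lemma drift_flow_continuous A B t : L2 A -> L2 B -> 0 < t -> continuous (drift_flow A B t).
Proof.
move=> AL2 BL2 t0 x.
have d0 : 0 < Num.sqrt (2 * t) by rewrite sqrtr_gt0 mulr_gt0.
apply: cvgD; first exact: (hsm_continuous sg1 d0 (L2P0 AL2)).
apply: cvgM; last exact: (hsm_continuous sgN1 d0 (L2P0 BL2)).
apply: (cvg_comp -%R expR); first by apply: cvgN; exact: cvg_id.
exact: continuous_expR.
Qed.

Lemma hsm00 f sg x : hsm f sg 0 (Num.sqrt (2 * 0)) x = f (sg * x).
Proof.
rewrite /hsm /smear mulr0 sqrtr0.
have -> : (fun s => gam s * f (sg * x + (0 + 0 * s))) = (fun s => f (sg * x) * gam s).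
  by apply/funext => s; rewrite mul0r !addr0 mulrC.
rewrite RintegralZl//; last exact: integrable_gam.
by rewrite (_ : \int[mu]_s gam s = 1) ?mulr1// /Rintegral integral_gam.
Qed.

Lemma drift_flow00 A B x : 0 < x -> drift_flow A B 0 x = A x.
Proof.
move=> x0; rewrite /drift_flow !hsm00 mul1r mulN1r !patchE !mem_setE !in_itv/= !andbT (ltW x0).
by rewrite oppr_ge0 leNgt x0/= mulr0 addr0.
Qed.

Lemma drift_flowE A B t x : L2 A -> L2 B -> 0 < t ->
  drift_flow A B t x = hA A t (x + t) + expR (- x) * hA B t (t - x).
Proof.
move=> AL2 BL2 t0; rewrite /drift_flow (hA_hsm _ _ t0 (L2P0 AL2) sg1) (hA_hsm _ _ t0 (L2P0 BL2) sgN1).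
by rewrite mul1r mulN1r (addrC (- x)).
Qed.

Lemma heat_L2 t w : 0 < t -> L2 (fun y => heat t (w - y)) /\
  L2 (fun y => heat_z t (w - y)) /\ L2 (fun y => heat_zz t (w - y)).
Proof.
move=> t0; have tn0 : t != 0 by rewrite gt_eqF.
have [C [b [C0 tb CP]]] := heat_bounds_at w t0.
have tt : t / 2 < t < b by apply/andP; split => //; lra.
have ww : w - 1 < w < w + 1 by apply/andP; split; lra.
have c0 : 0 < (16 * b)^-1 by rewrite invr_gt0 mulr_gt0//; lra.
split; last split; apply: gdecay_L2.
- by apply: continuous_measurable_fun; exact: heat_shift_continuous.
- by exists C, (16 * b)^-1; split => // y; have [] := CP t w y tt ww.
- by apply: continuous_measurable_fun; exact: heat_z_shift_continuous.
- by exists C, (16 * b)^-1; split => // y; have [] := CP t w y tt ww.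
- by apply: continuous_measurable_fun; exact: heat_zz_shift_continuous.
- by exists C, (16 * b)^-1; split => // y; have [] := CP t w y tt ww.
Qed.

Lemma RintegralP_lin (k f g : R -> R) a b : L2 k -> L2 f -> L2 g ->
  \int[mu]_(y in P) (k y * (a * f y + b * g y)) =
  a * \int[mu]_(y in P) (k y * f y) + b * \int[mu]_(y in P) (k y * g y).
Proof.
move=> kL2 fL2 gL2.
have i1 : mu.-integrable P (EFin \o (fun y => k y * f y)).
  have := L2_mul_integrable kL2 fL2; exact: integrableS.
have i2 : mu.-integrable P (EFin \o (fun y => k y * g y)).
  have := L2_mul_integrable kL2 gL2; exact: integrableS.
rewrite -RintegralZl// -RintegralZl// -RintegralD//; last 2 first.
- exact: rintegrableZ.
- exact: rintegrableZ.
by apply: eq_Rintegral => y _; ring.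
Qed.

Lemma hA_lin f g a b t w : L2 f -> L2 g -> 0 < t ->
  hA (fun y => a * f y + b * g y) t w = a * hA f t w + b * hA g t w.
Proof. by move=> fL2 gL2 t0; rewrite /hA RintegralP_lin//; exact: (heat_L2 w t0).1. Qed.

(** * Derivatives of the flow for data with two derivatives *)

Section domain.
Variables f0 f1 f2 : R -> R.
Hypothesis L0 : L2 f0.
Hypothesis L1 : L2 f1.
Hypothesis L2' : L2 f2.
Hypothesis ac0 : abscont f0 f1.
Hypothesis ac1 : abscont f1 f2.
Hypothesis f00 : f0 0 = 0.

(* The reflected data that go with [f0], [f1] and [f2]: [refl0] makes the boundary value
   vanish, [refl1] and [refl2] come from differentiating in [x] and integrating by parts.
   They are written as linear combinations for the sake of [hA_lin]. *)
Definition refl0 x := (-1) * f0 x + 0 * f0 x.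
Definition refl1 x := 1 * f1 x + 1 * f0 x.
Definition refl2 x := (-1) * (1 * f2 x + 2 * f1 x) + (-1) * f0 x.

Lemma L2_refl0 : L2 refl0. Proof. exact: L2_lin. Qed.
Lemma L2_refl1 : L2 refl1. Proof. exact: L2_lin. Qed.
Lemma L2_f2_2f1 : L2 (fun x => 1 * f2 x + 2 * f1 x). Proof. exact: L2_lin. Qed.
Lemma L2_refl2 : L2 refl2. Proof. by apply: (@L2_lin _ (-1) (-1) _ f0) => //; exact: L2_f2_2f1. Qed.

Lemma f_bound u g : L2 u -> L2 g -> abscont u g -> exists2 B : R, 0 <= B & forall y, `|u y| <= B.
Proof.
move=> uL2 gL2 ug; exists (Num.sqrt (2 * (norm2 u + norm2 g))) => [|y]; first exact: sqrtr_ge0.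
apply: sqr_norm_le; first exact: sqrtr_ge0.
rewrite sqr_sqrtr; last by rewrite mulr_ge0// addr_ge0// norm2_ge0.
exact: AC_bounded.
Qed.

Definition drift_flow0 := drift_flow f0 refl0.
Definition drift_flow1 := drift_flow f1 refl1.
Definition drift_flow2 := drift_flow f2 refl2.

Lemma hAz_ibp u g t w : L2 u -> L2 g -> abscont u g -> 0 < t ->
  hAz u t w = u 0 * heat t w + hA g t w.
Proof.
move=> uL2 gL2 ug t0; have [B B0 BP] := f_bound uL2 gL2 ug.
by have [] := heat_ibp w t0 gL2 (AC_ACp ug) (fun y _ => BP y).
Qed.

Lemma der_hA u g t w : L2 u -> L2 g -> abscont u g -> 0 < t ->
  is_derive w 1 (hA u t) (u 0 * heat t w + hA g t w).
Proof.
move=> uL2 gL2 ug t0; have [B B0 BP] := f_bound uL2 gL2 ug.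
have := is_derive_hA_z w t0 B0 uL2.1 (fun y _ => BP y).
by rewrite (hAz_ibp w uL2 gL2 ug t0).
Qed.

Lemma der_hA_right u g t x : L2 u -> L2 g -> abscont u g -> 0 < t ->
  is_derive x 1 (fun x => hA u t (x + t)) (u 0 * heat t (x + t) + hA g t (x + t)).
Proof.
move=> uL2 gL2 ug t0.
have hs : is_derive x 1 (fun x => x + t) 1.
  by apply: (is_derive_eq (derD (is_derive_id x 1) (is_derive_cst t x 1))); rewrite addr0.
have := der_comp (f := hA u t) (g := fun x => x + t) (der_hA (x + t) uL2 gL2 ug t0) hs.
by rewrite mulr1.
Qed.

Lemma der_hA_left u g t x : L2 u -> L2 g -> abscont u g -> 0 < t ->
  is_derive x 1 (fun x => hA u t (t - x)) (- (u 0 * heat t (t - x) + hA g t (t - x))).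
Proof.
move=> uL2 gL2 ug t0.
have hs : is_derive x 1 (fun x => t - x) (-1).
  by apply: (is_derive_eq (derB (is_derive_cst t x 1) (is_derive_id x 1))); rewrite sub0r.
have := der_comp (f := hA u t) (g := fun x => t - x) (der_hA (t - x) uL2 gL2 ug t0) hs.
by rewrite mulrN1.
Qed.

Lemma der_expN x : is_derive x 1 (fun x : R => expR (- x)) (- expR (- x)).
Proof.
by have := der_exp (derN (is_derive_id x 1)); rewrite mulrN1.
Qed.

(** In the reflected part the weight contributes [f0] and the kernel [f1], whence the datum [refl1];
    the boundary terms carry [f0 0 = 0]. *)
Lemma der_drift_flow0 t x : 0 < t -> is_derive x 1 (drift_flow0 t) (drift_flow1 t x).
Proof.
move=> t0.
have -> : drift_flow0 t = (fun x => hA f0 t (x + t) + (- (expR (- x) * hA f0 t (t - x)))).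
  apply/funext => y; rewrite /drift_flow0 (drift_flowE _ L0 L2_refl0 t0) (hA_lin (-1) 0 _ L0 L0 t0); ring.
apply: (is_derive_eq (derD (der_hA_right x L0 L1 ac0 t0)
  (derN (derM (der_expN x) (der_hA_left x L0 L1 ac0 t0))))).
rewrite /drift_flow1 (drift_flowE _ L1 L2_refl1 t0) (hA_lin 1 1 _ L1 L0 t0) f00; ring.
Qed.

(** Now the boundary terms carry [f1 0], which is arbitrary; those of the two parts cancel by
    [heat_reflect]. *)
Lemma der_drift_flow1 t x : 0 < t -> is_derive x 1 (drift_flow1 t) (drift_flow2 t x).
Proof.
move=> t0.
have -> : drift_flow1 t = (fun x => hA f1 t (x + t) + (expR (- x) * (hA f1 t (t - x) + hA f0 t (t - x)))).
  by apply/funext => y; rewrite /drift_flow1 (drift_flowE _ L1 L2_refl1 t0) (hA_lin 1 1 _ L1 L0 t0) !mul1r.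
apply: (is_derive_eq (derD (der_hA_right x L1 L2' ac1 t0)
  (derM (der_expN x) (derD (der_hA_left x L1 L2' ac1 t0) (der_hA_left x L0 L1 ac0 t0))))).
rewrite /drift_flow2 (drift_flowE _ L2' L2_refl2 t0) (hA_lin (-1) (-1) _ L2_f2_2f1 L0 t0) (hA_lin 1 2 _ L2' L1 t0) f00.
rewrite heat_reflect ?gt_eqF//; ring.
Qed.

Lemma der_hA_time c t : 0 < t ->
  is_derive t 1 (fun s => hA f0 s (c + s)) (f1 0 * heat t (c + t) + hA f2 t (c + t) + hA f1 t (c + t)).
Proof.
move=> t0; have [B B0 BP] := f_bound L0 L1 ac0.
have := is_derive_hA_line c t0 B0 L0.1 (fun y _ => BP y).
have [_ [Lz Lzz]] := heat_L2 (c + t) t0.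
have -> : \int[mu]_(y in P) ((heat_zz t (c + t - y) + heat_z t (c + t - y)) * f0 y) =
  \int[mu]_(y in P) (heat_zz t (c + t - y) * f0 y) + \int[mu]_(y in P) (heat_z t (c + t - y) * f0 y).
  rewrite -RintegralD//.
  - by apply: eq_Rintegral => y _; rewrite mulrDl.
  - have := L2_mul_integrable Lzz L0; exact: integrableS.
  - have := L2_mul_integrable Lz L0; exact: integrableS.
have [-> ->] := heat_ibp (c + t) t0 L1 (AC_ACp ac0) (fun y _ => BP y).
by rewrite f00 !mul0r !add0r (hAz_ibp _ L1 L2' ac1 t0).
Qed.

Lemma der_drift_flow0_time t x : 0 < t -> is_derive t 1 (fun s => drift_flow0 s x) (drift_flow1 t x + drift_flow2 t x).
Proof.
move=> t0.
have h1 := derB (der_hA_time x t0) (derZ (expR (- x)) (der_hA_time (- x) t0)).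
(* The kernel form is available for positive times only, hence the equality near [t]. *)
have e : \forall s \near t, hA f0 s (x + s) - expR (- x) * hA f0 s (- x + s) = drift_flow0 s x.
  near=> s; have s0 : 0 < s by near: s; exact: lt_nbhsr.
  rewrite /drift_flow0 (drift_flowE _ L0 L2_refl0 s0) (hA_lin (-1) 0 _ L0 L0 s0) (addrC (- x)); ring.
apply: (near_eq_is_derive e); apply: (is_derive_eq h1).
rewrite /drift_flow1 (drift_flowE _ L1 L2_refl1 t0) (hA_lin 1 1 _ L1 L0 t0).
rewrite /drift_flow2 (drift_flowE _ L2' L2_refl2 t0) (hA_lin (-1) (-1) _ L2_f2_2f1 L0 t0) (hA_lin 1 2 _ L2' L1 t0).
rewrite heat_reflect ?gt_eqF// (addrC (- x)); ring.
Unshelve. all: by end_near. Qed.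

End domain.
End drift_semigroup.

(** * Half-line functions with an [H^2] odd extension, and the flow among them *)

Section half_line_sobolev.
Context {R : realType}.
Notation mu := (@lebesgue_measure R).
Notation P := (`[(0 : R), +oo[%classic).
Implicit Types (p q f g h u A B : R -> R) (a b t x y e : R).

Definition half_bounded p := exists B : R, forall y, 0 <= y -> `|p y| <= B.

(** What puts [oddx p] in [H^2] of the line, with derivatives [evenx p1] and [oddx p2]. Only [p] has
    to vanish at 0; boundedness removes the boundary terms at infinity. *)
Record half_H2 p p1 p2 : Prop := HalfH2 {
  half_L2 : L2 p; half_L21 : L2 p1; half_L22 : L2 p2;
  half_at0 : p 0 = 0;
  half_ac : abscontp p p1; half_ac1 : abscontp p1 p2;
  half_bd : half_bounded p; half_bd1 : half_bounded p1 }.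

Lemma abscontpB u g u' g' : L2 g -> L2 g' -> abscontp u g -> abscontp u' g' ->
  abscontp (fun x => u x - u' x) (fun x => g x - g' x).
Proof.
move=> gL2 g'L2 ug ug' y y0; rewrite RintegralB//; [|exact: L2_itv|exact: L2_itv].
by rewrite -ug// -ug'//; ring.
Qed.

Lemma half_boundedB p q : half_bounded p -> half_bounded q -> half_bounded (fun x => p x - q x).
Proof.
move=> [B BP] [C CP]; exists (B + C) => y y0.
by rewrite (le_trans (ler_normB _ _))// lerD ?BP ?CP.
Qed.

Lemma half_H2B p p1 p2 q q1 q2 : half_H2 p p1 p2 -> half_H2 q q1 q2 ->
  half_H2 (fun x => p x - q x) (fun x => p1 x - q1 x) (fun x => p2 x - q2 x).
Proof.
move=> [a1 a2 a3 a4 a5 a6 a7 a8] [b1 b2 b3 b4 b5 b6 b7 b8]; split.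
- exact: L2B.
- exact: L2B.
- exact: L2B.
- by rewrite a4 b4 subrr.
- exact: abscontpB.
- exact: abscontpB.
- exact: half_boundedB.
- exact: half_boundedB.
Qed.

Lemma norm2_oddx p : L2 p -> norm2 (oddx p) <= 2 * norm2 p.
Proof.
move=> pL2; rewrite -lee_fin EFinM -!norm2E//; last exact: L2_oddx.
by apply: enorm2_oddx; exact: pL2.1.
Qed.

Lemma norm2_evenx p : L2 p -> norm2 (evenx p) <= 2 * norm2 p.
Proof.
move=> pL2; rewrite -lee_fin EFinM -!norm2E//; last exact: L2_evenx.
by apply: enorm2_evenx; exact: pL2.1.
Qed.

Lemma half_weak p p1 p2 : half_H2 p p1 p2 ->
  weak_deriv (oddx p) (evenx p1) /\ weak_deriv (evenx p1) (oddx p2).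
Proof.
move=> [a1 a2 a3 a4 a5 a6 [B BP] [C CP]]; split.
  exact: (@weak_deriv_oddx _ p p1 B).
exact: (@weak_deriv_evenx _ p1 p2 C).
Qed.

(** Equality almost everywhere is enough, which covers time zero, where the solution is the
    prescribed datum. The factor 2 is the cost of the extensions. *)
Lemma half_H2_norm p p1 p2 h e : half_H2 p p1 p2 -> measurable_fun setT h ->
  {ae mu, forall x, oddx p x = h x} -> 2 * (norm2 p + norm2 p1 + norm2 p2) < e ^+ 2 ->
  H2_norm_lt h e.
Proof.
move=> H mh ph lt; have [w1 w2] := half_weak H; case: H => a1 a2 a3 _ _ _ _ _.
apply: (H2_norm_lt_ae mh (L2_oddx a1) (L2_evenx a2) (L2_oddx a3) ph w1 w2).
apply: le_lt_trans lt; rewrite !mulrDr; apply: lerD; last exact: norm2_oddx.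
by apply: lerD; [exact: norm2_oddx|exact: norm2_evenx].
Qed.

Lemma half_H2_sup p p1 p2 e : half_H2 p p1 p2 ->
  (forall y, 0 <= y -> [/\ `|p y| <= e, `|p1 y| <= e & `|p2 y| <= e]) ->
  W2inf_norm_le (oddx p) e.
Proof.
move=> H pe; have [w1 w2] := half_weak H; case: H => a1 a2 a3 _ _ _ _ _.
exists (evenx p1), (oddx p2); split => //.
- by apply: measurable_oddx; exact: a1.1.
- by apply: measurable_evenx; exact: a2.1.
- by apply: measurable_oddx; exact: a3.1.
have odd_le f x : (forall y, 0 <= y -> `|f y| <= e) -> `|oddx f x| <= e.
  move=> fe; rewrite /oddx; case: ifPn => [|]; first exact: fe.
  by rewrite -ltNge => x0; rewrite normrN fe// oppr_ge0 ltW.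
apply: (aeS _ (ae_neq0 (R := R))) => x _; split.
- by apply: odd_le => y y0; have [] := pe y y0.
- by rewrite /evenx; have [] := pe `|x| (normr_ge0 x).
- by apply: odd_le => y y0; have [] := pe y y0.
Qed.

Lemma oddxB p q x : oddx (fun x => p x - q x) x = oddx p x - oddx q x.
Proof. by rewrite /oddx; case: ifP => _ //; rewrite opprB opprK addrC. Qed.

(* At [t = 0] and [x = 0] the formula of [drift_flow] would give [A 0 + B 0]. *)
Definition half_flow A B t : R -> R := (if t == 0 then A else drift_flow A B t) \_ P.

Lemma half_flow_ge0 A B t x : 0 < t -> 0 <= x -> half_flow A B t x = drift_flow A B t x.
Proof. by move=> t0 x0; rewrite /half_flow gt_eqF// patchE mem_setE in_itv/= andbT x0. Qed.

Lemma half_flow_init A B x : 0 <= x -> half_flow A B 0 x = A x.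
Proof. by move=> x0; rewrite /half_flow eqxx patchE mem_setE in_itv/= andbT x0. Qed.

Lemma half_flow_drift_flow A B t x : x != 0 -> half_flow A B t x = (drift_flow A B t \_ P) x.
Proof.
move=> x0; rewrite /half_flow; case: eqP => // ->; rewrite !patchE mem_setE in_itv/= andbT.
by case: ifP => // xge0; rewrite drift_flow00// lt_neqAle eq_sym x0.
Qed.

Lemma L2_half_flow A B t : L2 A -> L2 B ->
  L2 (half_flow A B t) /\ norm2 (half_flow A B t) <= 2 * norm2 A + 2 * norm2 B.
Proof.
move=> AL2 BL2; rewrite /half_flow; case: ifP => [_|_]; last exact: L2_drift_flow.
split; first exact: L2_patch.
have h := @norm2_patch _ A P (measurable_itv _) AL2.
have := norm2_ge0 A; have := norm2_ge0 B; lra.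
Qed.

Lemma norm2_half_flowB A B : L2 A -> L2 B -> forall e, 0 < e -> exists2 D : R, 0 <= D & forall t t',
  0 <= t -> 0 <= t' ->
  norm2 (fun x => half_flow A B t x - half_flow A B t' x) <=
    e + D * ((t - t') ^+ 2 + (Num.sqrt (2 * t) - Num.sqrt (2 * t')) ^+ 2).
Proof.
move=> AL2 BL2 e e0; have [D D0 DP] := norm2_drift_flowB AL2 BL2 e0; exists D => // t t' t0 t'0.
apply: le_trans (DP t t' t0 t'0); rewrite le_eqVlt; apply/orP; left; apply/eqP.
have [h1 _] := L2_drift_flow t AL2 BL2; have [h2 _] := L2_drift_flow t' AL2 BL2.
have E : (fun x => drift_flow A B t x - drift_flow A B t' x) \_ P =
    (fun x => (drift_flow A B t \_ P) x - (drift_flow A B t' \_ P) x).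
  by apply/funext => x; rewrite !patchE; case: ifP => // _; rewrite subr0.
rewrite E /norm2; congr fine; apply: enorm2_ae.
- by apply: measurable_funB; [exact: (L2_half_flow t AL2 BL2).1.1|exact: (L2_half_flow t' AL2 BL2).1.1].
- by apply: measurable_funB; [exact: h1.1|exact: h2.1].
by apply: (aeS _ (ae_neq0 (R := R))) => x x0; rewrite !half_flow_drift_flow.
Qed.

Lemma half_flow_bounded A B t : L2 A -> L2 B -> half_bounded A -> 0 <= t -> half_bounded (half_flow A B t).
Proof.
move=> AL2 BL2 [C CP]; rewrite le_eqVlt => /orP[/eqP<-|t0].
  by exists C => y y0; rewrite half_flow_init// CP.
exists (Num.sqrt (2 * (Num.sqrt (2 * t))^-1 * (norm2 A + norm2 B))) => y y0.
have n0 : 0 <= 2 * (Num.sqrt (2 * t))^-1 * (norm2 A + norm2 B).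
  by rewrite mulr_ge0 ?addr_ge0 ?norm2_ge0// mulr_ge0// invr_ge0 sqrtr_ge0.
rewrite half_flow_ge0//; apply: sqr_norm_le; first exact: sqrtr_ge0.
by rewrite sqr_sqrtr// drift_flow_sup.
Qed.

(** For [t > 0] the derivative is classical and continuous; at [t = 0] the absolute continuity of
    the datum takes its place. *)
Lemma abscontp_half_flow A B A' B' t : L2 A' -> L2 B' -> abscont A A' ->
  (forall t, 0 < t -> forall x, is_derive x 1 (drift_flow A B t) (drift_flow A' B' t x)) ->
  0 <= t -> abscontp (half_flow A B t) (half_flow A' B' t).
Proof.
move=> AL2 BL2 AA' HH; rewrite le_eqVlt => /orP[/eqP<-|t0] y y0.
  rewrite !half_flow_init// AA'//; apply: eq_Rintegral => x.
  by rewrite inE/= in_itv/= => /andP[x0 _]; rewrite half_flow_init.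
rewrite !half_flow_ge0// -(FTC2_line (HH t t0) (drift_flow_continuous AL2 BL2 t0) y0).
apply: eq_Rintegral => x.
by rewrite inE/= in_itv/= => /andP[x0 _]; rewrite half_flow_ge0.
Qed.

Lemma sqrD_le (a b : R) : (a + b) ^+ 2 <= 2 * a ^+ 2 + 2 * b ^+ 2.
Proof. by have := sqr_ge0 (a - b); nra. Qed.

Section flow.
Variables f0 f1 f2 : R -> R.
Hypothesis L0 : L2 f0.
Hypothesis L1 : L2 f1.
Hypothesis L2' : L2 f2.
Hypothesis ac0 : abscont f0 f1.
Hypothesis ac1 : abscont f1 f2.
Hypothesis f00 : f0 0 = 0.

Definition half_flow0 := half_flow f0 (refl0 f0).
Definition half_flow1 := half_flow f1 (refl1 f0 f1).
Definition half_flow2 := half_flow f2 (refl2 f0 f1 f2).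

Let H0 := L2_refl0 L0.
Let H1 := L2_refl1 L0 L1.
Let H2 := L2_refl2 L0 L1 L2'.

Lemma abscont_half_bounded u g : L2 u -> L2 g -> abscont u g -> half_bounded u.
Proof.
by move=> uL2 gL2 ug; have [B B0 BP] := f_bound uL2 gL2 ug; exists B => y _; exact: BP.
Qed.

Lemma flow_half_H2 t : 0 <= t -> half_H2 (half_flow0 t) (half_flow1 t) (half_flow2 t).
Proof.
move=> t0; split.
- exact: (L2_half_flow t L0 H0).1.
- exact: (L2_half_flow t L1 H1).1.
- exact: (L2_half_flow t L2' H2).1.
- move: t0; rewrite le_eqVlt => /orP[/eqP<-|t0]; first by rewrite /half_flow0 half_flow_init.
  (* At [x = 0] both parts evaluate [hA f0 t] at the point [t], with opposite signs. *)
  rewrite /half_flow0 half_flow_ge0// (drift_flowE _ L0 H0 t0) (hA_lin (-1) 0 _ L0 L0 t0).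
  by rewrite add0r subr0 oppr0 expR0; ring.
- by apply: abscontp_half_flow => // s s0 x; exact: der_drift_flow0.
- by apply: abscontp_half_flow => // s s0 x; exact: der_drift_flow1.
- by apply: half_flow_bounded => //; exact: abscont_half_bounded ac0.
- by apply: half_flow_bounded => //; exact: abscont_half_bounded ac1.
Qed.

(** The bounds below add up to coefficients 12, 38 and 10 for the squared norms of [f0], [f1] and
    [f2], all at most 40. *)
Lemma flow_norm2 t : 0 <= t ->
  norm2 (half_flow0 t) + norm2 (half_flow1 t) + norm2 (half_flow2 t) <= 40 * (norm2 f0 + norm2 f1 + norm2 f2).
Proof.
move=> t0.
have [_ h0] := L2_half_flow t L0 H0; have [_ h1] := L2_half_flow t L1 H1; have [_ h2] := L2_half_flow t L2' H2.
have Lk := L2_f2_2f1 L1 L2'.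
have m0 : norm2 (refl0 f0) <= 1 * norm2 f0 + 0 * norm2 f0.
  apply: (norm2_le2 ler01 (lexx 0) H0 L0 L0) => x.
  by rewrite /refl0 !mul0r !addr0 mul1r mulN1r sqrrN.
have m1 : norm2 (refl1 f0 f1) <= 2 * norm2 f1 + 2 * norm2 f0.
  by apply: (norm2_le2 (ler0n _ 2) (ler0n _ 2) H1 L1 L0) => x; rewrite /refl1 !mul1r sqrD_le.
have m2 : norm2 (refl2 f0 f1 f2) <= 2 * norm2 (fun x => 1 * f2 x + 2 * f1 x) + 2 * norm2 f0.
  apply: (norm2_le2 (ler0n _ 2) (ler0n _ 2) H2 Lk L0) => x.
  by rewrite /refl2 -mulrDr mulN1r sqrrN sqrD_le.
have m3 : norm2 (fun x => 1 * f2 x + 2 * f1 x) <= 2 * norm2 f2 + 8 * norm2 f1.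
  apply: (norm2_le2 (ler0n _ 2) (ler0n _ 8) Lk L2' L1) => x.
  apply: (le_trans (sqrD_le _ _)); rewrite mul1r.
  by rewrite (_ : 2 * (2 * f1 x) ^+ 2 = 8 * f1 x ^+ 2)//; ring.
have := norm2_ge0 f0; have := norm2_ge0 f1; have := norm2_ge0 f2; move: h0 h1 h2 m0 m1 m2 m3.
rewrite /half_flow0 /half_flow1 /half_flow2; move: (norm2 (half_flow f0 _ t)) (norm2 (half_flow f1 _ t)) (norm2 (half_flow f2 _ t)).
move: (norm2 (refl0 _)) (norm2 (refl1 _ _)) (norm2 (refl2 _ _ _)) (norm2 (fun x => 1 * f2 x + _)).
by move: (norm2 f0) (norm2 f1) (norm2 f2); clear; move=> *; lra.
Qed.

Lemma flow_near t0 e : 0 <= t0 -> 0 < e -> exists2 d : R, 0 < d &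
  forall t, 0 <= t -> `|t - t0| < d ->
  norm2 (fun x => half_flow0 t x - half_flow0 t0 x) + norm2 (fun x => half_flow1 t x - half_flow1 t0 x) +
  norm2 (fun x => half_flow2 t x - half_flow2 t0 x) < e.
Proof.
move=> t00 e0; have e6 : 0 < e / 6 by rewrite divr_gt0.
have [D0 D00 h0] := norm2_half_flowB L0 H0 e6; have [D1 D10 h1] := norm2_half_flowB L1 H1 e6.
have [D2 D20 h2] := norm2_half_flowB L2' H2 e6.
(* The three errors [e / 6] use up half of [e]; the continuous function [k], which vanishes at [t0],
   stays below the other half. *)
pose k t := (D0 + D1 + D2) * ((t - t0) ^+ 2 + (Num.sqrt (2 * t) - Num.sqrt (2 * t0)) ^+ 2).
have kc : k t @[t --> t0] --> k t0.
  apply: cvgM; first exact: cvg_cst.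
  apply: cvgD.
    apply: (cvg_comp (fun t => t - t0) (fun y => y ^+ 2)); last exact: exprn_continuous.
    by apply: cvgB; [exact: cvg_id|exact: cvg_cst].
  apply: (cvg_comp (fun t => Num.sqrt (2 * t) - Num.sqrt (2 * t0)) (fun y => y ^+ 2)); last exact: exprn_continuous.
  apply: cvgB; last exact: cvg_cst.
  apply: (cvg_comp (fun t => 2 * t) Num.sqrt); last exact: sqrt_continuous.
  by apply: cvgM; [exact: cvg_cst|exact: cvg_id].
have k0 : k t0 = 0 by rewrite /k !subrr expr0n/= addr0 mulr0.
have e2 : 0 < e / 2 by rewrite divr_gt0.
have /cvgrPdist_lt/(_ _ e2) [d /= d0 dP] := kc.
exists d => // t tge0 td; have := dP t; rewrite /ball/= distrC => /(_ td).
rewrite k0 sub0r normrN => kt; have {}kt := le_lt_trans (ler_norm _) kt.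
have := h0 t t0 tge0 t00; have := h1 t t0 tge0 t00; have := h2 t t0 tge0 t00.
move: kt; rewrite /k /half_flow0 /half_flow1 /half_flow2.
move: (norm2 (fun x => half_flow f0 _ t x - _)) (norm2 (fun x => half_flow f1 _ t x - _)) (norm2 (fun x => half_flow f2 _ t x - _)).
by move: (_ ^+ 2 + _ ^+ 2); clear; move=> S *; lra.
Qed.

Lemma flow_decay e : 0 < e -> exists2 T : R, 0 < T & forall t, T < t -> forall y, 0 <= y ->
  [/\ `|half_flow0 t y| <= e, `|half_flow1 t y| <= e & `|half_flow2 t y| <= e].
Proof.
move=> e0.
pose K := norm2 f0 + norm2 (refl0 f0) + (norm2 f1 + norm2 (refl1 f0 f1)) + (norm2 f2 + norm2 (refl2 f0 f1 f2)).
have K0 : 0 <= K by rewrite !addr_ge0// norm2_ge0.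
have u0 : 0 <= 2 * K / e ^+ 2 by apply: divr_ge0; [exact: mulr_ge0|exact: sqr_ge0].
(* Beyond this time [sqrt (2 t)] exceeds [2 * K / e ^+ 2], so the squared sup bound
   [2 * K / sqrt (2 t)] is at most [e ^+ 2]. *)
exists ((1 + 2 * K / e ^+ 2) ^+ 2) => [|t tT y y0].
  by rewrite exprn_gt0// ltr_pwDl.
have t0 : 0 < t by apply: le_lt_trans tT; rewrite sqr_ge0.
set v := 1 + _ in tT.
have v0 : 0 < v by rewrite /v ltr_pwDl.
have vd : v <= Num.sqrt (2 * t).
  rewrite -(ger0_norm (ltW v0)) -sqrtr_sqr ler_sqrt; last by rewrite mulr_ge0// ltW.
  by apply: (le_trans (ltW tT)); rewrite ler_peMl// ?(ltW t0)// ler1n.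
have d0 : 0 < Num.sqrt (2 * t) by exact: lt_le_trans vd.
have key N : 0 <= N -> N <= K -> 2 * (Num.sqrt (2 * t))^-1 * N <= e ^+ 2.
  move=> N0 NK; rewrite -mulrA mulrCA mulrC ler_pdivrMr//.
  have ee : 0 < e ^+ 2 by rewrite exprn_gt0.
  have : e ^+ 2 * v = e ^+ 2 + 2 * K by rewrite /v; field; rewrite gt_eqF.
  have : e ^+ 2 * v <= e ^+ 2 * Num.sqrt (2 * t) by rewrite ler_pM2l.
  by move: NK N0 ee K0; clearbody K; clear; move: (e ^+ 2) (Num.sqrt _) => *; lra.
have n0 := norm2_ge0 f0; have n1 := norm2_ge0 f1; have n2' := norm2_ge0 f2.
have m0 := norm2_ge0 (refl0 f0); have m1 := norm2_ge0 (refl1 f0 f1); have m2 := norm2_ge0 (refl2 f0 f1 f2).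
have [k0 k1 k2] : [/\ norm2 f0 + norm2 (refl0 f0) <= K, norm2 f1 + norm2 (refl1 f0 f1) <= K &
    norm2 f2 + norm2 (refl2 f0 f1 f2) <= K].
  move: n0 n1 n2' m0 m1 m2; rewrite /K; move: (norm2 (refl0 _)) (norm2 (refl1 _ _)) (norm2 (refl2 _ _ _)).
  by move: (norm2 f0) (norm2 f1) (norm2 f2); clear; move=> *; split; lra.
rewrite /half_flow0 /half_flow1 /half_flow2 !half_flow_ge0//; split; apply: (sqr_norm_le (ltW e0)).
- by apply: (le_trans (drift_flow_sup L0 H0 t0 y0)); apply: key => //; exact: addr_ge0.
- by apply: (le_trans (drift_flow_sup L1 H1 t0 y0)); apply: key => //; exact: addr_ge0.
- by apply: (le_trans (drift_flow_sup L2' H2 t0 y0)); apply: key => //; exact: addr_ge0.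
Qed.

Lemma flow_init x : 0 <= x -> half_flow0 0 x = f0 x.
Proof. exact: half_flow_init. Qed.

End flow.
End half_line_sobolev.

(** * Pointwise consequences of the half-line norms *)

Section half_line_bounds.
Context {R : realType}.
Notation mu := (@lebesgue_measure R).
Implicit Types (p q f g h u : R -> R) (a b t x y e : R).

Lemma half_H2_continuous p p1 p2 x : half_H2 p p1 p2 -> 0 < x -> {for x, continuous (oddx p)}.
Proof.
move=> H x0; have [U cU UP] := abscontp_ext (half_L21 H) (half_ac H).
have e : \forall y \near x, U y = oddx p y.
  near=> y; have y0 : 0 < y by near: y; exact: lt_nbhsr.
  by rewrite oddx_pos ?ltW// UP ?ltW.
have Ex : oddx p x = U x by rewrite oddx_pos ?ltW// UP ?ltW.
change (oddx p y @[y --> x] --> oddx p x); rewrite Ex.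
by apply: cvg_trans (cU x); apply: near_eq_cvg.
Unshelve. all: by end_near. Qed.

(** The 4 is the Sobolev constant 2 times the factor 2 of the extensions. *)
Lemma half_H2_bound p p1 p2 x : half_H2 p p1 p2 -> 0 < x -> p x ^+ 2 <= 4 * (norm2 p + norm2 p1).
Proof.
move=> H x0; have [w1 _] := half_weak H.
have := half_sup (L2_oddx (half_L2 H)) (L2_evenx (half_L21 H)) w1
  (fun y hy => half_H2_continuous H hy) x0.
rewrite oddx_pos ?(ltW x0)//; have := norm2_oddx (half_L2 H); have := norm2_evenx (half_L21 H).
by move: (norm2 p) (norm2 p1) (norm2 (oddx p)) (norm2 (evenx p1)) (_ ^+ 2); clear; move=> *; lra.
Qed.

Lemma half_H2_tail p p1 p2 e : half_H2 p p1 p2 -> 0 < e ->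
  exists2 M : R, 0 <= M & forall x, M < x -> `|p x| <= e.
Proof.
move=> H e0; have [w1 _] := half_weak H.
have [M MP] := half_tail (L2_oddx (half_L2 H)) (L2_evenx (half_L21 H)) w1
  (fun y hy => half_H2_continuous H hy) e0.
exists (Num.max 0 M) => [|x]; first by rewrite le_max lexx.
rewrite gt_max => /andP[x0 Mx].
by have := MP x Mx; rewrite oddx_pos ?(ltW x0).
Qed.

Lemma half_H2_zero p p1 p2 e : half_H2 p p1 p2 -> 0 < e ->
  exists2 d : R, 0 < d & forall x, 0 < x < d -> `|p x| <= e.
Proof.
move=> H e0; have [U cU UP] := abscontp_ext (half_L21 H) (half_ac H).
have U0 : U 0 = 0 by rewrite -UP// (half_at0 H).
have /cvgrPdist_le/(_ _ e0) [d /= d0 dP] := cU 0.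
exists d => // x /andP[x0 xd]; have := dP x.
rewrite /ball/= U0 !sub0r !normrN gtr0_norm// => /(_ xd).
by rewrite UP// ltW.
Qed.

Lemma oddx_odd p : p 0 = 0 -> odd_fun (oddx p).
Proof.
move=> p0 x; rewrite /oddx oppr_ge0 opprK; have [x0|x0|->] := ltgtP x 0.
- by rewrite opprK.
- by [].
- by rewrite oppr0 p0 oppr0.
Qed.

Lemma H2_norm_lt_sub f g a b : H2_norm_lt f a -> H2_norm_lt g b ->
  exists g1, [/\ L2 (fun x => f x - g x), L2 g1, weak_deriv (fun x => f x - g x) g1 &
    norm2 (fun x => f x - g x) + norm2 g1 <= 2 * (a ^+ 2 + b ^+ 2)].
Proof.
move=> /H2_norm_ltP[u1 [u2 [hf h1 h2 [w1 _] hlt]]] /H2_norm_ltP[v1 [v2 [kf k1 k2 [z1 _] klt]]].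
exists (fun x => u1 x - v1 x); split.
- exact: L2B.
- exact: L2B.
- exact: weak_derivB.
have sub (r s : R -> R) : L2 r -> L2 s -> norm2 (fun x => r x - s x) <= 2 * norm2 r + 2 * norm2 s.
  move=> rL2 sL2; apply: (norm2_le2 (ler0n _ 2) (ler0n _ 2) (L2B rL2 sL2) rL2 sL2) => x.
  by apply: (le_trans (sqrD_le _ _)); rewrite sqrrN.
have := sub _ _ hf kf; have := sub _ _ h1 k1; have := norm2_ge0 u2; have := norm2_ge0 v2.
move: hlt klt; move: (norm2 f) (norm2 g) (norm2 u1) (norm2 v1) (norm2 u2) (norm2 v2) (norm2 (fun x => f x - _)) (norm2 (fun x => u1 x - _)).
by move: (a ^+ 2) (b ^+ 2); clear; move=> *; lra.
Qed.

End half_line_bounds.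

(** * The linear equation on the open half line *)

Section drift_heat.
Context {R : realType}.
Implicit Types (z u v : R -> R -> R) (t x : R).

Definition drift_heat z := forall t x, 0 < t -> 0 < x ->
  [/\ derivable (fun s => z s x) t 1, derivable (z t) x 1, derivable (derive1 (z t)) x 1 &
   derive1 (fun s => z s x) t = derive1 (z t) x + derive1 (derive1 (z t)) x].

(** With the derivatives named, linear combinations and changes of representative become pointwise
    computations. *)
Lemma drift_heatP z : drift_heat z <-> exists z1 z2 : R -> R -> R, forall t x, 0 < t -> 0 < x ->
  [/\ is_derive x 1 (z t) (z1 t x), is_derive x 1 (z1 t) (z2 t x) &
   is_derive t 1 (fun s => z s x) (z1 t x + z2 t x)].
Proof.
split=> [H|[z1 [z2 H]] t x t0 x0].
  exists (fun t => derive1 (z t)), (fun t => derive1 (derive1 (z t))) => t x t0 x0.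
  have [h1 h2 h3 h4] := H t x t0 x0; split.
  - by have := derivableP h2; rewrite -derive1E.
  - by have := derivableP h3; rewrite -derive1E.
  - by have := derivableP h1; rewrite -derive1E h4.
have [h1 h2 h3] := H t x t0 x0.
have e : \forall y \near x, z1 t y = derive1 (z t) y.
  near=> y; have y0 : 0 < y by near: y; exact: lt_nbhsr.
  by have [k1 _ _] := H t y t0 y0; rewrite (derive1_val k1).
have h2' := near_eq_is_derive e h2.
split.
- exact: (@ex_derive _ _ _ _ _ _ _ h3).
- exact: (@ex_derive _ _ _ _ _ _ _ h1).
- exact: (@ex_derive _ _ _ _ _ _ _ h2').
- by rewrite (derive1_val h3) (derive1_val h1) (derive1_val h2').
Unshelve. all: by end_near. Qed.

Lemma drift_heat_lin (a b : R) u v : drift_heat u -> drift_heat v ->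
  drift_heat (fun t x => a * u t x + b * v t x).
Proof.
move=> /drift_heatP[u1 [u2 U]] /drift_heatP[v1 [v2 V]]; apply/drift_heatP.
exists (fun t x => a * u1 t x + b * v1 t x), (fun t x => a * u2 t x + b * v2 t x).
move=> t x t0 x0; have [U1 U2 U3] := U t x t0 x0; have [V1 V2 V3] := V t x t0 x0; split.
- exact: derD (derZ _ U1) (derZ _ V1).
- exact: derD (derZ _ U2) (derZ _ V2).
- by apply: (is_derive_eq (derD (derZ a U3) (derZ b V3))); ring.
Qed.

Lemma drift_heat_ext u v : drift_heat u -> (forall t x, 0 < t -> 0 < x -> u t x = v t x) ->
  drift_heat v.
Proof.
move=> /drift_heatP[u1 [u2 U]] uv; apply/drift_heatP; exists u1, u2 => t x t0 x0.
have [U1 U2 U3] := U t x t0 x0; split=> //.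
- apply: near_eq_is_derive U1; near=> y.
  by apply: uv => //; near: y; exact: lt_nbhsr.
- apply: near_eq_is_derive U3; near=> s.
  by apply: uv => //; near: s; exact: lt_nbhsr.
Unshelve. all: by end_near. Qed.

Lemma drift_heat_shock : drift_heat (fun _ x => 1 - expR (- x)).
Proof.
apply/drift_heatP; exists (fun _ x => expR (- x)), (fun _ x => - expR (- x)) => t x t0 x0; split.
- by apply: (is_derive_eq (derB (is_derive_cst (1 : R) x 1) (der_expN x))); rewrite sub0r opprK.
- exact: der_expN.
- by rewrite subrr; exact: is_derive_cst.
Qed.

End drift_heat.

(** * Comparison and uniqueness *)

Section uniqueness.
Context {R : realType}.
Notation mu := (@lebesgue_measure R).
Implicit Types (v w : R -> R -> R) (t x : R).

Lemma is_derive_continuous_at (f : R -> R) (x df : R) : is_derive x 1 f df -> {for x, continuous f}.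
Proof.
by move=> h; apply: differentiable_continuous; apply/derivable1_diffP; exact: (@ex_derive _ _ _ _ _ _ _ h).
Qed.

(** The 8 is the 2 of [half_sup] times the [2 (d^2 + d^2)] of [H2_norm_lt_sub]. *)
Lemma small_sqr (e : R) : 0 < e -> exists2 d : R, 0 < d & 8 * d ^+ 2 <= e ^+ 2.
Proof.
move=> e0; exists (e / 4); first by rewrite divr_gt0.
by rewrite expr_div_n; have := sqr_ge0 e; lra.
Qed.

(** [W0] cancels in the difference, which solves the linear equation. Its limits at 0 and at
    infinity and its uniform continuity in time are not part of [mburgers_sol]: they come from
    oddness and from [H2_class] through the Sobolev bounds. *)
Lemma comparison v w (w0 : R -> R) : mburgers_sol v w0 -> mburgers_sol w w0 -> H2_class v -> H2_class w ->
  forall t x, 0 <= t -> 0 < x -> w t x <= v t x.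
Proof.
move=> [v0 vo vE vp vl] [w0' wo wE wp wl] [vH vC] [wH wC] t x t0 x0.
pose z t x := 1 * v t x + (-1) * w t x.
have zE t' : z t' = (fun x => v t' x - w t' x).
  by apply/funext => y; rewrite /z mul1r mulN1r.
have z0 y : z 0 y = 0 by rewrite zE v0 w0' subrr.
have hz : drift_heat z := drift_heat_lin 1 (-1) vE wE.
(* [v 0] and [w 0] need not be continuous, but their difference vanishes. *)
have zc t' y : 0 <= t' -> 0 < y -> {for y, continuous (z t')}.
  rewrite le_eqVlt => /orP[/eqP<-|t'0] y0.
    by rewrite (_ : z 0 = fun=> 0); [exact: cvg_cst|apply/funext => y'; exact: z0].
  by have [_ h _ _] := hz t' y t'0 y0; apply: is_derive_continuous_at (derivableP h).
have zH t' : 0 <= t' -> exists g1, [/\ L2 (z t'), L2 g1 & weak_deriv (z t') g1].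
  move=> t'0; have [a va] := vH t' t'0; have [b wb] := wH t' t'0.
  have E : (fun x => (v t' x - W0 x) - (w t' x - W0 x)) = z t'.
    by rewrite zE; apply/funext => y; ring.
  by have [g1 [h1 h2 h3 _]] := H2_norm_lt_sub va wb; exists g1; rewrite E in h1 h3.
have zodd t' : 0 <= t' -> odd_fun (z t').
  by move=> t'0 y; rewrite zE vo// wo//; ring.
suff : 0 <= z t x by rewrite zE subr_ge0.
apply: weak_max_principle => //.
- by move=> y _; rewrite z0.
- move=> t' t'0 e e0; have [g1 [h1 h2 h3]] := zH t' (ltW t'0).
  have [d d0 dP] := half_zero h1 h2 h3 (zodd t' (ltW t'0)) (fun y hy => zc t' y (ltW t'0) hy) e0.
  by exists d => // y /dP; rewrite ler_norml => /andP[].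
- move=> t' t'0 e e0; have [g1 [h1 h2 h3]] := zH t' (ltW t'0).
  have [M MP] := half_tail h1 h2 h3 (fun y hy => zc t' y (ltW t'0) hy) e0.
  by exists M => y /MP; rewrite ler_norml => /andP[].
- move=> s s0 e e0; have [d d0 dP] := small_sqr e0.
  have [d1 [d10 h1]] := vC s s0 d d0; have [d2 [d20 h2]] := wC s s0 d d0.
  exists (Num.min d1 d2) => [|t' t'0]; first by rewrite lt_min d10.
  rewrite lt_min => /andP[/(h1 _ t'0) k1 /(h2 _ t'0) k2] y y0.
  have [g1 [l1 l2 l3 l4]] := H2_norm_lt_sub k1 k2.
  have E : (fun x => (v t' x - v s x) - (w t' x - w s x)) = (fun x => z t' x - z s x).
    by rewrite !zE; apply/funext => y'; ring.
  rewrite E in l1 l3 l4.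
  have cc y' : 0 < y' -> {for y', continuous (fun x => z t' x - z s x)}.
    by move=> hy; apply: cvgB; exact: zc.
  apply: (sqr_norm_le (ltW e0)); apply: le_trans (half_sup l1 l2 l3 cc y0) _.
  apply: le_trans dP; move: l4; move: (norm2 _) (norm2 g1) (d ^+ 2); clear; move=> *; lra.
Qed.

Lemma solution_unique v w (w0 : R -> R) : mburgers_sol v w0 -> mburgers_sol w w0 -> H2_class v -> H2_class w ->
  forall t x, 0 <= t -> v t x = w t x.
Proof.
move=> vS wS vH wH t x t0.
have pos y : 0 < y -> v t y = w t y.
  by move=> y0; apply/le_anti; rewrite (comparison vS wS vH wH t0 y0) (comparison wS vS wH vH t0 y0).
have [vo wo] : odd_fun (v t) /\ odd_fun (w t) by split; [case: vS|case: wS] => _ h _ _ _; exact: h.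
have odd0 (f : R -> R) : odd_fun f -> f 0 = 0.
  by move=> fo; have := fo 0; rewrite oppr0; lra.
have [x0|x0|->] := ltgtP x 0; last by rewrite !odd0.
- by rewrite -(opprK x) vo wo pos// oppr_gt0.
- exact: pos.
Qed.

Lemma W0_pos x : 0 <= x -> W0 x = 1 - expR (- x).
Proof.
rewrite le_eqVlt => /orP[/eqP<-|x0]; first by rewrite /W0 sgr0 oppr0 expR0 subrr mul0r.
by rewrite /W0 gtr0_sg// gtr0_norm// mul1r.
Qed.

Lemma W0_odd : odd_fun (@W0 R).
Proof. by move=> x; rewrite /W0 sgrN normrN mulNr. Qed.

End uniqueness.

(** * The solution and its properties *)

Section existence.
Context {R : realType}.
Notation mu := (@lebesgue_measure R).
Implicit Types (t x y e : R).

(** The weak derivative is replaced by its continuous representative before [f] is treated in the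
    same way. Continuity makes [f0] odd at every point, and [f0 0 = 0] follows. *)
Lemma odd_H2_rep (f : R -> R) (d : R) : odd_fun f -> H2_norm_lt f d ->
  exists f0 f1 f2 : R -> R, [/\ L2 f0 /\ L2 f1, L2 f2, abscont f0 f1 /\ abscont f1 f2, f0 0 = 0 &
    {ae mu, forall x, oddx f0 x = f x} /\ norm2 f0 + norm2 f1 + norm2 f2 < d ^+ 2].
Proof.
move=> fo /H2_norm_ltP[g1 [f2 [fL2 g1L2 f2L2 [w1 w2] lt]]].
have [f1 [ac1 gf1]] := weak_deriv_rep g1L2 f2L2 w2.
have f1L2 : L2 f1.
  by apply: L2_ae gf1 => //; apply: continuous_measurable_fun; exact: AC_continuous ac1.
have w1' : weak_deriv f f1.
  by apply: (weak_deriv_ae fL2 fL2 g1L2 f1L2 _ gf1 w1); apply: aeW.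
have [f0 [ac0 ff0]] := weak_deriv_rep fL2 f1L2 w1'.
have cf0 := AC_continuous f1L2 ac0.
have mf0 : measurable_fun setT f0 by exact: continuous_measurable_fun.
have f0L2 : L2 f0 by exact: L2_ae ff0.
have f0o x : f0 x + f0 (- x) = 0.
  apply: (@ae_eq_continuous_at R (fun x => f0 x + f0 (- x))); last first.
    apply: cvgD; first exact: cf0.
    by apply: (cvg_comp (fun y => - y) f0); [apply: cvgN; exact: cvg_id|exact: cf0].
  by apply: (aeS2 _ ff0 (aeN ff0)) => y <- <-; rewrite fo subrr.
have f00 : f0 0 = 0 by have := f0o 0; rewrite oppr0; lra.
exists f0, f1, f2; split => //; split.
  apply: aeS ff0 => x ->; rewrite /oddx; case: ifP => // _.
  by apply/eqP; rewrite eq_sym -subr_eq0 opprK f0o.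
by rewrite /norm2 -(enorm2_ae fL2.1 mf0 ff0) -(enorm2_ae g1L2.1 f1L2.1 gf1).
Qed.

Section solution.
Variables (w0 f0 f1 f2 : R -> R).
Hypothesis w0o : odd_fun w0.
Hypothesis L0 : L2 f0.
Hypothesis L1 : L2 f1.
Hypothesis L2' : L2 f2.
Hypothesis ac0 : abscont f0 f1.
Hypothesis ac1 : abscont f1 f2.
Hypothesis f00 : f0 0 = 0.
Hypothesis w0L2 : L2 (fun x => w0 x - W0 x).
Hypothesis fw : {ae mu, forall x, oddx f0 x = w0 x - W0 x}.

Let q0 := half_flow0 f0.
Let q1 := half_flow1 f0 f1.
Let q2 := half_flow2 f0 f1 f2.
Let Hq t (t0 : 0 <= t) : half_H2 (q0 t) (q1 t) (q2 t) := flow_half_H2 L0 L1 L2' ac0 ac1 f00 t0.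

(* [w0] agrees with [W0 + oddx f0] only almost everywhere. *)
Definition sol t x := if t == 0 then w0 x else W0 x + oddx (q0 t) x.

Lemma sol_pos_time t x : 0 < t -> sol t x = W0 x + oddx (q0 t) x.
Proof. by move=> t0; rewrite /sol gt_eqF. Qed.

Lemma sol_ae t : 0 <= t -> {ae mu, forall x, oddx (q0 t) x = sol t x - W0 x}.
Proof.
rewrite le_eqVlt => /orP[/eqP<-|t0].
  apply: aeS fw => x; rewrite /sol eqxx => <-.
  by rewrite /oddx /q0; case: leP => x0; rewrite flow_init// oppr_ge0 ltW.
by apply: aeW => x; rewrite sol_pos_time// addrAC subrr add0r.
Qed.

Lemma measurable_sol t : 0 <= t -> measurable_fun setT (fun x => sol t x - W0 x).
Proof.
rewrite le_eqVlt => /orP[/eqP<-|t0].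
  have -> : (fun x => sol 0 x - W0 x) = (fun x => w0 x - W0 x).
    by apply/funext => x; rewrite /sol eqxx.
  exact: w0L2.1.
have -> : (fun x => sol t x - W0 x) = oddx (q0 t).
  by apply/funext => x; rewrite sol_pos_time// addrAC subrr add0r.
by apply: measurable_oddx; exact: (half_L2 (Hq (ltW t0))).1.
Qed.

(** The extensions double the 40 of [flow_norm2], and 80 is at most [10 ^+ 2]. *)
Lemma sol_H2 (d eps t : R) : 0 <= d -> 10 * d <= eps -> norm2 f0 + norm2 f1 + norm2 f2 < d ^+ 2 ->
  0 <= t -> H2_norm_lt (fun x => sol t x - W0 x) eps.
Proof.
move=> d0 deps fd t0; apply: (half_H2_norm (Hq t0) (measurable_sol t0) (sol_ae t0)).
have := flow_norm2 L0 L1 L2' t0; rewrite -/q0 -/q1 -/q2.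
have : (10 * d) ^+ 2 <= eps ^+ 2 by rewrite ler_pXn2r ?nnegrE ?mulr_ge0// ?(le_trans _ deps) ?mulr_ge0.
rewrite exprMn; move: fd; move: (norm2 (q0 t)) (norm2 (q1 t)) (norm2 (q2 t)) (norm2 f0) (norm2 f1) (norm2 f2).
by have := sqr_ge0 d; move: (d ^+ 2) (eps ^+ 2); move=> *; lra.
Qed.

Lemma sol_H2_class : H2_class sol.
Proof.
split=> [t t0|t0 t00 e e0].
  (* The sum of squared norms is below [d], and [d <= d ^+ 2] because [d >= 1]. *)
  pose d := norm2 f0 + norm2 f1 + norm2 f2 + 1.
  have d1 : 1 <= d by rewrite lerDr !addr_ge0// norm2_ge0.
  exists (10 * d); apply: (sol_H2 (d := d)) => //; first exact: le_trans d1.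
  by apply: (@lt_le_trans _ _ d); [rewrite ltrDl|rewrite expr2 ler_peMl// (le_trans _ d1)].
have [r r0 rP] := flow_near L0 L1 L2' t00 (exprn_gt0 2 (divr_gt0 e0 (ltr0n _ 2))).
exists r; split => // t tge0 td.
apply: (half_H2_norm (half_H2B (Hq tge0) (Hq t00))).
- have -> : (fun x => sol t x - sol t0 x) =
      (fun x => (sol t x - W0 x) - (sol t0 x - W0 x)).
    by apply/funext => x; rewrite opprB addrA subrK.
  exact: measurable_funB (measurable_sol tge0) (measurable_sol t00).
- apply: (aeS2 _ (sol_ae tge0) (sol_ae t00)) => x h1 h2.
  by rewrite oddxB h1 h2 opprB addrA subrK.
have := rP t tge0 td; rewrite expr_div_n; have := sqr_ge0 e.
rewrite -/q0 -/q1 -/q2.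
move: (norm2 (fun x => q0 t x - _)) (norm2 (fun x => q1 t x - _)) (norm2 (fun x => q2 t x - _)).
by move: (e ^+ 2); move=> *; lra.
Qed.

Lemma flow_drift_heat : drift_heat q0.
Proof.
have h : drift_heat (drift_flow0 f0).
  apply/drift_heatP; exists (drift_flow1 f0 f1), (drift_flow2 f0 f1 f2) => t x t0 x0; split.
  - exact: der_drift_flow0.
  - exact: der_drift_flow1.
  - exact: der_drift_flow0_time.
apply: (drift_heat_ext h) => t x t0 x0.
by rewrite /q0 /half_flow0 half_flow_ge0// ltW.
Qed.

Lemma sol_half t x : 0 < t -> 0 <= x -> sol t x = 1 - expR (- x) + q0 t x.
Proof. by move=> t0 x0; rewrite sol_pos_time// W0_pos// oddx_pos. Qed.

Lemma sol_drift_heat : drift_heat sol.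
Proof.
apply: (drift_heat_ext (drift_heat_lin 1 1 drift_heat_shock flow_drift_heat)) => t x t0 x0.
by rewrite sol_half ?ltW// !mul1r.
Qed.

(** A sup bound on [f0] is useless near 0, where the shock vanishes too; there the bound on [f1]
    makes [f0] small in proportion to [x]. This needs the second derivative in the norm. *)
Lemma init_lower (d x : R) : 0 <= d -> d <= 8^-1 -> norm2 f0 + norm2 f1 + norm2 f2 < d ^+ 2 ->
  0 < x -> 0 <= f0 x + (1 - expR (- x)) / 2.
Proof.
move=> d0 d8 fd x0.
have bd u g y : L2 u -> L2 g -> abscont u g -> norm2 u + norm2 g <= d ^+ 2 -> `|u y| <= 2 * d.
  move=> uL2 gL2 ug h; apply: sqr_norm_le; first by rewrite mulr_ge0.
  apply: (le_trans (AC_bounded uL2 gL2 ug y)); rewrite -/(norm2 u) -/(norm2 g) exprMn.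
  by have := sqr_ge0 d; move: h; move: (norm2 u) (norm2 g) (d ^+ 2); move=> *; lra.
have [h0 h1] : norm2 f0 + norm2 f1 <= d ^+ 2 /\ norm2 f1 + norm2 f2 <= d ^+ 2.
  have := norm2_ge0 f0; have := norm2_ge0 f2; move: fd.
  by move: (norm2 f0) (norm2 f1) (norm2 f2) (d ^+ 2); move=> *; split; lra.
have b0 : `|f0 x| <= 2 * d by exact: bd ac0 h0.
have b1 : - (2 * d * x) <= f0 x.
  rewrite -subr_ge0 opprK; have := ac0 (ltW x0); rewrite f00 subr0 => ->.
  have := @Rintegral_itv_cst R 0 x (2 * d) (ltW x0); rewrite subr0 => <-.
  rewrite -RintegralD//; [|exact: L2_itv|exact: integrable_itv_cst].
  apply: Rintegral_ge0 => y _; have := bd f1 f2 y L1 L2' ac1 h1.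
  by rewrite ler_norml => /andP[]; lra.
have E0 : 0 < expR (- x) by exact: expR_gt0.
have E1 : expR (- x) * (1 + x) <= 1.
  by rewrite expRN mulrC ler_pdivrMr ?expR_gt0// mul1r expR_ge1Dx.
move: b0; rewrite ler_norml => /andP[b0 _].
(* For [x <= 1]: [2 d x <= x / 4], while [1 - expR (- x) >= x / (1 + x) >= x / 2]. For [x > 1]:
   [2 d <= 1 / 4], while [1 - expR (- x) >= 1 / 2]. Both cases use [d <= 1 / 8]. *)
have [x1|x1] := leP x 1.
  have : 2 * d * x <= 4^-1 * x by rewrite ler_pM2r//; move: d8; lra.
  by move: E0 E1 b1 x1 x0; move: (expR _) (f0 x); move=> E f; nra.
have : expR (- x) * 2 <= 1.
  by apply: le_trans E1; rewrite ler_pM2l//; move: x1; lra.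
by move: b0 d8; move: (expR _) (f0 x); move=> *; lra.
Qed.

Lemma sol_gt0 (d t x : R) : 0 <= d -> d <= 8^-1 -> norm2 f0 + norm2 f1 + norm2 f2 < d ^+ 2 ->
  0 < t -> 0 < x -> 0 < sol t x.
Proof.
(* Comparison with half of the shock: [sol t x >= (1 - expR (- x)) / 2]. *)
move=> d0 d8 fd t0 x0; pose z t x := 1 * q0 t x + 2^-1 * (1 - expR (- x)).
have E1 y : 0 < y -> expR (- y) < 1 by move=> y0; rewrite -[ltRHS]expR0 ltr_expR oppr_lt0.
suff : 0 <= z t x.
  have := E1 x x0; rewrite sol_half ?(ltW x0)// /z; move: (expR _) (q0 t x).
  by move=> *; lra.
have lower t' y e : 0 < y -> `|q0 t' y| <= e -> - e <= z t' y.
  move=> y0; rewrite ler_norml => /andP[h _]; have := E1 y y0; rewrite /z.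
  by move: h; move: (expR _) (q0 t' y); move=> *; lra.
apply: weak_max_principle; [| | | | |exact: ltW|exact: x0].
- move=> y y0; have := init_lower d0 d8 fd y0; rewrite /z /q0 flow_init ?(ltW y0)//.
  by move: (expR _) (f0 y); move=> *; lra.
- exact: (drift_heat_lin 1 2^-1 flow_drift_heat drift_heat_shock).
- move=> t' t'0 e e0; have [r r0 rP] := half_H2_zero (Hq (ltW t'0)) e0.
  by exists r => // y /[dup] /andP[y0 _] /rP; exact: lower.
- move=> t' t'0 e e0; have [M M0 MP] := half_H2_tail (Hq (ltW t'0)) e0.
  by exists M => y My; apply: lower; [exact: le_lt_trans My|exact: MP].
(* The tolerance [(e / 2) ^+ 2] offsets the factor 4 of [half_H2_bound]. *)
- move=> s s0 e e0; have [r r0 rP] := flow_near L0 L1 L2' s0 (exprn_gt0 2 (divr_gt0 e0 (ltr0n _ 2))).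
  exists r => // t' t'0 td y y0.
  have -> : z t' y - z s y = q0 t' y - q0 s y by rewrite /z; ring.
  apply: (sqr_norm_le (ltW e0)).
  apply: le_trans (half_H2_bound (half_H2B (Hq t'0) (Hq s0)) y0) _.
  have := rP t' t'0 td; rewrite expr_div_n; have := norm2_ge0 (fun x => q2 t' x - q2 s x).
  rewrite -/q0 -/q1 -/q2.
  move: (norm2 (fun x => q0 t' x - _)) (norm2 (fun x => q1 t' x - _)) (norm2 (fun x => q2 t' x - _)).
  by move: (e ^+ 2); move=> *; lra.
Qed.

Lemma sol_lim t : 0 < t -> sol t x @[x --> +oo] --> (1 : R).
Proof.
move=> t0; apply/cvgrPdist_le => e e0.
have e2 : 0 < e / 2 by rewrite divr_gt0.
have [M M0 MP] := half_H2_tail (Hq (ltW t0)) e2.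
near=> x.
have xM : M < x by near: x; apply: nbhs_pinfty_gt; exact: num_real.
(* Gives [expR (- x) <= 1 / x <= e / 2], from [1 + x <= expR x]. *)
have xe : 2 / e < x by near: x; apply: nbhs_pinfty_gt; exact: num_real.
have x0 : 0 < x by exact: le_lt_trans xM.
have q : `|q0 t x| <= e / 2 by exact: MP.
have E : 0 <= expR (- x) <= e / 2.
  rewrite expR_ge0/= expRN invf_ple ?posrE ?expR_gt0// invf_div.
  by apply: le_trans (ltW xe) _; apply: le_trans (expR_ge1Dx x); rewrite lerDr.
rewrite sol_half ?(ltW x0)//.
have -> : 1 - (1 - expR (- x) + q0 t x) = expR (- x) - q0 t x by ring.
move: q E; rewrite !ler_norml => /andP[a1 a2] /andP[a3 a4].
by apply/andP; move: a1 a2 a3 a4; move: (expR _) (q0 t x); move=> *; split; lra.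
Unshelve. all: by end_near. Qed.

Lemma sol_mburgers (d : R) : 0 <= d -> d <= 8^-1 -> norm2 f0 + norm2 f1 + norm2 f2 < d ^+ 2 ->
  mburgers_sol sol w0.
Proof.
move=> d0 d8 fd; split.
- by move=> x; rewrite /sol eqxx.
- move=> t; rewrite le_eqVlt => /orP[/eqP<-|t0] x; first by rewrite /sol eqxx.
  rewrite !sol_pos_time// W0_odd (oddx_odd (half_at0 (Hq (ltW t0)))).
  by rewrite opprD.
- exact: sol_drift_heat.
- by move=> t x; exact: sol_gt0 d0 d8 fd.
- exact: sol_lim.
Qed.

Lemma sol_decay e : 0 < e -> exists T : R, forall t, T < t ->
  W2inf_norm_le (fun x => sol t x - W0 x) e.
Proof.
move=> e0; have [T T0 TP] := flow_decay L0 L1 L2' e0.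
exists T => t tT; have t0 := lt_trans T0 tT.
have -> : (fun x => sol t x - W0 x) = oddx (q0 t).
  by apply/funext => x; rewrite sol_pos_time// addrAC subrr add0r.
exact: (half_H2_sup (Hq (ltW t0)) (TP t tT)).
Qed.

End solution.
End existence.

Theorem theorem2p1 (R : realType) (eps : R) : 0 < eps ->
  exists delta : R, 0 < delta /\
  forall w0 : R -> R, odd_fun w0 ->
    H2_norm_lt (fun x => w0 x - W0 x) delta ->
    exists w : R -> R -> R,
      [/\ mburgers_sol w w0, H2_class w,
          (forall v : R -> R -> R, mburgers_sol v w0 -> H2_class v ->
             forall t x, 0 <= t -> v t x = w t x),
          (forall t, 0 < t -> H2_norm_lt (fun x => w t x - W0 x) eps) &
          (forall eta, 0 < eta -> exists T : R, forall t, T < t ->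
             W2inf_norm_le (fun x => w t x - W0 x) eta)].
Proof.
(* The bound [1 / 8] secures positivity through [init_lower], and [eps / 10] secures stability
   through [sol_H2]. *)
move=> eps0; pose d := Num.min (8^-1) (eps / 10).
have d0 : 0 < d by rewrite lt_min invr_gt0 ltr0n/= divr_gt0.
have d8 : d <= 8^-1 by rewrite ge_min lexx.
have deps : 10 * d <= eps by rewrite mulrC -ler_pdivlMr// ge_min lexx orbT.
exists d; split=> // w0 w0o w0H.
have fo : odd_fun (fun x => w0 x - W0 x) by move=> x; rewrite w0o W0_odd; ring.
have [f0 [f1 [f2 [[L0 L1] L2' [ac0 ac1] f00 [fw fd]]]]] := odd_H2_rep fo w0H.
have wL : L2 (fun x => w0 x - W0 x) by case: w0H => g1 [g2 []].
have S := sol_mburgers w0o L0 L1 L2' ac0 ac1 f00 (ltW d0) d8 fd.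
have C := sol_H2_class L0 L1 L2' ac0 ac1 f00 wL fw.
exists (sol w0 f0); split => //.
- by move=> v vS vC t x t0; exact: (solution_unique vS S vC C).
- by move=> t t0; exact: (sol_H2 L0 L1 L2' ac0 ac1 f00 wL fw (ltW d0) deps fd (ltW t0)).
- by move=> eta eta0; exact: (sol_decay w0 L0 L1 L2' ac0 ac1 f00 eta0).
Qed.
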